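(* Let $(L\rightrightarrows L_M;G\rightrightarrows M)$ be a line bundle groupoid, and let $\theta,\theta'\in\Omega^1(G,L)$ be multiplicative $1$-forms which are $\partial$-cohomologous: $\theta-\theta'=\partial\alpha$ for some $\alpha\in\Omega^1(M,L_M)$. Then the map $\mathsf A\colon\mathsf MK_\theta\to\mathsf MK_{\theta'}$ between the Morita kernels defined by $\mathsf A(v,\lambda)=(v,\lambda+(s^*\alpha)(v))$ is a VB Morita map.
   Context: A VB groupoid (VBG) $(V\rightrightarrows V_M;G\rightrightarrows M)$ consists of Lie groupoids $V\rightrightarrows V_M$, $G\rightrightarrows M$ (Hausdorff) and vector bundles $V\to G$, $V_M\to M$ such that all structure maps $s,t,m,i,u$ of $V$ are vector bundle (VB) morphisms covering those of $G$; products $gg'$ are defined when $s(g)=t(g')$. A VBG morphism $(F,f)$ is a VB morphism $F$ covering $f$ with $F$, $f$ Lie groupoid morphisms; it is a VB Morita map if $F$ is a Morita map of Lie groupoids. A line bundle groupoid is a VBG $(L\rightrightarrows L_M;G\rightrightarrows M)$ with $L\to G$, $L_M\to M$ line bundles; its structure maps are isomorphisms on fibers, and line bundle valued forms are pulled back along fiberwise invertible $(F,f)$ by $F^*\theta=F^{-1}\circ\theta\circ df$. $s_g:=s|_{L_g}$. The differential $\partial$ is $\partial\alpha=s^*\alpha-t^*\alpha$ for $\alpha\in\Omega^\bullet(M,L_M)$ and $\partial\theta=\mathrm{pr}_2^*\theta-m^*\theta+\mathrm{pr}_1^*\theta$ for $\theta\in\Omega^\bullet(G,L)$; $\theta$ is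 multiplicative if $\partial\theta=0$. The Morita kernel $\mathsf MK_\theta$ of a multiplicative $\theta\in\Omega^1(G,L)$ is the VBG $TG\oplus L\rightrightarrows TM\oplus L_M$ over $G\rightrightarrows M$ with $s(v,\lambda)=(ds(v),s(\lambda))$, $t(v,\lambda)=(dt(v),t(\lambda+\theta(v)))$, $u(v,\lambda)=(du(v),u(\lambda))$, $(v,\lambda)^{-1}=(v^{-1},s_{g^{-1}}^{-1}(t(\lambda+\theta(v))))$ for $(v,\lambda)$ over $g$, and $(v,\lambda)(v',\lambda')=(vv',s_{gg'}^{-1}(s(\lambda')))$ for composable elements over $g,g'$. *)

(* Defs.v *)
From HB Require Import structures.
From mathcomp Require Import all_boot all_order all_algebra.
From mathcomp Require Import boolp classical_sets functions reals topology.
From mathcomp Require Import normedtype derive.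

Set Implicit Arguments.
Unset Strict Implicit.
Unset Printing Implicit Defensive.

Import Order.TTheory GRing.Theory Num.Theory.
Import numFieldNormedType.Exports.

Local Open Scope classical_set_scope.
Local Open Scope ring_scope.

(** Manifolds are presented by their algebras of smooth functions, i.e. as
    differential spaces (in the sense of Sikorski) that are locally
    diffeomorphic to open subsets of R^n, Hausdorff and second countable.  This
    is the usual category of smooth manifolds.  Its advantage here is that
    subsets, products and tangent bundles of differential spaces are again
    differential spaces, and that on embedded submanifolds, products of
    manifolds and tangent bundles of manifolds these structures are the
    standard ones.

    Records below contain data only; the axioms are separate predicates
    ([manifold], [lie_groupoid], [VBG], ...).  Partially defined operations
    (sums in fibres, groupoid products, inverses of fibre maps) are
    represented by total functions whose values are irrelevant outside of
    their domains. *)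

(** * Differential spaces and manifolds *)

Fixpoint Ck {R : realType} (n k : nat) (f : 'rV[R]_n -> R) : Prop :=
  match k with
  | 0 => continuous f
  | k'.+1 => (forall x, differentiable f x) /\
             (forall v : 'rV[R]_n, Ck k' (fun x => 'D_v f x))
  end.

Definition Cinf {R : realType} (n : nat) (f : 'rV[R]_n -> R) : Prop :=
  forall k, Ck k f.

(** Neighbourhoods in the initial topology of a family [F] of real-valued
    functions. *)
Definition fnbhs {R : realType} (T : Type) (F : set (T -> R))
    (x : T) (A : set T) : Prop :=
  exists k (f : 'I_k -> T -> R) (e : R),
    [/\ forall i, F (f i), 0 < e &
        forall y, (forall i, `|f i y - f i x| < e) -> A y].

(** The differential structure generated by [F]: the functions which locally
    are smooth functions of finitely many elements of [F]. *)
Definition fgen {R : realType} (T : Type) (F : set (T -> R)) : set (T -> R) :=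
  [set h | forall x, exists k (f : 'I_k -> T -> R) (w : 'rV[R]_k -> R),
     [/\ forall i, F (f i), Cinf w &
         fnbhs F x [set y | h y = w (\row_i f i y)]]].

Record dspace (R : realType) := DSpace {
  pt :> Type;
  fct : set (pt -> R) }.
Arguments fct {R} d.

Definition dopen {R : realType} (X : dspace R) (U : set X) : Prop :=
  forall x, U x -> fnbhs (fct X) x U.

Definition smooth {R : realType} (X Y : dspace R) (f : X -> Y) : Prop :=
  forall h, fct Y h -> fct X (h \o f).

Definition euclid (R : realType) (n : nat) : dspace R :=
  @DSpace R 'rV[R]_n [set f | Cinf f].

Definition dsub {R : realType} (X : dspace R) (A : set X) : dspace R :=
  @DSpace R {x : X | A x}
    (fgen [set h | exists2 f, fct X f & h = f \o sval]).

Definition dprod {R : realType} (X Y : dspace R) : dspace R :=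
  @DSpace R (X * Y)%type
    (fgen ([set h | exists2 f, fct X f & h = f \o fst] `|`
           [set h | exists2 f, fct Y f & h = f \o snd])).

Definition smooth_on {R : realType} (X Y : dspace R) (A : set X)
    (f : X -> Y) : Prop :=
  @smooth R (dsub A) Y (f \o sval).

(** [f] restricts to a diffeomorphism from [A] to [B]. *)
Definition diffeo_on {R : realType} (X Y : dspace R) (A : set X) (B : set Y)
    (f : X -> Y) : Prop :=
  [/\ forall x, A x -> B (f x), smooth_on A f &
      exists g : Y -> X,
        [/\ forall y, B y -> A (g y), smooth_on B g,
            forall x, A x -> g (f x) = x & forall y, B y -> f (g y) = y]].

Definition manifold {R : realType} (n : nat) (X : dspace R) : Prop :=
  [/\ fgen (fct X) `<=` fct X,
      (forall x : X, exists (U : set X) (V : set (euclid R n))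
         (phi : X -> euclid R n),
         [/\ dopen U, U x, open (V : set 'rV[R]_n) & diffeo_on U V phi]),
      (forall x y : X, x <> y -> exists U V : set X,
         [/\ dopen U, dopen V, U x, V y & U `&` V = set0]) &
      (exists B : nat -> set X, (forall i, dopen (B i)) /\
         forall (x : X) (U : set X), dopen U -> U x ->
           exists2 i, B i x & B i `<=` U)].

(** * Tangent vectors, as derivations at a point *)

(** [D] is extended by [0] to the functions that are not smooth, so that a
    derivation is determined by its values on smooth functions. *)
Definition derivation_at {R : realType} (X : dspace R) (x : X)
    (D : (X -> R) -> R) : Prop :=
  [/\ forall f, ~ fct X f -> D f = 0,
      forall (a : R) f g, fct X f -> fct X g ->
        D (fun y => a * f y + g y) = a * D f + D g &
      forall f g, fct X f -> fct X g ->
        D (fun y => f y * g y) = f x * D g + g x * D f].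

Record tvec {R : realType} (X : dspace R) := TVec {
  tbase : X;
  tder : (X -> R) -> R;
  tderP : derivation_at tbase tder }.

Lemma derivation_at0 {R : realType} (X : dspace R) (x : X) :
  derivation_at x (fun=> 0).
Proof. by split=> // *; rewrite !mulr0 addr0. Qed.

Definition tzero {R : realType} (X : dspace R) (x : X) : tvec X :=
  TVec (derivation_at0 x).

(** The tangent vector at [x] given by [D]; the zero vector if [D] is not a
    derivation at [x], which does not occur on well-formed arguments. *)
Definition mktvec {R : realType} (X : dspace R) (x : X) (D : (X -> R) -> R) :
    tvec X :=
  if pselect (derivation_at x D) is left h then TVec h else tzero x.

Definition tspace {R : realType} (X : dspace R) : dspace R :=
  @DSpace R (tvec X)
    (fgen ([set h | exists2 f, fct X f & h = f \o @tbase R X] `|`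
           [set h | exists2 f, fct X f & h = fun v => tder v f])).

(** The tangent map [df], for smooth [f]. *)
Definition tmap {R : realType} (X Y : dspace R) (f : X -> Y)
    (v : tspace X) : tspace Y :=
  mktvec (f (tbase v))
    (fun h => if pselect (fct Y h) then tder v (h \o f) else 0).

Definition submersion {R : realType} (X Y : dspace R) (f : X -> Y) : Prop :=
  smooth f /\
  forall (x : X) (w : tspace Y), tbase w = f x ->
    exists2 v : tspace X, tbase v = x & tmap f v = w.

(** * Vector bundles *)

(** [vadd] is only meaningful on vectors in the same fibre. *)
Record vbstr {R : realType} (E B : dspace R) := VBStr {
  vproj : E -> B;
  vzero : B -> E;
  vadd : E -> E -> E;
  vscale : R -> E -> E;
  vprojK : forall b, vproj (vzero b) = b }.

Definition vsub {R : realType} (E B : dspace R) (S : vbstr E B) (e e' : E) : E :=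
  vadd S e (vscale S (-1) e').

(** Local triviality by fibrewise linear maps makes the fibres vector spaces
    for the given operations. *)
Definition vector_bundle {R : realType} (r : nat) (E B : dspace R)
    (S : vbstr E B) : Prop :=
  [/\ (forall e e', vproj S e = vproj S e' ->
         vproj S (vadd S e e') = vproj S e),
      (forall a e, vproj S (vscale S a e) = vproj S e) &
      (forall b : B, exists (U : set B) (phi : E -> 'rV[R]_r),
         [/\ dopen U /\ U b,
             @diffeo_on R E (dprod B (euclid R r))
               [set e | U (vproj S e)] [set p | U p.1]
               (fun e => (vproj S e, phi e)),
             (forall x, U x -> phi (vzero S x) = 0),
             (forall e e', U (vproj S e) -> vproj S e = vproj S e' ->
                phi (vadd S e e') = phi e + phi e') &
             (forall a e, U (vproj S e) ->
                phi (vscale S a e) = a *: phi e)])].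

Definition vb_morphism {R : realType} (E B E' B' : dspace R)
    (S : vbstr E B) (S' : vbstr E' B') (F : E -> E') (f : B -> B') : Prop :=
  [/\ smooth F, smooth f,
      forall e, vproj S' (F e) = f (vproj S e),
      forall e e', vproj S e = vproj S e' ->
        F (vadd S e e') = vadd S' (F e) (F e') &
      forall a e, F (vscale S a e) = vscale S' a (F e)].

Definition tbundle {R : realType} (X : dspace R) : vbstr (tspace X) X :=
  @VBStr R (tspace X) X (@tbase R X) (@tzero R X)
    (fun v w => mktvec (tbase v) (fun h => tder v h + tder w h))
    (fun a v => mktvec (tbase v) (fun h => a * tder v h))
    (fun _ => erefl).

(** The external product bundle over [B * B']. *)
Definition vbprod {R : realType} (E B E' B' : dspace R)
    (S : vbstr E B) (S' : vbstr E' B') : vbstr (dprod E E') (dprod B B') :=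
  @VBStr R (dprod E E') (dprod B B')
    (fun e => (vproj S e.1, vproj S' e.2))
    (fun b => (vzero S b.1, vzero S' b.2))
    (fun e e' => (vadd S e.1 e'.1, vadd S' e.2 e'.2))
    (fun a e => (vscale S a e.1, vscale S' a e.2))
    (fun b => match b with
              | (b1, b2) => f_equal2 pair (vprojK S b1) (vprojK S' b2)
              end).

Definition wsum_set {R : realType} (E E' B : dspace R)
    (S : vbstr E B) (S' : vbstr E' B) : set (dprod E E') :=
  [set p | vproj S' p.2 = vproj S p.1].

(** The total space of the Whitney sum. *)
Definition wsum {R : realType} (E E' B : dspace R)
    (S : vbstr E B) (S' : vbstr E' B) : dspace R := dsub (wsum_set S S').

(** The element [(e, e')] of the Whitney sum, for [e], [e'] over the same
    point; the default [(e, 0)] does not occur on well-formed arguments. *)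
Definition wpair {R : realType} (E E' B : dspace R)
    (S : vbstr E B) (S' : vbstr E' B) (e : E) (e' : E') : wsum S S' :=
  if pselect (wsum_set S S' (e, e')) is left h then exist _ (e, e') h
  else exist _ (e, vzero S' (vproj S e)) (vprojK S' (vproj S e)).

Lemma wpair_fst {R : realType} (E E' B : dspace R)
    (S : vbstr E B) (S' : vbstr E' B) (e : E) (e' : E') :
  (sval (wpair S S' e e')).1 = e.
Proof. by rewrite /wpair; case: pselect. Qed.

Lemma wpair_projK {R : realType} (E E' B : dspace R)
    (S : vbstr E B) (S' : vbstr E' B) (b : B) :
  vproj S (sval (wpair S S' (vzero S b) (vzero S' b))).1 = b.
Proof. by rewrite wpair_fst vprojK. Qed.

Definition whitney {R : realType} (E E' B : dspace R)
    (S : vbstr E B) (S' : vbstr E' B) : vbstr (wsum S S') B :=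
  @VBStr R (wsum S S') B
    (fun p => vproj S (sval p).1)
    (fun b => wpair S S' (vzero S b) (vzero S' b))
    (fun p q => wpair S S' (vadd S (sval p).1 (sval q).1)
                           (vadd S' (sval p).2 (sval q).2))
    (fun a p => wpair S S' (vscale S a (sval p).1) (vscale S' a (sval p).2))
    (wpair_projK S S').

(** * Lie groupoids *)

Record groupoid (R : realType) := Groupoid {
  arr : dspace R;
  obj : dspace R;
  src : arr -> obj;
  tgt : arr -> obj;
  mul : arr -> arr -> arr;
  unt : obj -> arr;
  ginv : arr -> arr }.

Definition composable {R : realType} (G : groupoid R) :
    set (dprod (arr G) (arr G)) :=
  [set p | src p.1 = tgt p.2].

Definition gmul {R : realType} (G : groupoid R) (p : dprod (arr G) (arr G)) :
    arr G := mul p.1 p.2.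

Record lie_groupoid {R : realType} (G : groupoid R) : Prop := LieGroupoid {
  lg_arr : exists n, manifold n (arr G);
  lg_obj : exists n, manifold n (obj G);
  lg_src : submersion (@src R G);
  lg_tgt : submersion (@tgt R G);
  lg_mul : smooth_on (@composable R G) (@gmul R G);
  lg_unt : smooth (@unt R G);
  lg_inv : smooth (@ginv R G);
  lg_src_mul : forall g h : arr G, src g = tgt h -> src (mul g h) = src h;
  lg_tgt_mul : forall g h : arr G, src g = tgt h -> tgt (mul g h) = tgt g;
  lg_mulA : forall g h k : arr G, src g = tgt h -> src h = tgt k ->
    mul g (mul h k) = mul (mul g h) k;
  lg_src_unt : forall x : obj G, src (unt x) = x;
  lg_tgt_unt : forall x : obj G, tgt (unt x) = x;
  lg_mul1g : forall g : arr G, mul (unt (tgt g)) g = g;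
  lg_mulg1 : forall g : arr G, mul g (unt (src g)) = g;
  lg_src_inv : forall g : arr G, src (ginv g) = tgt g;
  lg_tgt_inv : forall g : arr G, tgt (ginv g) = src g;
  lg_mulgV : forall g : arr G, mul g (ginv g) = unt (tgt g);
  lg_mulVg : forall g : arr G, mul (ginv g) g = unt (src g) }.

Record groupoid_morphism {R : realType} (H G : groupoid R)
    (f : arr H -> arr G) (f0 : obj H -> obj G) : Prop := GroupoidMorphism {
  gm_arr : smooth f;
  gm_obj : smooth f0;
  gm_src : forall h, src (f h) = f0 (src h);
  gm_tgt : forall h, tgt (f h) = f0 (tgt h);
  gm_mul : forall h k : arr H, src h = tgt k -> f (mul h k) = mul (f h) (f k);
  gm_unt : forall x, f (unt x) = unt (f0 x) }.

(** The canonical map from [H] to the fibre product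
    (N x N) x_(M x M) G is a diffeomorphism. *)
Definition fully_faithful {R : realType} (H G : groupoid R)
    (f : arr H -> arr G) (f0 : obj H -> obj G) : Prop :=
  @diffeo_on R (arr H) (dprod (dprod (obj H) (obj H)) (arr G))
    setT
    [set p | src p.2 = f0 p.1.1 /\ tgt p.2 = f0 p.1.2]
    (fun h => ((src h, tgt h), f h)).

(** The map G x_M N -> M, (g, y) |-> t(g), is a surjective submersion. *)
Definition essentially_surjective {R : realType} (H G : groupoid R)
    (f0 : obj H -> obj G) : Prop :=
  let P : set (dprod (arr G) (obj H)) := [set p | src p.1 = f0 p.2] in
  let q : dsub P -> obj G := fun p => tgt (sval p).1 in
  (forall x, exists p, q p = x) /\ submersion q.

Definition morita_map {R : realType} (H G : groupoid R)
    (f : arr H -> arr G) (f0 : obj H -> obj G) : Prop :=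
  [/\ groupoid_morphism f f0, fully_faithful f f0 &
      essentially_surjective f0].

(** * VB groupoids *)

(** [vtop] is the groupoid of total spaces and [vbase] the base groupoid. *)
Record vbgroupoid (R : realType) := VBGroupoid {
  vtop : groupoid R;
  vbase : groupoid R;
  varr : vbstr (arr vtop) (arr vbase);
  vobj : vbstr (obj vtop) (obj vbase) }.

(** [vg_mul*] say that the multiplication is a vector bundle morphism from the
    bundle of composable pairs of [vtop V] over the composable pairs of
    [vbase V]. *)
Record VBG {R : realType} (r r0 : nat) (V : vbgroupoid R) : Prop := IsVBG {
  vg_top : lie_groupoid (vtop V);
  vg_base : lie_groupoid (vbase V);
  vg_arr : vector_bundle r (varr V);
  vg_obj : vector_bundle r0 (vobj V);
  vg_src : vb_morphism (varr V) (vobj V) (@src R (vtop V)) (@src R (vbase V));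
  vg_tgt : vb_morphism (varr V) (vobj V) (@tgt R (vtop V)) (@tgt R (vbase V));
  vg_unt : vb_morphism (vobj V) (varr V) (@unt R (vtop V)) (@unt R (vbase V));
  vg_inv : vb_morphism (varr V) (varr V) (@ginv R (vtop V)) (@ginv R (vbase V));
  vg_mul : forall v w : arr (vtop V), src v = tgt w ->
    vproj (varr V) (mul v w) = mul (vproj (varr V) v) (vproj (varr V) w);
  vg_mulD : forall v w v' w' : arr (vtop V), src v = tgt w -> src v' = tgt w' ->
    vproj (varr V) v = vproj (varr V) v' ->
    vproj (varr V) w = vproj (varr V) w' ->
    mul (vadd (varr V) v v') (vadd (varr V) w w') =
    vadd (varr V) (mul v w) (mul v' w');
  vg_mulZ : forall a (v w : arr (vtop V)), src v = tgt w ->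
    mul (vscale (varr V) a v) (vscale (varr V) a w) =
    vscale (varr V) a (mul v w) }.

Definition line_bundle_groupoid {R : realType} (L : vbgroupoid R) : Prop :=
  VBG 1 1 L.

(** [F] covers [f]; the maps on objects are the ones induced by [F] and [f]. *)
Definition vb_morita_map {R : realType} (V W : vbgroupoid R)
    (F : arr (vtop V) -> arr (vtop W)) (f : arr (vbase V) -> arr (vbase W)) :
    Prop :=
  exists (F0 : obj (vtop V) -> obj (vtop W))
         (f0 : obj (vbase V) -> obj (vbase W)),
    [/\ vb_morphism (varr V) (varr W) F f,
        groupoid_morphism F F0, groupoid_morphism f f0 & morita_map F F0].

(** * Line bundle valued forms *)

(** A 1-form on [B] with values in the bundle [S], as a bundle map from the
    tangent bundle of [B]. *)
Definition form1 {R : realType} (E B : dspace R) (S : vbstr E B)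
    (theta : tspace B -> E) : Prop :=
  vb_morphism (tbundle B) S theta idfun.

(** The element of [A] over [b] which is mapped to [e'] by [F] (the zero
    vector if there is none). *)
Definition fibinv {R : realType} (E B E' : dspace R) (S : vbstr E B)
    (A : set E) (F : E -> E') (b : B) (e' : E') : E :=
  if pselect (exists e, [/\ A e, vproj S e = b & F e = e']) is left h
  then projT1 (cid h) else vzero S b.

(** The pull-back F^{-1} o theta o df along (F, f), where [f] is defined on a
    differential space [X] embedded in [B] by [j], and [F] on the restriction
    to [X] of the subbundle [A] of [S]. *)
Definition pullback_on {R : realType} (X E B E' B' : dspace R)
    (j : X -> B) (S : vbstr E B) (A : set E) (F : E -> E') (f : X -> B')
    (theta : tspace B' -> E') (v : tspace X) : E :=
  fibinv S A F (j (tbase v)) (theta (tmap f v)).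

Definition pullback {R : realType} (E B E' B' : dspace R)
    (S : vbstr E B) (F : E -> E') (f : B -> B')
    (theta : tspace B' -> E') : tspace B -> E :=
  pullback_on idfun S setT F f theta.

Section Forms.
Context {R : realType} (L : vbgroupoid R).
Notation G := (vbase L).
Notation LL := (vtop L).

Definition src_pullback (alpha : tspace (obj G) -> obj LL) :
    tspace (arr G) -> arr LL :=
  pullback (varr L) (@src R LL) (@src R G) alpha.

Definition tgt_pullback (alpha : tspace (obj G) -> obj LL) :
    tspace (arr G) -> arr LL :=
  pullback (varr L) (@tgt R LL) (@tgt R G) alpha.

Definition d0 (alpha : tspace (obj G) -> obj LL) (v : tspace (arr G)) : arr LL :=
  vsub (varr L) (src_pullback alpha v) (tgt_pullback alpha v).

(** The forms on composable pairs of [G] take values in composable pairs of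
    [L], a subbundle of the restriction of the external product bundle. *)
Definition pullback2 (F : dprod (arr LL) (arr LL) -> arr LL)
    (f : dprod (arr G) (arr G) -> arr G) (theta : tspace (arr G) -> arr LL) :
    tspace (dsub (@composable R G)) -> dprod (arr LL) (arr LL) :=
  pullback_on (fun p : dsub (@composable R G) => sval p)
    (vbprod (varr L) (varr L)) (@composable R LL) F
    (fun p : dsub (@composable R G) => f (sval p)) theta.

Definition d1 (theta : tspace (arr G) -> arr LL)
    (w : tspace (dsub (@composable R G))) : dprod (arr LL) (arr LL) :=
  let LxL := vbprod (varr L) (varr L) in
  vadd LxL
    (vsub LxL (pullback2 snd snd theta w)
              (pullback2 (@gmul R LL) (@gmul R G) theta w))
    (pullback2 fst fst theta w).

Definition multiplicative (theta : tspace (arr G) -> arr LL) : Prop :=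
  forall w, d1 theta w =
    vzero (vbprod (varr L) (varr L)) (sval (tbase w)).

End Forms.

(** * The Morita kernel *)

(** The product of the tangent groupoid: the image under the differential of
    the multiplication of the tangent vector [(v, v')] to the space of
    composable pairs. *)
Definition tmul {R : realType} (G : groupoid R) (v v' : tspace (arr G)) :
    tspace (arr G) :=
  let G2 := dsub (@composable R G) in
  if pselect (exists w : tspace G2,
       tmap (fun p : G2 => (sval p).1) w = v /\
       tmap (fun p : G2 => (sval p).2) w = v') is left h
  then tmap (fun p : G2 => gmul (sval p)) (projT1 (cid h)) else v.

Section MoritaKernel.
Context {R : realType} (L : vbgroupoid R).
Notation G := (vbase L).
Notation LL := (vtop L).

Definition MKarr := wsum (tbundle (arr G)) (varr L).
Definition MKobj := wsum (tbundle (obj G)) (vobj L).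

(** The inverse of the source map on the fibre over [g]. *)
Definition srcinv (g : arr G) (x : obj LL) : arr LL :=
  fibinv (varr L) setT (@src R LL) g x.

Context (theta : tspace (arr G) -> arr LL).

Definition MKgroupoid : groupoid R :=
  @Groupoid R MKarr MKobj
    (fun p => let: (v, l) := sval p in
       wpair (tbundle (obj G)) (vobj L) (tmap (@src R G) v) (src l))
    (fun p => let: (v, l) := sval p in
       wpair (tbundle (obj G)) (vobj L) (tmap (@tgt R G) v)
         (tgt (vadd (varr L) l (theta v))))
    (fun p p' => let: (v, l) := sval p in let: (v', l') := sval p' in
       wpair (tbundle (arr G)) (varr L) (tmul v v')
         (srcinv (mul (tbase v) (tbase v')) (src l')))
    (fun x => let: (v, l) := sval x in
       wpair (tbundle (arr G)) (varr L) (tmap (@unt R G) v) (unt l))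
    (fun p => let: (v, l) := sval p in
       wpair (tbundle (arr G)) (varr L) (tmap (@ginv R G) v)
         (srcinv (ginv (tbase v)) (tgt (vadd (varr L) l (theta v))))).

Definition morita_kernel : vbgroupoid R :=
  @VBGroupoid R MKgroupoid G
    (whitney (tbundle (arr G)) (varr L)) (whitney (tbundle (obj G)) (vobj L)).

(** (v, l) |-> (v, l + (s^* alpha)(v)) *)
Definition MKmap (alpha : tspace (obj G) -> obj LL) (p : MKarr) : MKarr :=
  let: (v, l) := sval p in
  wpair (tbundle (arr G)) (varr L) v (vadd (varr L) l (src_pullback alpha v)).

End MoritaKernel.

(* Main.v *)
(** The map A is invertible: its inverse is (v, l) |-> (v, l - (s^* alpha)(v)),
    and on objects A is the similar map (w, e) |-> (w, e + alpha(w)).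
    Compatibility with the structure maps is checked after applying the source
    map, which is injective on the fibres of L; for the target map it is the
    relation theta' + s^* alpha = theta + t^* alpha.  Hence A is fully faithful
    once it is known to be smooth, which rests on the smooth invertibility of
    the source map on the fibres of L.

    Two points need local analysis.  That two vectors v, v' with ds(v) = dt(v')
    are the components of a vector tangent to the composable pairs follows from
    Hadamard's lemma, by which derivations are directional derivatives in a
    chart, and a Lyusternik-type argument: a vector in the kernel of the
    differential of a submersion is a limit of secants of its level set.
    Essential surjectivity requires the target map of a Morita kernel to be a
    submersion; it is the sum of dt and t up to a fibrewise translation, and a
    vector is lifted by first moving the base point in a chart, with constant
    fibre coordinates, and then adding a vertical vector. *)

From HB Require Import structures.
From mathcomp Require Import all_boot all_order all_algebra.
From mathcomp Require Import boolp classical_sets functions reals constructive_ereal.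
From mathcomp Require Import interval_inference topology normedtype landau derive.
From mathcomp Require Import realfun sequences exp measure lebesgue_measure.
From mathcomp Require Import lebesgue_integral ftc ring lra.

Set Implicit Arguments.
Unset Strict Implicit.
Unset Printing Implicit Defensive.

Import Order.TTheory GRing.Theory Num.Theory.
Import numFieldNormedType.Exports.

Require Import Defs.

Local Open Scope classical_set_scope.
Local Open Scope ring_scope.

(** * Closure properties of smooth functions *)

(** The source map of a Morita kernel is a Whitney sum of a tangent map and a line bundle map; the
    target map is such a sum after a translation of the line component. The map A is itself a
    translation, on arrows and on objects. Smoothness, invertibility and lifting of vectors are
    therefore proved once for these two shapes, [wmap] and [shear].

    The product of tangent vectors is an arbitrary choice with a default value. It is the same term
    in both kernels, so that its base point and its source are all that has to be known, and both
    follow from the existence of a vector tangent to the composable pairs. No curve in the fibre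
    product is constructed: a vector of the ambient product restricts as soon as it kills the
    functions vanishing on the fibre product, and secants suffice to test this.

    Derivations are evaluated on global functions, whereas coordinates and trivializations are
    local. Bump functions show that a derivation depends on germs alone, and a smooth expression in
    finitely many global functions extends the germ that it represents. *)

Lemma Cinf_coind (R : realType) n (P : set ('rV[R]_n -> R)) :
  (forall f, P f -> (forall x, differentiable f x) /\
     forall v, P (fun x => 'D_v f x)) ->
  P `<=` @Cinf R n.
Proof.
move=> PD f Pf k; elim: k f Pf => [|k IHk] f Pf /=.
  by move=> x; apply: differentiable_continuous; have [+ _] := PD _ Pf; apply.
by have [df DP] := PD _ Pf; split=> // v; apply: IHk.
Qed.

Lemma Cinf_diff (R : realType) n (f : 'rV[R]_n -> R) x :
  Cinf f -> differentiable f x.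
Proof. by move=> /(_ 1%N)[]. Qed.

Lemma Cinf_derive (R : realType) n (f : 'rV[R]_n -> R) v :
  Cinf f -> Cinf (fun x => 'D_v f x).
Proof. by move=> f_Cinf k; have [_] := f_Cinf k.+1; apply. Qed.

Lemma Cinf_continuous (R : realType) n (f : 'rV[R]_n -> R) :
  Cinf f -> continuous f.
Proof. by move=> /(_ 0%N). Qed.

Lemma derive_rV (R : realType) n (f : 'rV[R]_n -> R) x v :
  differentiable f x ->
  'D_v f x = \sum_i v 0 i * 'D_(delta_mx 0 i) f x.
Proof.
move=> df; rewrite deriveE// [in LHS](row_sum_delta v) linear_sum.
by apply: eq_bigr => i _; rewrite linearZ deriveE.
Qed.

(** The candidate differential is given by its coefficients, which makes it linear and continuous;
    only the estimate remains. The integrals [ray_int] are differentiated in this way. *)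
Lemma diff_rV (R : realType) n (f : 'rV[R]_n -> R) x (G : 'I_n -> R) :
  (forall e, 0 < e -> \forall h \near (0 : 'rV[R]_n),
     `|f (h + x) - f x - \sum_i h 0 i * G i| <= e * `|h|) ->
  is_diff x f (fun h => \sum_i h 0 i * G i).
Proof.
move=> fG.
have dfl : linear (fun h : 'rV[R]_n => \sum_i h 0 i * G i).
  move=> a u v; rewrite scaler_sumr -big_split/=; apply: eq_bigr => i _.
  by rewrite !mxE mulrDl -mulrA.
pose L := GRing.isLinear.Build R 'rV[R]_n R _ _ dfl.
pose df : {linear 'rV[R]_n -> R} := HB.pack (fun h : 'rV[R]_n => \sum_i h 0 i * G i) L.
have dfc : continuous df.
  apply: (continuous_big (P := xpredT) (@add_continuous R)) => i _ h.
  exact: (cvgMr_tmp (@coord_continuous R 1 n 0 i h)).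
have dfo : f \o shift x = cst (f x) + df +o_ (0 : 'rV[R]_n) id.
  apply: eqaddoE.
  apply/eqaddoP => _/posnumP[e].
  near=> h; have : `|f (h + x) - f x - \sum_i h 0 i * G i| <= e%:num * `|h|.
    by near: h; exact: fG.
  by rewrite /df /= !fctE/= opprD addrA.
have dfE := diff_unique dfc dfo.
by apply: DiffDef => //; apply/diff_locallyP; rewrite dfE.
Unshelve. all: by end_near. Qed.

(* The closure of the smooth functions under the operations below consists of
   differentiable functions and is stable under directional derivatives, which
   makes it smooth by coinduction. *)
Inductive Cclos (R : realType) n : ('rV[R]_n -> R) -> Prop :=
| Cclos_base f : Cinf f -> Cclos f
| Cclos_add f g : Cclos f -> Cclos g -> Cclos (f + g)
| Cclos_mul f g : Cclos f -> Cclos g -> Cclos (f * g)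
| Cclos_comp k (w : 'rV[R]_k -> R) (g : 'I_k -> 'rV[R]_n -> R) :
    Cinf w -> (forall i, Cclos (g i)) -> Cclos (fun x => w (\row_i g i x))
| Cclos_inv f : Cclos f -> (forall x, f x != 0) -> Cclos (fun x => (f x)^-1).

Lemma Cinf_cst (R : realType) n (c : R) : Cinf (fun _ : 'rV[R]_n => c).
Proof.
apply: (Cinf_coind (P := [set f | exists c, f = cst c])); last by exists c.
move=> _ [a ->]; split=> [x|v]; first exact: differentiable_cst.
by exists 0; apply/funext => x; rewrite derive_cst.
Qed.

Lemma derive_coord (R : realType) n i (v x : 'rV[R]_n) :
  'D_v (fun x : 'rV[R]_n => x 0 i) x = v 0 i.
Proof.
rewrite deriveE//; last exact: differentiable_coord.
have dl : linear (fun x : 'rV[R]_n => x 0 i) by move=> a u w; rewrite !mxE.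
pose df : {linear 'rV[R]_n -> R} :=
  HB.pack (fun x : 'rV[R]_n => x 0 i) (GRing.isLinear.Build R 'rV[R]_n R _ _ dl).
by rewrite (@diff_lin _ _ _ df)//; exact: coord_continuous.
Qed.

Lemma Cinf_coord (R : realType) n i : Cinf (fun x : 'rV[R]_n => x 0 i).
Proof.
move=> [|k] /=; first by move=> x; exact: coord_continuous.
split=> [x|v]; first exact: differentiable_coord.
rewrite (_ : (fun x => _) = cst (v 0 i)); first exact: Cinf_cst.
by apply/funext => x; rewrite derive_coord.
Qed.

Lemma is_diff_row (R : realType) n k (g : 'I_k -> 'rV[R]_n -> R) x :
  (forall i, differentiable (g i) x) ->
  is_diff x (fun x => \row_i g i x) (fun h => \row_i 'd (g i) x h).
Proof.
move=> dg.
have E f : (fun y : 'rV[R]_n => \row_i f i y : 'rV[R]_k) =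
    \sum_(i < k) (fun y => f i y *: (delta_mx 0 i : 'rV[R]_k)).
  apply/funext => y; rewrite fct_sumE; apply/rowP => j.
  rewrite mxE summxE (bigD1 j)//= !mxE !eqxx mulr1 big1 ?addr0// => i /negPf ij.
  by rewrite !mxE eqxx eq_sym ij mulr0.
have di i : is_diff x (fun y => g i y *: (delta_mx 0 i : 'rV[R]_k))
  (fun h => 'd (g i) x h *: (delta_mx 0 i : 'rV[R]_k)).
  by apply: DiffDef; [exact: differentiableZl|exact: diffZl].
rewrite !E; elim/big_ind2: _ => // [|f1 f2 h1 h2 d1 d2]; last exact: is_diffD.
exact: is_diff_cst.
Qed.

Lemma derive_comp_rV (R : realType) n k (w : 'rV[R]_k -> R)
    (g : 'I_k -> 'rV[R]_n -> R) x v :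
  differentiable w (\row_i g i x) -> (forall i, differentiable (g i) x) ->
  differentiable (fun x => w (\row_i g i x)) x /\
  'D_v (fun x => w (\row_i g i x)) x =
  \sum_i 'D_v (g i) x * 'D_(delta_mx 0 i) w (\row_i g i x).
Proof.
move=> dw dg; have [dr rE] := is_diff_row dg.
have dc : differentiable (w \o (fun x => \row_i g i x)) x.
  exact: differentiable_comp.
split=> //; rewrite deriveE// diff_comp//= rE -deriveE// derive_rV//.
by apply: eq_bigr => i _; rewrite mxE -deriveE.
Qed.

Lemma Cclos_sum (R : realType) n k (f : 'I_k -> 'rV[R]_n -> R) :
  (forall i, Cclos (f i)) -> Cclos (fun x => \sum_i f i x).
Proof.
move=> Cf; rewrite -fct_sumE; elim/big_ind: _ => //; last exact: Cclos_add.
by apply: Cclos_base; exact: Cinf_cst.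
Qed.

Lemma Cclos_Cinf (R : realType) n (f : 'rV[R]_n -> R) : Cclos f -> Cinf f.
Proof.
apply: (Cinf_coind (P := @Cclos R n)) => {}f.
elim=> {f} [f Cf|f g Cf [df Df] Cg [dg Dg]|f g Cf [df Df] Cg [dg Dg]
  |k w g Cw Cg Dg|f Cf [df Df] f0].
- split=> [x|v]; first exact: Cinf_diff.
  by apply: Cclos_base; exact: Cinf_derive.
- split=> [x|v]; first exact: differentiableD.
  rewrite (_ : (fun x => _) = (fun x => 'D_v f x) + (fun x => 'D_v g x)).
    exact: Cclos_add.
  by apply/funext => x; rewrite deriveD//; exact: diff_derivable.
- split=> [x|v]; first exact: differentiableM.
  rewrite (_ : (fun x => _) = f * (fun x => 'D_v g x) + g * (fun x => 'D_v f x)).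
    by apply: Cclos_add; apply: Cclos_mul.
  by apply/funext => x; rewrite deriveM//; exact: diff_derivable.
- have dg i x : differentiable (g i) x by have [+ _] := Dg i; apply.
  split=> [x|v]; first by have [] := derive_comp_rV 0 (Cinf_diff _ Cw) (dg^~ x).
  rewrite (_ : (fun x => _) = fun x => \sum_i
      'D_v (g i) x * 'D_(delta_mx 0 i) w (\row_i g i x)).
    apply: Cclos_sum => i; apply: (@Cclos_mul _ _ (fun x => 'D_v (g i) x)).
      by have [_] := Dg i; apply.
    exact: (@Cclos_comp _ _ _ (fun x => 'D_(delta_mx 0 i) w x) _
      (Cinf_derive _ Cw)).
  by apply/funext => x; have [] := derive_comp_rV v (Cinf_diff _ Cw) (dg^~ x).
- split=> [x|v]; first exact: differentiableV.
  (* The derivative of the reciprocal is arranged as a product of members of the class. *)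
  rewrite (_ : (fun x => _) = (cst (-1) * (fun x => 'D_v f x)) *
      ((fun x => (f x)^-1) * (fun x => (f x)^-1))).
    apply: Cclos_mul; last by apply: Cclos_mul; exact: Cclos_inv.
    by apply: Cclos_mul => //; apply: Cclos_base; exact: Cinf_cst.
  apply/funext => x; rewrite deriveV//; last exact: diff_derivable.
  rewrite -[RHS]/(-1 * 'D_v f x * ((f x)^-1 * (f x)^-1)).
  by rewrite /GRing.scale/= expr2 invfM mulN1r !mulNr mulrC.
Qed.

(** * Flat functions, bump functions and reciprocals *)

(* All derivatives of [exp (- 1 / t)], extended by [0], are of this form. *)
Definition flatp (R : realType) (p : {poly R}) (t : R) : R :=
  if 0 < t then p.[t^-1] * expR (- t^-1) else 0.

(** The exponential dominates each term [s ^+ i / i!] of its series, whence the weights [i!]; the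
    summand 1 makes the constant positive. *)
Lemma horner_le_expR (R : realType) (p : {poly R}) :
  exists2 C : R, 0 < C & forall s, 0 <= s -> `|p.[s]| <= C * expR s.
Proof.
have He (i : nat) (s : R) : 0 <= s -> s ^+ i <= i`!%:R * expR s.
  move=> s0; case: i => [|i];
    first by rewrite expr0 fact0 mul1r (le_trans _ (expR_ge1Dx s))// lerDl.
  rewrite mulrC -ler_pdivrMr ?ltr0n ?fact_gt0// (le_trans _ (expR_ge1Dxn i s0))//.
  by rewrite lerDr.
exists (1 + \sum_(i < size p) `|p`_i| * i`!%:R); first by rewrite ltr_wpDr// sumr_ge0.
move=> s s0; rewrite mulrDl mul1r -[leLHS]add0r lerD ?expR_ge0//.
rewrite horner_coef mulr_suml (le_trans (ler_norm_sum _ _ _))//.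
apply: ler_sum => i _; rewrite normrM -mulrA ler_wpM2l// ger0_norm ?exprn_ge0//.
exact: He.
Qed.

(** The bound for the polynomial [p * 'X ^+ 2] at [t^-1] produces the factor [t ^+ 2]. Being
    quadratic, it forces the difference quotient at 0 to tend to 0. *)
Lemma flatp_le (R : realType) (p : {poly R}) :
  exists2 C : R, 0 < C & forall t, `|flatp p t| <= C * t ^+ 2.
Proof.
have [C C0 CP] := horner_le_expR (p * 'X ^+ 2); exists C => // t.
rewrite /flatp; case: ifPn => [t0|_]; last by rewrite normr0 mulr_ge0// ?sqr_ge0// ltW.
have := CP t^-1; rewrite invr_ge0 => /(_ (ltW t0)).
rewrite hornerM hornerXn normrM (ger0_norm (exprn_ge0 _ _)) ?invr_ge0 ?(ltW t0)//.
rewrite exprVn ler_pdivrMr ?exprn_gt0// => le1.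
rewrite normrM (ger0_norm (expR_ge0 _)) expRN ler_pdivrMr ?expR_gt0//.
by rewrite mulrAC.
Qed.

Lemma is_derive_flatp (R : realType) (p : {poly R}) (t : R) :
  is_derive t 1 (flatp p) (flatp ('X ^+ 2 * (p - p^`())) t).
Proof.
have [t0|t0|->] := ltgtP t 0.
- apply: (@near_eq_is_derive _ _ _ (cst 0)).
  + near=> z; rewrite /flatp ltNge ifN// negbK ltW//.
    by near: z; exact: lt_nbhsl.
  + by rewrite /flatp ltNge (ltW t0)/=; exact: is_derive_cst.
- pose f (s : R) : R := p.[s^-1] * expR (- s^-1).
  apply: (@near_eq_is_derive _ _ _ f).
  + near=> z; rewrite /flatp ifT//.
    by near: z; exact: lt_nbhsr.
  + have tN0 : t != 0 by rewrite gt_eqF.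
    have dV : is_derive t 1 (fun t : R => t^-1) (- t ^- 2).
      have dt := differentiable_Rinv tN0.
      split; first exact/derivable1_diffP.
      by rewrite deriveE// diff_Rinv//= /GRing.scale/= mulr1.
    rewrite /flatp t0.
    have d1 := @is_derive1_comp _ (horner p) _ t _ _ (is_derive_poly p _) dV.
    have d2 := @is_derive1_comp _ (@expR R) _ t _ _ (is_derive_expR _) (is_deriveN dV).
    apply: (is_derive_eq (is_deriveM d1 d2)).
    rewrite /GRing.scale/= hornerM hornerXn hornerD hornerN exprVn.
    by rewrite -[(- [eta GRing.inv]) t]/(- t^-1); ring.
- have [C C0 CP] := flatp_le p.
  have H : h^-1 *: (flatp p (h *: 1 + 0) - flatp p 0) @[h --> 0^'] --> (0 : R).
    apply/cvgrPdist_le => e e0; near=> h.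
    rewrite sub0r normrN addr0 scaler1 {2}/flatp ltxx subr0 normrZ normfV.
    have h0 : h != 0 by near: h; exact: nbhs_dnbhs_neq.
    rewrite ler_pdivrMl ?normr_gt0// (le_trans (CP _))//.
    rewrite -real_normK ?num_real// expr2 mulrA [leRHS]mulrC ler_pM2r ?normr_gt0//.
    rewrite mulrC -ler_pdivlMr//.
    near: h; apply: (@cvgr0_norm_le _ _ _ _ (dnbhs_filter _)).
      by apply: cvg_within_filter; exact: cvg_id.
    by rewrite divr_gt0.
  rewrite {2}/flatp ltxx; split; last exact/cvg_lim.
  by apply/cvg_ex; exists 0.
Unshelve. all: by end_near. Qed.

Lemma differentiable_flatp (R : realType) (p : {poly R}) (t : R) :
  differentiable (flatp p) t.
Proof. by apply/derivable1_diffP; have [] := is_derive_flatp p t. Qed.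

Lemma Cinf_flatp (R : realType) (p : {poly R}) n (i : 'I_n) :
  Cinf (fun x : 'rV[R]_n => flatp p (x 0 i)).
Proof.
(* The scalar [c] collects the coordinates [v 0 i] produced by directional derivatives. *)
pose P := [set f | exists (c : R) (p : {poly R}),
  f = (fun x : 'rV[R]_n => c * flatp p (x 0 i))].
apply: (Cinf_coind (P := P)); last first.
  by exists 1, p; apply/funext => x; rewrite mul1r.
move=> _ [c [q ->]].
have df x : differentiable (fun x : 'rV[R]_n => flatp q (x 0 i)) x.
  apply: (@differentiable_comp _ _ _ _ (fun x : 'rV[R]_n => x 0 i) (flatp q)).
    exact: differentiable_coord.
  by apply/derivable1_diffP; have [] := is_derive_flatp q (x 0 i).
split=> [x|v].
  have -> : (fun x : 'rV[R]_n => c * flatp q (x 0 i)) =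
    c *: (fun x : 'rV[R]_n => flatp q (x 0 i)) by [].
  exact: differentiableZ.
exists (c * v 0 i), ('X ^+ 2 * (q - q^`())); apply/funext => x.
have -> : (fun x : 'rV[R]_n => c * flatp q (x 0 i)) =
    c *: (fun x : 'rV[R]_n => flatp q (x 0 i)) by [].
rewrite deriveZ; last exact: diff_derivable.
rewrite -[LHS]/(c * _) -mulrA; congr (c * _); rewrite deriveE//.
rewrite (@diff_comp _ _ _ _ (fun x : 'rV[R]_n => x 0 i) (flatp q))/=.
- rewrite -(deriveE _ (differentiable_coord _ _ _)) derive_coord.
  rewrite diff1E; last exact: differentiable_flatp.
  by rewrite derive1E; have [_ ->] := is_derive_flatp q (x 0 i).
- exact: differentiable_coord.
- exact: differentiable_flatp.
Qed.

(** * Operations on smooth functions, bump functions and reciprocals *)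

Lemma CinfD (R : realType) n (f g : 'rV[R]_n -> R) :
  Cinf f -> Cinf g -> Cinf (fun x => f x + g x).
Proof.
by move=> Cf Cg; apply: Cclos_Cinf; apply: Cclos_add; exact: Cclos_base.
Qed.

Lemma CinfM (R : realType) n (f g : 'rV[R]_n -> R) :
  Cinf f -> Cinf g -> Cinf (fun x => f x * g x).
Proof.
by move=> Cf Cg; apply: Cclos_Cinf; apply: Cclos_mul; exact: Cclos_base.
Qed.

Lemma CinfN (R : realType) n (f : 'rV[R]_n -> R) :
  Cinf f -> Cinf (fun x => - f x).
Proof.
move=> Cf; rewrite (_ : (fun x => _) = (fun x => -1 * f x)).
  by apply: CinfM => //; exact: Cinf_cst.
by apply/funext => x; rewrite mulN1r.
Qed.

Lemma CinfB (R : realType) n (f g : 'rV[R]_n -> R) :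
  Cinf f -> Cinf g -> Cinf (fun x => f x - g x).
Proof. by move=> Cf Cg; apply: CinfD => //; exact: CinfN. Qed.

Lemma CinfV (R : realType) n (f : 'rV[R]_n -> R) :
  Cinf f -> (forall x, f x != 0) -> Cinf (fun x => (f x)^-1).
Proof.
by move=> Cf f0; apply: Cclos_Cinf; apply: Cclos_inv => //; exact: Cclos_base.
Qed.

Lemma Cinf_comp (R : realType) n k (w : 'rV[R]_k -> R)
    (g : 'I_k -> 'rV[R]_n -> R) :
  Cinf w -> (forall i, Cinf (g i)) -> Cinf (fun x => w (\row_i g i x)).
Proof.
move=> Cw Cg; apply: Cclos_Cinf; apply: Cclos_comp => // i.
exact: Cclos_base.
Qed.

Lemma Cinf_sum (R : realType) n k (f : 'I_k -> 'rV[R]_n -> R) :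
  (forall i, Cinf (f i)) -> Cinf (fun x => \sum_i f i x).
Proof.
by move=> Cf; apply: Cclos_Cinf; apply: Cclos_sum => i; exact: Cclos_base.
Qed.

Lemma Cinf_prod (R : realType) n k (f : 'I_k -> 'rV[R]_n -> R) :
  (forall i, Cinf (f i)) -> Cinf (fun x => \prod_i f i x).
Proof.
move=> Cf; elim: (index_enum _) => [|i s IHs].
  by under eq_fun do rewrite big_nil; exact: Cinf_cst.
by under eq_fun do rewrite big_cons; exact: CinfM.
Qed.

Lemma Cinf_flat (R : realType) n (f : 'rV[R]_n -> R) :
  Cinf f -> Cinf (fun x => flatp 1 (f x)).
Proof.
move=> Cf; have := @Cinf_comp _ _ _ _ (fun _ : 'I_1 => f)
  (Cinf_flatp 1 ord0) (fun _ => Cf).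
by under eq_fun do rewrite mxE.
Qed.

Lemma flat_ge0 (R : realType) (t : R) : 0 <= flatp 1 t.
Proof.
rewrite /flatp; case: ifP => // _.
by rewrite -[1]/(1%:P) hornerC mul1r expR_ge0.
Qed.

Lemma flat_gt0 (R : realType) (t : R) : (0 < flatp 1 t) = (0 < t).
Proof.
rewrite /flatp; case: ifP => _; last by rewrite ltxx.
by rewrite -[1]/(1%:P) hornerC mul1r expR_gt0.
Qed.

Lemma flat_eq0 (R : realType) (t : R) : t <= 0 -> flatp 1 t = 0.
Proof. by rewrite /flatp ltNge => ->. Qed.

(** A product over the coordinates of flat functions of [e ^+ 2 - (y 0 i - a 0 i) ^+ 2], each
    positive exactly where that coordinate is closer than [e], divided by its value at [a]. *)
Lemma Cinf_bump (R : realType) k (a : 'rV[R]_k) e : 0 < e ->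
  exists b : 'rV[R]_k -> R, [/\ Cinf b, b a = 1 &
    forall y, b y != 0 -> forall i, `|y 0 i - a 0 i| < e].
Proof.
move=> e0; pose d (y : 'rV[R]_k) i := y 0 i - a 0 i.
pose b (y : 'rV[R]_k) := \prod_i flatp 1 (e * e - d y i * d y i).
have ba : b a != 0.
  apply/prodf_neq0 => i _; rewrite gt_eqF// flat_gt0 /d !subrr mulr0 subr0.
  exact: mulr_gt0.
exists (fun y => (b a)^-1 * b y); split.
- apply: CinfM; first exact: Cinf_cst.
  apply: Cinf_prod => i; apply: Cinf_flat; apply: CinfB; first exact: Cinf_cst.
  by apply: CinfM; apply: CinfB; (exact: Cinf_coord || exact: Cinf_cst).
- by rewrite mulVf.
- move=> y; rewrite mulf_eq0 negb_or => /andP[_ /prodf_neq0 by0] i.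
  rewrite ltNge; apply: contra (by0 i isT) => le_e; apply/eqP/flat_eq0.
  rewrite subr_le0 -!expr2 -[leRHS]real_normK ?num_real//.
  by rewrite lerXn2r// nnegrE ltW.
Qed.

(** With [r = x / c - 1] the reciprocal is [c^-1 / (1 + r)]. Multiplying [r] by a cutoff that is 1
    near [c] and 0 far from it keeps the denominator positive everywhere. *)
Lemma Cinf_recip (R : realType) (c : R) : c != 0 ->
  exists w : 'rV[R]_1 -> R, Cinf w /\
    exists2 e, 0 < e & forall x : 'rV[R]_1, `|x 0 0 - c| < e -> w x = (x 0 0)^-1.
Proof.
move=> c0; pose r (x : 'rV[R]_1) := c^-1 * x 0 0 - 1.
pose u x := r x * r x.
(* [p] vanishes for [u >= 1/2], [q] for [u <= 1/4], and they have no common zero; so [b] below is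
   smooth and passes from 1 to 0 between these values. *)
pose p x := flatp 1 (2^-1 - u x); pose q x := flatp 1 (u x - 4^-1).
pose b x := p x * (p x + q x)^-1.
have Cr : Cinf r.
  apply: CinfB; last exact: Cinf_cst.
  by apply: CinfM; (exact: Cinf_coord || exact: Cinf_cst).
have Cu : Cinf u by exact: CinfM.
have Cp : Cinf p by apply: Cinf_flat; apply: CinfB => //; exact: Cinf_cst.
have Cq : Cinf q by apply: Cinf_flat; apply: CinfB => //; exact: Cinf_cst.
have pq_gt0 x : 0 < p x + q x.
  have [u2|u2] := ltP (u x) 2^-1.
    by rewrite ltr_pwDl ?flat_ge0// flat_gt0 subr_gt0.
  rewrite ltr_wpDl ?flat_ge0// flat_gt0 subr_gt0 (lt_le_trans _ u2)//.
  by rewrite ltf_pV2 ?posrE ?ltr_nat.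
have Cb : Cinf b.
  apply: CinfM => //; apply: CinfV; first exact: CinfD.
  by move=> x; rewrite gt_eqF.
have b01 x : 0 <= b x <= 1.
  rewrite /b divr_ge0 ?flat_ge0 ?(ltW (pq_gt0 x))//=.
  by rewrite ler_pdivrMr// mul1r lerDl flat_ge0.
have g_gt0 x : 0 < 1 + r x * b x.
  have [u1|u1] := ltP (u x) 1.
    have : `|r x * b x| < 1; last by rewrite ltr_norml => /andP[]; lra.
    rewrite normrM (le_lt_trans (y := `|r x|))//.
      by rewrite ler_piMr// ger0_norm; case/andP: (b01 x).
    have : `|r x| ^+ 2 < 1 by rewrite real_normK ?num_real// expr2.
    by rewrite expr_lt1.
  by rewrite /b /p flat_eq0 ?mul0r ?mulr0 ?addr0// subr_le0 (le_trans _ u1)//; lra.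
exists (fun x => c^-1 * (1 + r x * b x)^-1); split.
  apply: CinfM; first exact: Cinf_cst.
  apply: CinfV => [|x]; last by rewrite gt_eqF.
  by apply: CinfD; [exact: Cinf_cst|exact: CinfM].
(* This radius means [|r x| < 1/2], that is [u x < 1/4], where the cutoff is 1. *)
exists (`|c| * 2^-1); first by rewrite mulr_gt0 ?normr_gt0.
move=> x xc; suff -> : b x = 1.
  by rewrite mulr1 /r addrCA subrr addr0 invfM invrK mulrA mulVf ?mul1r.
have q0 : q x = 0.
  apply: flat_eq0; rewrite subr_le0.
  have : `|r x| < 2^-1.
    rewrite /r -[X in _ - X](mulVf c0) -mulrBr normrM normfV mulrC.
    by rewrite ltr_pdivrMr ?normr_gt0// mulrC.
  rewrite /u -expr2 -[leLHS]real_normK ?num_real// => rx.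
  have : `|r x| ^+ 2 <= 2^-1 ^+ 2 by rewrite lerXn2r ?nnegrE// ltW.
  by move=> /le_trans->//; lra.
by rewrite /b q0 addr0 mulfV//; have := pq_gt0 x; rewrite q0 addr0; case: ltgtP.
Qed.

(** * Hadamard's lemma *)

Lemma near0_norm_lt (R : realType) n e : 0 < e ->
  \forall h \near (0 : 'rV[R]_n), `|h| < e.
Proof.
move=> e0; apply/nbhs_ballP; exists e => // h.
by rewrite -ball_normE/= sub0r normrN.
Qed.

Lemma norm_rV_coord (R : realType) n (v : 'rV[R]_n) i : `|v 0 i| <= `|v|.
Proof.
rewrite [leRHS]/Num.norm/= mx_normrE.
exact: (@le_bigmax _ _ _ _ (fun i => `|v i.1 i.2|) (ord0, i)).
Qed.

Lemma norm_rV_le (R : realType) n (v : 'rV[R]_n) e :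
  0 <= e -> (forall i, `|v 0 i| <= e) -> `|v| <= e.
Proof.
move=> e0 ve; rewrite [leLHS]/Num.norm/= mx_normrE.
by apply: bigmax_le => // -[i j] _; rewrite ord1.
Qed.

Lemma is_derive_line (R : realType) n (f : 'rV[R]_n -> R) x v s :
  differentiable f (x + s *: v) ->
  is_derive s 1 (fun s => f (x + s *: v)) ('D_v f (x + s *: v)).
Proof.
move=> /diff_derivable-/(_ v) df; set g := fun s => _.
have E : (fun h : R => h^-1 *: (g (h *: 1 + s) - g s)) =
    (fun h : R => h^-1 *: (f (h *: v + (x + s *: v)) - f (x + s *: v))).
  apply/funext => h; rewrite /g scaler1 scalerDl.
  by rewrite addrCA.
by split; [rewrite /derivable E|rewrite /derive E].
Qed.

Lemma derive_near (R : realType) n (f : 'rV[R]_n -> R) p e : Cinf f -> 0 < e ->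
  \forall z \near p, forall v, `|'D_v f z - 'D_v f p| <= e * `|v|.
Proof.
move=> Cf e0.
(* The denominator [n.+1] also covers dimension 0. *)
have : \forall z \near p, forall i : 'I_n,
    `|'D_(delta_mx 0 i) f z - 'D_(delta_mx 0 i) f p| <= e / n.+1%:R.
  apply: (@filter_forall _ _ (fun i z => `|'D_(delta_mx 0 i) f z -
    'D_(delta_mx 0 i) f p| <= e / n.+1%:R) (nbhs p)) => i.
  have /cvgrPdist_le := @Cinf_continuous _ _ _ (Cinf_derive (delta_mx 0 i) Cf) p.
  move=> /(_ (e / n.+1%:R)) H.
  have := H (divr_gt0 e0 (ltr0Sn R n)).
  by apply: filterS => z; rewrite distrC.
apply: filterS => z ze v.
rewrite !derive_rV; [|exact: Cinf_diff..].
rewrite -sumrB (le_trans (ler_norm_sum _ _ _))//.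
apply: (le_trans (y := \sum_(i < n) e / n.+1%:R * `|v|)).
  apply: ler_sum => i _; rewrite -mulrBr normrM mulrC.
  by rewrite ler_pM// norm_rV_coord.
rewrite sumr_const card_ord -[leLHS]mulr_natl mulrA ler_wpM2r//.
rewrite mulrCA ler_piMr ?(ltW e0)//.
by rewrite ler_pdivrMr// mul1r ler_nat.
Qed.

Lemma MVT_rV (R : realType) n (f : 'rV[R]_n -> R) x y :
  (forall z, differentiable f z) ->
  exists2 s, 0 <= s <= 1 & f y - f x = 'D_(y - x) f (x + s *: (y - x)).
Proof.
move=> df.
have [] := @MVT_segment _ (fun s => f (x + s *: (y - x)))
    (fun s => 'D_(y - x) f (x + s *: (y - x))) 0 1 ler01.
- by move=> s _; exact: is_derive_line.
- apply: derivable_within_continuous => s _.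
  by have [] := is_derive_line (df (x + s *: (y - x))).
- move=> s; rewrite in_itv/= => s01.
  rewrite scale1r scale0r addr0 subrKC subr0 mulr1 => ->.
  by exists s.
Qed.

(** By the mean value theorem the increment is a derivative at a point of the segment, and
    derivatives near [p] are close to each other. Half of [e] compares that point with [p], the
    other half compares [z] with [p]. *)
Lemma strict_diff (R : realType) n (f : 'rV[R]_n -> R) p e : Cinf f -> 0 < e ->
  exists2 d, 0 < d & forall x y z, `|x - p| < d -> `|y - p| < d -> `|z - p| < d ->
    `|f y - f x - 'D_(y - x) f z| <= e * `|y - x|.
Proof.
move=> Cf e0; have /nbhs_ballP[d/= d0 dP] := derive_near p Cf (divr_gt0 e0 (ltr0n R 2)).
exists d => // x y z xd yd zd.
have [s /andP[s0 s1] ->] := MVT_rV x y (fun z => Cinf_diff z Cf).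
set w := x + _.
have wd : ball p d w.
  rewrite -ball_normE/= distrC.
  have -> : w - p = (1 - s) *: (x - p) + s *: (y - p).
    by apply/rowP => i; rewrite !mxE; ring.
  rewrite (le_lt_trans (ler_normD _ _))// !normrZ !ger0_norm ?subr_ge0//.
  have [->|sN0] := eqVneq s 0; first by rewrite mul0r subr0 mul1r addr0.
  have : s * `|y - p| < s * d by rewrite ltr_pM2l// lt_neqAle eq_sym sN0.
  have : (1 - s) * `|x - p| <= (1 - s) * d by rewrite ler_wpM2l ?subr_ge0// ltW.
  lra.
have zd' : ball p d z by rewrite -ball_normE/= distrC.
have := dP _ wd (y - x); have := dP _ zd' (y - x).
rewrite distrC => H1 H2; have := lerD H2 H1.
move=> /(le_trans (ler_normD _ _)); rewrite addrA subrK => /le_trans; apply.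
by rewrite -mulrDl -splitr.
Qed.

(** * Integrals over the unit interval and along rays *)

Section unit_integral.
Context {R : realType}.
Let mu := @lebesgue_measure R.
Implicit Types f g : R -> R.

Definition int01 f : R := \int[mu]_(t in `[0, 1]) f t.

Let i01 f : continuous f -> mu.-integrable `[0, 1] (EFin \o f).
Proof.
move=> cf; apply: continuous_compact_integrable; first exact: segment_compact.
exact: continuous_subspaceT.
Qed.

Lemma int01D f g : continuous f -> continuous g ->
  int01 (fun t => f t + g t) = int01 f + int01 g.
Proof. by move=> cf cg; rewrite /int01 RintegralD//; exact: i01. Qed.

Lemma int01Z (a : R) f : continuous f -> int01 (fun t => a * f t) = a * int01 f.
Proof. by move=> cf; rewrite /int01 RintegralZl//; exact: i01. Qed.

Lemma int01_le f (c : R) : continuous f ->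
  (forall t, 0 <= t <= 1 -> `|f t| <= c) -> `|int01 f| <= c.
Proof.
move=> cf fc.
have inf : mu.-integrable `[0, 1] (EFin \o (fun t => `|f t|)).
  by apply: i01 => t; apply: cvg_norm; exact: cf.
have inc : mu.-integrable `[0, 1] (EFin \o cst c).
  by apply: i01 => t; exact: cvg_cst.
have le1 : `|int01 f| <= int01 (fun t => `|f t|).
  by apply: le_normr_Rintegral => //; exact: i01.
have le2 : int01 (fun t => `|f t|) <= int01 (cst c).
  apply: le_Rintegral => // t; rewrite /= in_itv/=; exact: fc.
apply: (le_trans le1); apply: (le_trans le2).
by rewrite /int01 Rintegral_cst//= lebesgue_measure_itv/= lte01 sube0 mulr1.
Qed.

Lemma int01_FTC (F : R -> R) f : continuous f ->
  (forall t : R, is_derive t 1 F (f t)) -> int01 f = F 1 - F 0.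
Proof.
move=> cf dF; rewrite /int01 /Rintegral (@continuous_FTC2 _ f F)//.
- exact: continuous_subspaceT.
- have cF : continuous F.
    by move=> t; apply/differentiable_continuous/derivable1_diffP; have [] := dF t.
  split; first by move=> t _; have [] := dF t.
    by apply: cvg_at_right_filter; exact: cF.
  by apply: cvg_at_left_filter; exact: cF.
- by move=> t _; rewrite derive1E; have [_ ->] := dF t.
Qed.

End unit_integral.

Lemma cont_line (R : realType) n (f : 'rV[R]_n -> R) (a x : 'rV[R]_n) j :
  continuous f -> continuous (fun t : R => t ^+ j * f (a + t *: x)).
Proof.
move=> cf t; apply: cvgM; first exact: exprn_continuous.
apply: (@cvg_comp _ _ _ (fun t : R => a + t *: x) f _ (nbhs (a + t *: x))).
  by apply: cvgD; [exact: cvg_cst|apply: cvgZr_tmp; exact: cvg_id].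
exact: cf.
Qed.

(** The weight [t ^+ j] makes the family stable under differentiation: each derivative in [x] brings
    out one more factor [t]. *)
Definition ray_int (R : realType) n (a : 'rV[R]_n) j (f : 'rV[R]_n -> R)
    (x : 'rV[R]_n) : R :=
  int01 (fun t => t ^+ j * f (a + t *: (x - a))).

Lemma ray_int_sum (R : realType) n (a : 'rV[R]_n) j k (c : 'I_k -> R)
    (f : 'I_k -> 'rV[R]_n -> R) x :
  (forall i, continuous (f i)) ->
  ray_int a j (fun y => \sum_i c i * f i y) x = \sum_i c i * ray_int a j (f i) x.
Proof.
move=> cf.
(* Additivity of the integral needs continuity of the partial sums, which is carried through the
   induction. *)
suff : continuous (fun t : R => t ^+ j * \sum_i c i * f i (a + t *: (x - a))) /\
   ray_int a j (fun y => \sum_i c i * f i y) x = \sum_i c i * ray_int a j (f i) x.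
  by case.
rewrite /ray_int; elim: (index_enum _) => [|i s [IHc IHs]].
  have E : (fun t : R => t ^+ j * \sum_(i <- [::]) c i * f i (a + t *: (x - a)))
      = (fun t => 0 * cst 0 t) by apply/funext => t; rewrite big_nil mulr0 mul0r.
  have c0 : continuous (cst 0 : R -> R) by move=> t; exact: cvg_cst.
  by rewrite E int01Z// mul0r big_nil; split=> // t; apply: cvgMl_tmp; exact: c0.
have cfi := cont_line (a := a) (x := x - a) (j := j) (cf i).
have E : (fun t : R => t ^+ j * \sum_(i <- i :: s) c i * f i (a + t *: (x - a)))
  = (fun t : R => c i * (t ^+ j * f i (a + t *: (x - a))) +
      t ^+ j * \sum_(i <- s) c i * f i (a + t *: (x - a))).
  by apply/funext => t; rewrite big_cons mulrDr mulrCA.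
rewrite E; split.
  move=> t; apply: cvgD; last exact: IHc.
  by apply: cvgMl_tmp; exact: cfi.
rewrite int01D//; last by move=> t; apply: cvgMl_tmp; exact: cfi.
by rewrite int01Z// big_cons IHs.
Qed.

(** Around each point of the ray [strict_diff] gives an estimate; compactness of the unit interval
    makes it uniform in [t]. *)
Lemma uniform_diff_ray (R : realType) n (a x : 'rV[R]_n) (f : 'rV[R]_n -> R) e :
  Cinf f -> 0 < e -> \forall h \near (0 : 'rV[R]_n), forall t : R, 0 <= t <= 1 ->
  `|f (a + t *: (h + x)) - f (a + t *: x) - t * 'D_h f (a + t *: x)| <= e * `|h|.
Proof.
move=> Cf e0.
have := @segment_compact R 0 1; move=> /compact_near_coveringP/near_covering_withinP.
move=> /(_ _ (nbhs (0 : 'rV[R]_n)) (fun h t => `|f (a + t *: (h + x)) -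
  f (a + t *: x) - t * 'D_h f (a + t *: x)| <= e * `|h|) _) H.
have {}H := H _; apply: filterS (H _) => [h hP t t01|].
  by apply: hP; rewrite /= in_itv.
move=> t0 _.
have [d d0 dP] := strict_diff (a + t0 *: x) Cf e0.
have ct : a + t *: x @[t --> t0] --> a + t0 *: x.
  by apply: cvgD; [exact: cvg_cst|apply: cvgZr_tmp; exact: cvg_id].
near=> t h; rewrite /= in_itv/= => /andP[t_ge0 t_le1].
have td : `|a + t *: x - (a + t0 *: x)| < d / 2.
  near: t; apply: (@cvgr_distC_lt _ _ _ (nbhs t0) _ _ _ ct); exact: divr_gt0.
have hd : `|h| < d / 2 by near: h; apply: near0_norm_lt; exact: divr_gt0.
have tx : `|a + t *: x - (a + t0 *: x)| < d.
  by rewrite (lt_trans td)// ltr_pdivrMr// ltr_pMr// ltr1n.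
have th : `|t *: h| <= `|h| by rewrite normrZ ger0_norm// ler_piMl.
have E : a + t *: (h + x) = t *: h + (a + t *: x) by rewrite scalerDr addrCA.
have thx : `|a + t *: (h + x) - (a + t0 *: x)| < d.
  rewrite E -addrA (le_lt_trans (ler_normD _ _))// (splitr d) ltrD//.
  exact: le_lt_trans th hd.
have := dP _ _ _ tx thx tx.
rewrite E addrK => /le_trans dPle.
have {1}-> : t * 'D_h f (a + t *: x) = 'D_(t *: h) f (a + t *: x).
  by rewrite !deriveE ?linearZ//; exact: Cinf_diff.
by apply: dPle; rewrite ler_wpM2l// ltW.
Unshelve. all: by end_near. Qed.

(** Differentiation under the integral sign: the linearization error of the integrand is uniform in
    [t], and the weight is at most 1. *)
Lemma ray_int_diff (R : realType) n (a : 'rV[R]_n) j (f : 'rV[R]_n -> R) x :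
  Cinf f -> is_diff x (ray_int a j f)
    (fun h => \sum_i h 0 i * ray_int a j.+1 (fun y => 'D_(delta_mx 0 i) f y) x).
Proof.
move=> Cf; apply: diff_rV => e e0.
have := uniform_diff_ray a (x - a) Cf e0; apply: filterS => h hP.
have cf := Cinf_continuous Cf.
have cDf i := Cinf_continuous (Cinf_derive (delta_mx 0 i) Cf).
rewrite -ray_int_sum//.
have -> : (fun y => \sum_i h 0 i * 'D_(delta_mx 0 i) f y) = (fun y => 'D_h f y).
  by apply/funext => y; rewrite [RHS]derive_rV//; exact: Cinf_diff.
have cDh := Cinf_continuous (Cinf_derive h Cf).
have c1 := cont_line (a := a) (x := h + x - a) (j := j) cf.
have c2 := cont_line (a := a) (x := x - a) (j := j) cf.
have c3 := cont_line (a := a) (x := x - a) (j := j.+1) cDh.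
have cN (g : R -> R) : continuous g -> continuous (fun t => -1 * g t).
  by move=> cg t; apply: cvgMl_tmp; exact: cg.
have cD (g k : R -> R) : continuous g -> continuous k ->
  continuous (fun t => g t + k t).
  by move=> cg ck t; apply: cvgD; [exact: cg|exact: ck].
(* Differences are written with factors [-1], in order to collect all terms under one integral by
   [int01D] and [int01Z]. *)
rewrite /ray_int -[X in _ - X - _]mul1r -[X in _ - _ - X]mul1r -!mulNr.
have k1 := cN _ c2; have k2 := cD _ _ c1 k1; have k3 := cN _ c3.
rewrite -(int01Z _ c2) -(int01D c1 k1) -(int01Z _ c3) -(int01D k2 k3).
apply: int01_le; first exact: cD.
move=> t /[dup] /andP[t0 t1] /hP; rewrite addrA => /(le_trans _); apply.
rewrite !mulN1r exprS -!mulrA mulrCA -!mulrBr normrM.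
by rewrite ler_piMl// ger0_norm ?exprn_ge0// exprn_ile1.
Qed.

Lemma ray_int_Cinf (R : realType) n (a : 'rV[R]_n) j (f : 'rV[R]_n -> R) :
  Cinf f -> Cinf (ray_int a j f).
Proof.
move=> Cf; apply: (Cinf_coind (P := [set g | exists j f, Cinf f /\ g = ray_int a j f])).
  move=> _ [{}j [{}f [{}Cf ->]]]; have df x := ray_int_diff a j x Cf.
  split=> [x|v]; first by have [] := df x.
  exists j.+1, (fun y => 'D_v f y); split; first exact: Cinf_derive.
  apply/funext => x; have [dx dE] := df x.
  rewrite deriveE// dE -ray_int_sum.
    congr ray_int; apply/funext => y.
    by rewrite [RHS]derive_rV//; exact: Cinf_diff.
  by move=> i; apply: Cinf_continuous; exact: Cinf_derive.
by exists j, f.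
Qed.

(** The coefficients are the means of the partial derivatives over the segment from [a] to [x]; the
    expansion is the fundamental theorem of calculus along this segment. *)
Lemma hadamard (R : realType) n (f : 'rV[R]_n -> R) (a : 'rV[R]_n) : Cinf f ->
  exists g : 'I_n -> 'rV[R]_n -> R, [/\ forall i, Cinf (g i),
    forall i, g i a = 'D_(delta_mx 0 i) f a &
    forall x, f x = f a + \sum_i (x 0 i - a 0 i) * g i x].
Proof.
move=> Cf; exists (fun i => ray_int a 0 (fun y => 'D_(delta_mx 0 i) f y)).
have cDf i := Cinf_continuous (Cinf_derive (delta_mx 0 i) Cf).
split=> [i|i|x].
- by apply: ray_int_Cinf; exact: Cinf_derive.
- rewrite /ray_int subrr.
  have -> : (fun t : R => t ^+ 0 * 'D_(delta_mx 0 i) f (a + t *: 0)) =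
      (fun t => 'D_(delta_mx 0 i) f a * cst 1 t).
    by apply/funext => t; rewrite scaler0 addr0 mul1r mulr1.
  rewrite int01Z; last by move=> t; exact: cvg_cst.
  by rewrite /int01 Rintegral_cst//= lebesgue_measure_itv/= lte01 sube0 !mulr1.
- have -> : \sum_i (x 0 i - a 0 i) * ray_int a 0 (fun y => 'D_(delta_mx 0 i) f y) x =
      \sum_i (x - a) 0 i * ray_int a 0 (fun y => 'D_(delta_mx 0 i) f y) x.
    by apply: eq_bigr => i _; rewrite !mxE.
  rewrite -ray_int_sum//.
  have -> : (fun y => \sum_i (x - a) 0 i * 'D_(delta_mx 0 i) f y) =
      (fun y => 'D_(x - a) f y).
    by apply/funext => y; rewrite [RHS]derive_rV//; exact: Cinf_diff.
  have cD := @cont_line _ _ _ a (x - a) 0 (Cinf_continuous (Cinf_derive (x - a) Cf)).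
  have dF (t : R) : is_derive t 1 (fun t => f (a + t *: (x - a)))
      (t ^+ 0 * 'D_(x - a) f (a + t *: (x - a))).
    by rewrite expr0 mul1r; apply: is_derive_line; exact: Cinf_diff.
  rewrite /ray_int (int01_FTC cD dF).
  by rewrite scale1r scale0r addr0 !(addrC a) subrK addrC subrK.
Qed.

(** * Tangent vectors of level sets *)

(* The join of the complete and the normed module structures. *)
HB.instance Definition _ (R : realType) m n := Complete.on 'M[R]_(m, n).

Lemma common_pos (R : realType) m (P : 'I_m -> R -> Prop) :
  (forall j d d', d' <= d -> P j d -> P j d') ->
  (forall j, exists2 d, 0 < d & P j d) -> exists2 d, 0 < d & forall j, P j d.
Proof.
move=> Pmon exP; pose d j := projT1 (cid2 (exP j)).
exists (\big[Num.min/1]_j d j).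
  by apply: lt_bigmin => // j _; rewrite /d; case: cid2.
move=> j; have : P j (d j) by rewrite /d; case: cid2.
by apply: Pmon; exact: bigmin_le.
Qed.

(** The vectors [b i] span a right inverse [B] of the differential at [p]. The correction is sought
    in the form [B z], where [z] is a fixed point of the Newton map whose derivative is frozen at
    [p]; strict differentiability makes this map a contraction of a ball of radius proportional to
    [s]. *)
Lemma lyusternik (R : realType) n m (F : 'I_m -> 'rV[R]_n -> R) p v
    (b : 'I_m -> 'rV[R]_n) :
  (forall j, Cinf (F j)) -> (forall i j, 'D_(b i) (F j) p = (i == j)%:R) ->
  (forall j, 'D_v (F j) p = 0) ->
  forall e, 0 < e -> exists2 d, 0 < d & forall s, 0 < s < d ->
    exists2 y, `|y| <= e * s & forall j, F j (p + s *: v + y) = F j p.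
Proof.
move=> CF bF vF e e0.
pose B (z : 'rV[R]_m) := \sum_i z 0 i *: b i.
have BB z z' : B z - B z' = B (z - z').
  by rewrite /B -sumrB; apply: eq_bigr => i _; rewrite !mxE scalerBl.
pose K := 1 + \sum_i `|b i|.
have K0 : 0 < K by rewrite ltr_pwDl// sumr_ge0.
have BK z : `|B z| <= K * `|z|.
  rewrite (le_trans (ler_norm_sum _ _ _))// mulrDl mul1r -[leLHS]add0r lerD//.
  rewrite mulr_suml ler_sum// => i _.
  by rewrite normrZ mulrC ler_wpM2l// norm_rV_coord.
have DB z j : 'D_(B z) (F j) p = z 0 j.
  have db i : 'd (F j) p (b i) = (i == j)%:R.
    by rewrite -deriveE//; exact: Cinf_diff.
  rewrite deriveE; last exact: Cinf_diff.
  rewrite /B linear_sum (bigD1 j)//= linearZ db eqxx big1 ?addr0.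
    exact: mulr1.
  by move=> i /negPf ij; rewrite linearZ db ij; exact: mulr0.
(* The first bound yields the contraction factor 1/2, the second [|g 0| <= r / 2]; together they
   make [g] preserve the ball of radius [r]. *)
pose eps := Num.min (2 * K)^-1 (e / (2 * K * (`|v| + 1))).
have v1 : 0 < `|v| + 1 by rewrite ltr_wpDl.
have K20 : 0 < 2 * K by rewrite mulr_gt0.
have eps0 : 0 < eps by rewrite lt_min invr_gt0 K20 divr_gt0 ?mulr_gt0.
have [d d0 dP] : exists2 d, 0 < d & forall j x y, `|x - p| < d -> `|y - p| < d ->
    `|F j y - F j x - 'D_(y - x) (F j) p| <= eps * `|y - x|.
  apply: (@common_pos _ _ (fun j d => forall x y, `|x - p| < d -> `|y - p| < d ->
    `|F j y - F j x - 'D_(y - x) (F j) p| <= eps * `|y - x|)).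
    by move=> j d d' dd' H x y xd yd; apply: H; exact: lt_le_trans dd'.
  move=> j; have [d d0 H] := strict_diff p (CF j) eps0; exists d => // x y xd yd.
  by apply: H => //; rewrite subrr normr0.
have ve : 0 < `|v| + e by rewrite ltr_wpDl.
(* All points used are within [s * (|v| + e)] of [p], hence in the ball where the linearization is
   controlled. *)
exists (d / (`|v| + e)); first exact: divr_gt0.
move=> s /andP[s0 sd].
(* With this radius [|B z| <= K * r = e * s], the required size of the correction. *)
pose r := e / K * s; have r0 : 0 < r by rewrite !mulr_gt0 ?invr_gt0.
pose x (z : 'rV[R]_m) := p + s *: v + B z.
have xd z : `|z| <= r -> `|x z - p| < d.
  move=> zr; have -> : x z - p = s *: v + B z by rewrite /x -[_ + _ + B z]addrA [LHS]addrC addKr.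
  rewrite (le_lt_trans (ler_normD _ _))//.
  rewrite ltr_pdivlMr// mulrDr in sd; rewrite (le_lt_trans _ sd)// lerD//.
    by rewrite normrZ gtr0_norm.
  rewrite (le_trans (BK z))// (le_trans (y := K * r))//.
    by rewrite ler_pM2l//; exact: zr.
  by rewrite /r mulrA mulrCA mulfV ?gt_eqF// mulr1 mulrC.
pose g (z : 'rV[R]_m) := \row_j (z 0 j - (F j (x z) - F j p)) : 'rV[R]_m.
pose U := [set z : 'rV[R]_m | `|z| <= r].
have glip z z' : U z -> U z' -> `|g z - g z'| <= 2^-1 * `|z - z'|.
  move=> /xd zd /xd zd'; apply: norm_rV_le => [|j]; first by rewrite mulr_ge0.
  rewrite !mxE.
  have -> : z 0 j - (F j (x z) - F j p) - (z' 0 j - (F j (x z') - F j p)) =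
    - (F j (x z) - F j (x z') - (z - z') 0 j) by rewrite !mxE; ring.
  have xx : x z - x z' = B (z - z') by rewrite -BB /x opprD addrACA subrr add0r.
  rewrite normrN -DB -xx (le_trans (dP _ _ _ zd' zd))// xx.
  rewrite (le_trans (y := (2 * K)^-1 * (K * `|z - z'|)))//.
    by apply: ler_pM => //; [exact: ltW|rewrite /eps ge_min lexx].
  by rewrite invfM -!mulrA mulKf ?gt_eqF.
have g0 : `|g 0| <= r / 2.
  apply: norm_rV_le => [|j]; first by rewrite divr_ge0 ?ltW.
  have B0 : B 0 = 0 by rewrite /B big1// => i _; rewrite mxE scale0r.
  have x0 : x 0 = p + s *: v by rewrite /x B0 addr0.
  have := dP j p (x 0); rewrite subrr normr0 => /(_ d0 (xd 0 _)).
  rewrite normr0 ltW// => /(_ isT); rewrite x0.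
  have -> : p + s *: v - p = s *: v by rewrite addrC addKr.
  have -> : 'D_(s *: v) (F j) p = 0.
    have dv : 'd (F j) p v = 0 by rewrite -deriveE//; exact: Cinf_diff.
    by rewrite deriveE ?linearZ ?dv; [exact: mulr0|exact: Cinf_diff].
  rewrite subr0 !mxE sub0r normrN x0 => /le_trans; apply.
  rewrite normrZ gtr0_norm// (le_trans (y := e / (2 * K * (`|v| + 1)) * (s * `|v|)))//.
    rewrite ler_wpM2r ?mulr_ge0 ?(ltW s0)// /eps ge_min lexx orbT //.
  have -> : e / (2 * K * (`|v| + 1)) * (s * `|v|) = r / 2 * (`|v| / (`|v| + 1)).
    by rewrite /r; field; rewrite !gt_eqF.
  by rewrite ler_piMr ?divr_ge0 ?(ltW r0)// ler_pdivrMr// mul1r lerDl.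
have gU : {homo g : z / U z >-> U z}.
  move=> z Uz; rewrite /U/= -[g z](subrK (g 0)) (le_trans (ler_normD _ _))//.
  have U0 : U 0 by rewrite /U/= normr0 ltW.
  have := glip _ _ Uz U0; rewrite subr0 => /le_trans H.
  have : `|g z - g 0| <= r / 2 by apply: H; rewrite mulrC ler_wpM2r// ltW// invr_gt0.
  by lra.
pose gf : {fun U >-> U} := HB.pack g (isFun.Build _ _ U U g gU).
have half0 : 0 <= 2^-1 :> R by rewrite invr_ge0.
have cgf : is_contraction gf.
  exists (NngNum half0); split=> /=; first by rewrite invf_lt1 ?ltr1n.
  by move=> [z z'] [Uz Uz'] /=; exact: glip.
have clU : closed U.
  have -> : U = (fun z : 'rV[R]_m => `|z|) @^-1` [set t | t <= r] by [].
  by apply: closed_comp; [move=> z _; exact: norm_continuous|exact: closed_le].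
have Une : U !=set0 by exists 0; rewrite /U/= normr0 ltW.
have [z Uz zg] := @banach_fixed_point _ _ _ gf cgf clU Une.
exists (B z).
  rewrite (le_trans (BK z))// (le_trans (y := K * r))//.
    by rewrite ler_pM2l//; exact: Uz.
  by rewrite /r mulrA mulrCA mulfV ?gt_eqF// mulr1.
move=> j; move/rowP: zg => /(_ j); rewrite /= mxE => /eqP.
by rewrite eq_sym subr_eq addrC -subr_eq subrr eq_sym subr_eq0 => /eqP.
Qed.

(* A function vanishing on a regular level set has zero derivative in the
   directions that are tangent to it: these directions are approximated by
   points of the level set. *)
Lemma derive_level_set (R : realType) n m (F : 'I_m -> 'rV[R]_n -> R) p v
    (b : 'I_m -> 'rV[R]_n) (f : 'rV[R]_n -> R) :
  (forall j, Cinf (F j)) -> (forall i j, 'D_(b i) (F j) p = (i == j)%:R) ->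
  (forall j, 'D_v (F j) p = 0) -> Cinf f ->
  (\forall x \near p, (forall j, F j x = F j p) -> f x = f p) ->
  'D_v f p = 0.
Proof.
move=> CF bF vF Cf /nbhs_ballP[d0 /= d0_gt0 Ff].
apply/eqP; rewrite -normr_eq0; apply/negP => /negP c0.
set c := `|_| in c0; have {}c0 : 0 < c by rewrite lt_neqAle eq_sym c0 /c normr_ge0.
pose C := 1 + \sum_i `|'D_(delta_mx 0 i) f p|.
have C0 : 0 < C by rewrite ltr_pwDl// sumr_ge0.
have DfC y : `|'D_y f p| <= C * `|y|.
  rewrite derive_rV; last exact: Cinf_diff.
  rewrite (le_trans (ler_norm_sum _ _ _))// mulrDl mul1r -[leLHS]add0r lerD//.
  rewrite mulr_suml ler_sum// => i _.
  by rewrite normrM mulrC ler_wpM2l// norm_rV_coord.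
have v1 : 0 < `|v| + 1 by rewrite ltr_wpDl.
(* The linearization error of [f] and its derivative along the correction [y] are each made at most
   [s * c / 4], while their sum has to be at least [s * c]. *)
have [d1 d1_gt0 sd] := strict_diff p Cf (divr_gt0 c0 (mulr_gt0 (ltr0n R 4) v1)).
pose e := Num.min 1 (c / (4 * C)).
have e0 : 0 < e by rewrite lt_min ltr01 divr_gt0 ?mulr_gt0.
have [d2 d2_gt0 /= ly] := lyusternik CF bF vF e0.
(* Since [|w| <= s * (|v| + 1)], this choice keeps [p + w] inside both neighbourhoods of [p]. *)
pose s := Num.min (d2 / 2) (Num.min (d0 / 2) (d1 / 2) / (`|v| + 1)).
have s0 : 0 < s by rewrite !(lt_min, divr_gt0).
have [|y ys yF] := ly s; first by rewrite s0/= gt_min ltr_pdivrMr// ltr_pMr// ltr1n.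
pose w := s *: v + y.
have wle : `|w| <= s * (`|v| + 1).
  rewrite (le_trans (ler_normD _ _))// mulrDr mulr1 lerD//.
    by rewrite normrZ gtr0_norm.
  by rewrite (le_trans ys)// ler_piMl ?(ltW s0)// /e ge_min lexx.
have sle : s * (`|v| + 1) <= Num.min (d0 / 2) (d1 / 2).
  by rewrite -ler_pdivlMr// /s ge_min lexx orbT.
have wd0 : `|w| < d0.
  rewrite (le_lt_trans wle)// (le_lt_trans sle)// gt_min ltr_pdivrMr//.
  by rewrite ltr_pMr// ltr1n.
have wd1 : `|w| < d1.
  rewrite (le_lt_trans wle)// (le_lt_trans sle)// gt_min.
  by rewrite orbC ltr_pdivrMr// ltr_pMr// ltr1n.
have fw : f (p + w) = f p.
  apply: Ff; first by rewrite -ball_normE/= opprD addNKr normrN.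
  by move=> j; rewrite /w addrA yF.
have := sd p (p + w) p; have -> : p + w - p = w by rewrite addrC addKr.
rewrite subrr normr0 => /(_ d1_gt0 wd1 d1_gt0).
rewrite fw subrr sub0r normrN.
have -> : 'D_w f p = s * 'D_v f p + 'D_y f p.
  rewrite !deriveE; [|exact: Cinf_diff..].
  by rewrite /w linearD linearZ.
move=> le1.
have le2 : s * c <= `|s * 'D_v f p + 'D_y f p| + `|'D_y f p|.
  rewrite -[s](gtr0_norm s0) -normrM -[X in `|X| <= _](addrK ('D_y f p)).
  by rewrite gtr0_norm// ler_normB.
have le3 : `|'D_y f p| <= s * (c / 4).
  rewrite (le_trans (DfC y))// (le_trans (y := C * (e * s)))// ?ler_pM2l//.
  rewrite mulrA mulrC ler_pM2l// mulrC -ler_pdivlMr// -mulrA -invfM.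
  by rewrite /e ge_min lexx orbT.
have le4 : c / (4 * (`|v| + 1)) * `|w| <= s * (c / 4).
  rewrite (le_trans (y := c / (4 * (`|v| + 1)) * (s * (`|v| + 1))))//.
    by rewrite ler_wpM2l// divr_ge0 ?ltW// mulr_gt0.
  rewrite le_eqVlt; apply/orP; left; apply/eqP; field.
  by rewrite gt_eqF.
have := le_trans le2 (lerD (le_trans le1 le4) le3).
rewrite -mulrDr ler_pM2l//; lra.
Qed.

(** * Locally smooth functions *)

Section fnbhs.
Context {R : realType} {T : Type}.
Implicit Types (F : set (T -> R)) (x : T) (A B : set T).

Lemma fnbhs_point F x A : fnbhs F x A -> A x.
Proof. by move=> [k [f [e [_ e0 fA]]]]; apply: fA => i; rewrite subrr normr0. Qed.

Lemma fnbhsS F x A B : A `<=` B -> fnbhs F x A -> fnbhs F x B.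
Proof.
move=> AB [k [f [e [Ff e0 fA]]]]; exists k, f, e; split=> // y /fA.
exact: AB.
Qed.

Lemma fnbhsT F x : fnbhs F x setT.
Proof. by exists 0%N, (fun _ _ => 0), 1; split=> // -[]. Qed.

Lemma fnbhsI F x A B : fnbhs F x A -> fnbhs F x B -> fnbhs F x (A `&` B).
Proof.
move=> [k [f [e [Ff e0 fA]]]] [l [g [d [Fg d0 gB]]]].
pose h (i : 'I_(k + l)) := match fintype.split i with inl j => f j | inr j => g j end.
exists (k + l)%N, h, (Num.min e d); split=> [i||y hy].
- by rewrite /h; case: fintype.split.
- by rewrite lt_min e0.
- split.
    apply: fA => i; have := hy (lshift l i).
    by rewrite /h (unsplitK (inl i)) lt_min => /andP[].
  apply: gB => i; have := hy (rshift k i).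
  by rewrite /h (unsplitK (inr i)) lt_min => /andP[].
Qed.

Lemma fnbhs_forall F x n (A : 'I_n -> set T) :
  (forall i, fnbhs F x (A i)) -> fnbhs F x [set y | forall i, A i y].
Proof.
move=> FA; suff : fnbhs F x [set y | forall i, i \in index_enum 'I_n -> A i y].
  by apply: fnbhsS => y yA i; apply: yA; rewrite mem_index_enum.
elim: (index_enum _) => [|i s IHs]; first by apply: fnbhsS (fnbhsT F x).
apply: fnbhsS (fnbhsI (FA i) IHs) => y [yi ys] j.
by rewrite inE => /predU1P[->//|]; exact: ys.
Qed.

(** A basic neighbourhood is open: at each of its points the finitely many strict inequalities leave
    a common margin. *)
Lemma fnbhs_open F x A : fnbhs F x A ->
  exists O : set T, [/\ O x, O `<=` A & forall y, O y -> fnbhs F y O].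
Proof.
move=> [k [f [e [Ff e0 fA]]]].
exists [set y | forall i, `|f i y - f i x| < e]; split=> //.
  by move=> i; rewrite subrr normr0.
move=> y /= Oy.
have [d d0 dP] : exists2 d, 0 < d & forall i, `|f i y - f i x| + d < e.
  have [|i|d d0 dP] := @common_pos R k (fun i d => `|f i y - f i x| + d < e).
  - by move=> i d d' dd' /(le_lt_trans _); apply; rewrite lerD2l.
  - exists ((e - `|f i y - f i x|) / 2); first by rewrite divr_gt0// subr_gt0.
    by have := Oy i; lra.
  - by exists d.
exists k, f, d; split=> // z zy i.
rewrite -(subrK (f i y) (f i z)) -addrA (le_lt_trans (ler_normD _ _))//.
by rewrite [ltLHS]addrC (lt_trans _ (dP i))// ltrD2l; exact: zy.
Qed.

Lemma fnbhs_coord F x f (e : R) : F f -> 0 < e ->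
  fnbhs F x [set y | `|f y - f x| < e].
Proof. by move=> Ff e0; exists 1%N, (fun=> f), e; split=> // y /(_ ord0). Qed.

Lemma fnbhs_row F x k (f : 'I_k -> T -> R) (A : set 'rV[R]_k) :
  (forall i e, 0 < e -> fnbhs F x [set y | `|f i y - f i x| < e]) ->
  nbhs (\row_i f i x) A -> fnbhs F x [set y | A (\row_i f i y)].
Proof.
move=> Ff /nbhs_ballP[d /= d0 dA].
have := @fnbhs_forall F x _ _ (fun i => Ff i (d / 2) (divr_gt0 d0 (ltr0n R 2))).
apply: fnbhsS => y fy; apply: dA; rewrite -ball_normE/= distrC.
apply: (@le_lt_trans _ _ (d / 2)); last by rewrite ltr_pdivrMr// ltr_pMr// ltr1n.
apply: norm_rV_le => [|i]; first by rewrite divr_ge0// ltW.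
by rewrite !mxE ltW//; exact: fy.
Qed.

(* [h] agrees near [x] with a smooth function of finitely many elements of [F];
   thus [fgen F] consists of the [h] with [lsm F x h] for all [x]. *)
Definition lsm F x (h : T -> R) : Prop :=
  exists k (f : 'I_k -> T -> R) (w : 'rV[R]_k -> R),
    [/\ forall i, F (f i), Cinf w & fnbhs F x [set y | h y = w (\row_i f i y)]].

Lemma lsm_eq F x h h' : fnbhs F x [set y | h y = h' y] -> lsm F x h -> lsm F x h'.
Proof.
move=> hh' [k [f [w [Ff Cw hw]]]]; exists k, f, w; split=> //.
by apply: fnbhsS (fnbhsI hh' hw) => y [/= <-].
Qed.

Lemma lsm_ext F x h h' : h =1 h' -> lsm F x h -> lsm F x h'.
Proof. by move=> hh'; apply: lsm_eq; apply: fnbhsS (fnbhsT F x) => y _ /=. Qed.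

Lemma lsm_sub F x h : F h -> lsm F x h.
Proof.
move=> Fh; exists 1%N, (fun=> h), (fun z => z 0 0); split=> //.
  exact: Cinf_coord.
by apply: fnbhsS (fnbhsT F x) => y _ /=; rewrite mxE.
Qed.

Lemma lsm_cont F x h (e : R) : lsm F x h -> 0 < e ->
  fnbhs F x [set y | `|h y - h x| < e].
Proof.
move=> [k [f [w [Ff Cw hw]]]] e0.
have : fnbhs F x [set y | `|w (\row_i f i y) - w (\row_i f i x)| < e].
  apply: (@fnbhs_row _ _ _ _ [set z | `|w z - w (\row_i f i x)| < e]).
    by move=> i d d0; exact: fnbhs_coord.
  have cw : w z @[z --> \row_i f i x] --> w (\row_i f i x).
    exact: Cinf_continuous.
  by apply: (@cvgr_distC_lt _ _ _ (nbhs (\row_i f i x)) _ _ _ cw).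
move=> /(fnbhsI hw); apply: fnbhsS => y [/= ->].
by rewrite (fnbhs_point hw).
Qed.

(** The finitely many functions that represent each [h i] are gathered in one family, indexed by the
    pairs in [J]; [W] evaluates the composite on its coordinates. *)
Lemma lsm_comp F x n (h : 'I_n -> T -> R) (w : 'rV[R]_n -> R) :
  (forall i, lsm F x (h i)) -> Cinf w -> lsm F x (fun y => w (\row_i h i y)).
Proof.
move=> lh Cw.
have /choice[p pP] : forall i, exists p : {k & (('I_k -> T -> R) * ('rV[R]_k -> R))%type},
    [/\ forall j, F ((tagged p).1 j), Cinf (tagged p).2 &
      fnbhs F x [set y | h i y = (tagged p).2 (\row_j (tagged p).1 j y)]].
  by move=> i; have [k [f [v H]]] := lh i; exists (existT _ k (f, v)).
pose J := {i : 'I_n & 'I_(tag (p i))}.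
pose g (j : 'I_#|{: J}|) : T -> R :=
  (tagged (p (tag (enum_val j)))).1 (tagged (enum_val j)).
pose W (z : 'rV[R]_#|{: J}|) := w (\row_i (tagged (p i)).2
  (\row_j z 0 (enum_rank (Tagged (fun i => 'I_(tag (p i))) j : J)))).
exists #|{: J}|, g, W; split=> [j||].
- by rewrite /g; have [+ _ _] := pP (tag (enum_val j)); apply.
- apply: (Cinf_comp (g := fun i z => (tagged (p i)).2 _)) => // i.
  apply: (Cinf_comp (g := fun j z => z 0 _)); first by have [] := pP i.
  by move=> j; exact: Cinf_coord.
- have : fnbhs F x [set y | forall i, h i y =
      (tagged (p i)).2 (\row_j (tagged (p i)).1 j y)].
    by apply: fnbhs_forall => i; have [] := pP i.
  apply: fnbhsS => y /= hy; rewrite /W; congr w; apply/rowP => i.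
  rewrite !mxE hy; congr (tagged (p i)).2; apply/rowP => j.
  by rewrite !mxE /g enum_rankK.
Qed.

Lemma lsm_comp1 F x h (w : 'rV[R]_1 -> R) :
  lsm F x h -> Cinf w -> lsm F x (fun y => w (\row_i h y)).
Proof. by move=> lh; exact: (@lsm_comp _ _ _ (fun=> h)). Qed.

Lemma lsm_comp2 F x g h (w : 'rV[R]_2 -> R) :
  lsm F x g -> lsm F x h -> Cinf w ->
  lsm F x (fun y => w (\row_i if i == 0 then g y else h y)).
Proof.
move=> lg lh Cw.
by apply: (@lsm_comp _ _ _ (fun i y => if i == 0 then g y else h y)) => // i; case: (i == 0).
Qed.

Lemma lsmD F x g h : lsm F x g -> lsm F x h -> lsm F x (fun y => g y + h y).
Proof.
move=> lg lh; apply: lsm_ext (lsm_comp2 lg lh (CinfD (Cinf_coord R 0) (Cinf_coord R 1))).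
by move=> y; rewrite !mxE.
Qed.

Lemma lsmM F x g h : lsm F x g -> lsm F x h -> lsm F x (fun y => g y * h y).
Proof.
move=> lg lh; apply: lsm_ext (lsm_comp2 lg lh (CinfM (Cinf_coord R 0) (Cinf_coord R 1))).
by move=> y; rewrite !mxE.
Qed.

Lemma lsm_cst F x (c : R) : lsm F x (fun=> c).
Proof.
apply: (@lsm_comp _ _ 0 (fun _ _ => 0) (fun=> c)); first by case.
exact: Cinf_cst.
Qed.

(** Only the germ matters, so the reciprocal may be replaced by the everywhere smooth function of
    [Cinf_recip]. *)
Lemma lsmV F x g : lsm F x g -> g x != 0 -> lsm F x (fun y => (g y)^-1).
Proof.
move=> lg gx; have [w [Cw [e e0 we]]] := Cinf_recip gx.
apply: lsm_eq (lsm_comp1 lg Cw).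
by apply: fnbhsS (lsm_cont lg e0) => y /= ye; rewrite we mxE.
Qed.

Lemma fnbhs_fgen F x A : fnbhs (fgen F) x A -> fnbhs F x A.
Proof.
move=> [k [f [e [Ff e0 fA]]]].
have : fnbhs F x [set y | forall i, `|f i y - f i x| < e].
  by apply: fnbhs_forall => i; apply: lsm_cont => //; exact: Ff.
by apply: fnbhsS => y; exact: fA.
Qed.

Lemma lsm_fgen F x h : lsm (fgen F) x h -> lsm F x h.
Proof.
move=> [k [f [w [Ff Cw hw]]]].
apply: (@lsm_eq _ _ (fun y => w (\row_i f i y))).
  by apply: fnbhsS (fnbhs_fgen hw) => y /= ->.
by apply: lsm_comp => // i; exact: Ff.
Qed.

Lemma fgen_idem F : fgen (fgen F) `<=` fgen F.
Proof. by move=> h hF x; apply: lsm_fgen; exact: hF. Qed.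

End fnbhs.

(** * Differential spaces and derivations *)

Lemma fnbhs_Cinf (R : realType) n (z : 'rV[R]_n) A :
  fnbhs (@Cinf R n) z A <-> nbhs z A.
Proof.
split=> [[k [f [e [Cf e0 fA]]]]|zA].
  have : \forall y \near z, forall i, `|f i y - f i z| < e.
    apply: (@filter_forall _ _ (fun i y => `|f i y - f i z| < e) (nbhs z)) => i.
    have cf : f i y @[y --> z] --> f i z by exact: Cinf_continuous.
    by apply: (@cvgr_distC_lt _ _ _ (nbhs z) _ _ _ cf).
  by apply: filterS => y; exact: fA.
pose f (i : 'I_n) (y : 'rV[R]_n) := y 0 i.
have rowK y : \row_i f i y = y by apply/rowP => i; rewrite mxE.
apply: (@fnbhsS _ _ _ _ [set y | A (\row_i f i y)]).
  by move=> y /=; rewrite rowK.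
apply: fnbhs_row; last by rewrite rowK.
by move=> i e e0; apply: fnbhs_coord => //; exact: Cinf_coord.
Qed.

Lemma lsm_Cinf (R : realType) n (z : 'rV[R]_n) h : lsm (@Cinf R n) z h <->
  exists2 w, Cinf w & \forall y \near z, h y = w y.
Proof.
split=> [[k [f [w [Cf Cw /fnbhs_Cinf hw]]]]|[w Cw hw]].
  by exists (fun y => w (\row_i f i y)) => //; exact: Cinf_comp.
apply: (@lsm_eq _ _ _ _ w); last exact: lsm_sub.
by apply/fnbhs_Cinf; apply: filterS hw => y /= ->.
Qed.

Section smooth_at.
Context {R : realType}.
Implicit Types X Y Z : dspace R.

(** The locality axiom of differential spaces, by which smoothness can be checked point by point. *)
Definition dclosed X := fgen (fct X) `<=` fct X.

Definition smooth_at X Y (g : X -> Y) (x : X) : Prop :=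
  forall h, fct Y h -> lsm (fct X) x (h \o g).

Lemma smooth_smooth_at X Y (g : X -> Y) x : smooth g -> smooth_at g x.
Proof. by move=> sg h /sg; exact: lsm_sub. Qed.

Lemma smooth_atP X Y (g : X -> Y) :
  dclosed X -> (forall x, smooth_at g x) -> smooth g.
Proof. by move=> cX sg h Yh; apply: cX => x; exact: sg. Qed.

Lemma smooth_at_near X Y (g : X -> Y) x A : smooth_at g x ->
  fnbhs (fct Y) (g x) A -> fnbhs (fct X) x [set y | A (g y)].
Proof.
move=> sg [k [f [e [Yf e0 fA]]]].
have : fnbhs (fct X) x [set y | forall i, `|f i (g y) - f i (g x)| < e].
  apply: fnbhs_forall => i.
  exact: (lsm_cont (sg _ (Yf i)) e0).
by apply: fnbhsS => y; exact: fA.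
Qed.

Lemma smooth_at_lsm X Y (g : X -> Y) x h : smooth_at g x ->
  lsm (fct Y) (g x) h -> lsm (fct X) x (h \o g).
Proof.
move=> sg [k [f [w [Yf Cw hw]]]].
apply: (@lsm_eq _ _ _ _ (fun y => w (\row_i f i (g y)))).
  by apply: fnbhsS (smooth_at_near sg hw) => y /= ->.
apply: (@lsm_comp _ _ _ _ _ (fun i => f i \o g)) => // i.
exact/sg/Yf.
Qed.

Lemma smooth_at_gen X Y (E : set (Y -> R)) (g : X -> Y) x : fct Y = fgen E ->
  (forall h, E h -> lsm (fct X) x (h \o g)) -> smooth_at g x.
Proof.
move=> YE Eg h; rewrite YE => /(_ (g x)) hE.
have sg : @smooth_at X (DSpace E) g x by [].
exact: (@smooth_at_lsm X (DSpace E)).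
Qed.

Lemma smooth_at_eq X Y (g g' : X -> Y) x :
  fnbhs (fct X) x [set y | g y = g' y] -> smooth_at g x -> smooth_at g' x.
Proof.
move=> gg' sg h /sg; apply: lsm_eq; apply: fnbhsS gg' => y /= ->.
by [].
Qed.

Lemma smooth_at_comp X Y Z (g : X -> Y) (f : Y -> Z) x :
  smooth_at g x -> smooth_at f (g x) -> smooth_at (f \o g) x.
Proof. by move=> sg sf h /sf; exact: smooth_at_lsm. Qed.

Lemma smooth_at_id X (x : X) : smooth_at (fun y : X => y) x.
Proof. by move=> h Xh; exact: lsm_sub. Qed.

Lemma smooth_id X : smooth (fun y : X => y).
Proof. by []. Qed.

Lemma smooth_comp X Y Z (g : X -> Y) (f : Y -> Z) :
  smooth g -> smooth f -> smooth (f \o g).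
Proof. by move=> sg sf h /sf/sg. Qed.

Lemma dclosed_dsub X (A : set X) : dclosed (dsub A).
Proof. exact: fgen_idem. Qed.

Lemma dclosed_dprod X Y : dclosed (dprod X Y).
Proof. exact: fgen_idem. Qed.

Lemma dclosed_tspace X : dclosed (tspace X).
Proof. exact: fgen_idem. Qed.

Lemma smooth_sval X (A : set X) : smooth (fun p : dsub A => sval p).
Proof. by move=> h Xh x; apply: lsm_sub; exists h. Qed.

Lemma smooth_at_dsub X Y (A : set Y) (g : X -> dsub A) x :
  smooth_at (fun y => sval (g y)) x -> smooth_at g x.
Proof.
by move=> sg; apply: smooth_at_gen => // h [f Yf ->]; exact: sg.
Qed.

Lemma smooth_fst X Y : smooth (fun p : dprod X Y => p.1).
Proof. by move=> h Xh x; apply: lsm_sub; left; exists h. Qed.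

Lemma smooth_snd X Y : smooth (fun p : dprod X Y => p.2).
Proof. by move=> h Yh x; apply: lsm_sub; right; exists h. Qed.

Lemma smooth_at_dprod X Y Z (g : X -> dprod Y Z) x :
  smooth_at (fun y => (g y).1) x -> smooth_at (fun y => (g y).2) x ->
  smooth_at g x.
Proof.
by move=> s1 s2; apply: smooth_at_gen => // h [][f Yf ->]; [exact: s1|exact: s2].
Qed.

Lemma smooth_dprod X Y Z (f : X -> Y) (g : X -> Z) :
  dclosed X -> smooth f -> smooth g ->
  smooth (fun x => (f x, g x) : dprod Y Z).
Proof.
move=> cX sf sg; apply: smooth_atP => // x.
by apply: smooth_at_dprod; exact: smooth_smooth_at.
Qed.

Lemma smooth_tbase X : smooth (@tbase R X : tspace X -> X).
Proof. by move=> h Xh x; apply: lsm_sub; left; exists h. Qed.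

Lemma smooth_tder X (h : X -> R) : fct X h ->
  fct (tspace X) (fun v => tder v h).
Proof. by move=> Xh x; apply: lsm_sub; right; exists h. Qed.

Lemma smooth_at_tspace X Y (g : X -> tspace Y) x :
  smooth_at (fun y => tbase (g y)) x ->
  (forall h, fct Y h -> lsm (fct X) x (fun y => tder (g y) h)) ->
  smooth_at g x.
Proof.
by move=> s1 s2; apply: smooth_at_gen => // h [][f Yf ->]; [exact: s1|exact: s2].
Qed.

Lemma smooth_at_euclid X n (g : X -> euclid R n) x :
  (forall i, lsm (fct X) x (fun y => (g y : 'rV[R]_n) 0 i)) -> smooth_at g x.
Proof.
move=> sg h Ch; apply: lsm_ext (lsm_comp sg Ch) => y /=.
by congr h; apply/rowP => i; rewrite mxE.
Qed.

(** A smooth function on [A] is locally an expression in restrictions. Replacing these by the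
    functions that they restrict gives an expression defined on the whole of [Y], which can be
    composed with [g]. *)
Lemma smooth_on_comp X Y Z (A : set Y) (f : Y -> Z) (g : X -> Y) x :
  smooth_on A f -> smooth_at g x -> fnbhs (fct X) x [set y | A (g y)] ->
  smooth_at (f \o g) x.
Proof.
move=> sf sg nA h /sf; have Ax := fnbhs_point nA.
move=> /(_ (exist _ (g x) Ax)) [k [b [w [Yb Cw hw]]]].
have /choice[b' b'P] i : exists b', fct Y b' /\ b i = b' \o sval.
  by have [b' Yb' ->] := Yb i; exists b'.
have [l [u [e [Yu e0 uA]]]] := hw.
have /choice[u' u'P] i : exists u', fct Y u' /\ u i = u' \o sval.
  by have [u' Yu' ->] := Yu i; exists u'.
apply: (@lsm_eq _ _ _ _ (fun y => w (\row_i b' i (g y)))); last first.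
  apply: (@lsm_comp _ _ _ _ _ (fun i y => b' i (g y))) => // i; apply: sg.
  by have [] := b'P i.
have : fnbhs (fct X) x [set y | forall i, `|u' i (g y) - u' i (g x)| < e].
  apply: fnbhs_forall => i; have [Yu' _] := u'P i.
  exact: (lsm_cont (sg _ Yu') e0).
move=> /(fnbhsI nA); apply: fnbhsS => y [Ay uy].
have := uA (exist _ (g y) Ay); rewrite /= => -> //.
  by congr w; apply/rowP => i; rewrite !mxE; have [_ ->] := b'P i.
by move=> i; have [_ ->] := u'P i; exact: uy.
Qed.

Lemma smooth_on_at X Y (A : set X) (f : X -> Y) x :
  fnbhs (fct X) x A -> smooth_on A f -> smooth_at f x.
Proof. by move=> nA sf; exact: (smooth_on_comp sf (@smooth_at_id X x)). Qed.

(** The expression representing the germ is itself defined everywhere, and serves as the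
    extension. *)
Lemma lsm_dclosed X x h : dclosed X -> lsm (fct X) x h ->
  exists2 g, fct X g & fnbhs (fct X) x [set y | h y = g y].
Proof.
move=> cX [k [f [w [Xf Cw hw]]]]; exists (fun y => w (\row_i f i y)) => //.
by apply: cX => y; apply: lsm_comp => // i; apply: lsm_sub.
Qed.

Lemma fct_lsm X h : dclosed X -> (forall x, lsm (fct X) x h) -> fct X h.
Proof. by move=> cX lh; exact: cX. Qed.

End smooth_at.

Section derivations.
Context {R : realType}.
Implicit Types X Y Z : dspace R.

Lemma tvec_ext X (v w : tvec X) : tbase v = tbase w -> tder v =1 tder w -> v = w.
Proof.
case: v w => [x D DP] [y D' D'P] /= xy DD'.
have {}DD' : D = D' by apply/funext.
subst; congr TVec; exact: Prop_irrelevance.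
Qed.

Section vector.
Context {X : dspace R} (cX : dclosed X) (v : tvec X).
Local Notation x := (tbase v).
Local Notation fX := (fct X).

Lemma fct_cst (c : R) : fX (fun=> c).
Proof. by apply: fct_lsm => // y; exact: lsm_cst. Qed.

Lemma fctD f g : fX f -> fX g -> fX (fun y => f y + g y).
Proof. by move=> *; apply: fct_lsm => // y; apply: lsmD; exact: lsm_sub. Qed.

Lemma fctM f g : fX f -> fX g -> fX (fun y => f y * g y).
Proof. by move=> *; apply: fct_lsm => // y; apply: lsmM; exact: lsm_sub. Qed.

Lemma fctZD (a : R) f g : fX f -> fX g -> fX (fun y => a * f y + g y).
Proof. by move=> Xf Xg; apply: fctD => //; apply: fctM => //; exact: fct_cst. Qed.

Lemma fct_comp n (f : 'I_n -> X -> R) w :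
  (forall i, fX (f i)) -> Cinf w -> fX (fun y => w (\row_i f i y)).
Proof.
by move=> Xf Cw; apply: fct_lsm => // y; apply: lsm_comp => // i; exact: lsm_sub.
Qed.

Lemma fct_sum (I : Type) (s : seq I) (f : I -> X -> R) :
  (forall i, fX (f i)) -> fX (fun y => \sum_(i <- s) f i y).
Proof.
move=> Xf; elim: s => [|i s IHs].
  by under eq_fun do rewrite big_nil; exact: fct_cst.
by under eq_fun do rewrite big_cons; exact: fctD.
Qed.

Lemma tder0 f : ~ fX f -> tder v f = 0.
Proof. by have [+ _ _] := tderP v; apply. Qed.

Lemma tderZD a f g : fX f -> fX g ->
  tder v (fun y => a * f y + g y) = a * tder v f + tder v g.
Proof. by have [_ + _] := tderP v; apply. Qed.

Lemma tderM f g : fX f -> fX g ->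
  tder v (fun y => f y * g y) = f x * tder v g + g x * tder v f.
Proof. by have [_ _] := tderP v; apply. Qed.

Lemma tder_cst c : tder v (fun=> c) = 0.
Proof.
have D1 : tder v (fun=> 1) = 0.
  have := tderM (fct_cst 1) (fct_cst 1); rewrite !mulr1.
  move=> /eqP; rewrite mul1r.
  by rewrite -{1}[tder v _]addr0 (inj_eq (addrI _)) eq_sym => /eqP.
have D0 : tder v (fun=> 0) = 0.
  have := tderZD 0 (fct_cst 0) (fct_cst 0); rewrite mul0r addr0 mul0r add0r.
  have := tderM (fct_cst 0) (fct_cst 0).
  by rewrite !mul0r addr0.
have := tderZD c (fct_cst 1) (fct_cst 0); rewrite mulr1 addr0 => ->.
by rewrite D1 D0 mulr0 addr0.
Qed.

Lemma tderD f g : fX f -> fX g ->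
  tder v (fun y => f y + g y) = tder v f + tder v g.
Proof.
move=> Xf Xg; rewrite -[tder v f in RHS]mul1r -tderZD//; congr tder.
by apply/funext => y; rewrite mul1r.
Qed.

Lemma tder_sum (I : Type) (s : seq I) (f : I -> X -> R) :
  (forall i, fX (f i)) ->
  tder v (fun y => \sum_(i <- s) f i y) = \sum_(i <- s) tder v (f i).
Proof.
move=> Xf; elim: s => [|i s IHs].
  by under eq_fun do rewrite big_nil; rewrite tder_cst big_nil.
by under eq_fun do rewrite big_cons; rewrite tderD ?big_cons ?IHs//; exact: fct_sum.
Qed.

(* Multiply the difference by a bump function. *)
Lemma tder_eq f g : fX f -> fX g -> fnbhs fX x [set y | f y = g y] ->
  tder v f = tder v g.
Proof.
move=> Xf Xg [k [u [e [Xu e0 uA]]]].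
have [b [Cb bx b0]] := Cinf_bump (\row_i u i x) e0.
pose B y := b (\row_i u i y).
have XB : fX B by exact: fct_comp.
have E : (fun y => B y * f y) = (fun y => B y * g y).
  apply/funext => y; have [->|By] := eqVneq (B y) 0; first by rewrite !mul0r.
  congr (_ * _); apply: uA => i; have := b0 _ By i; by rewrite !mxE.
have := tderM XB Xf; have := tderM XB Xg; rewrite E /B bx => ->.
have fg : f x = g x by apply: uA => i; rewrite subrr normr0.
by rewrite fg !mul1r => /addIr.
Qed.

(** Chain rule for derivations: in the Hadamard expansion of [w] at the image point, the Leibniz
    rule retains only the values of the coefficients at that point. *)
Lemma tder_comp n (f : 'I_n -> X -> R) w : (forall i, fX (f i)) -> Cinf w ->
  tder v (fun y => w (\row_i f i y)) =
  \sum_i tder v (f i) * 'D_(delta_mx 0 i) w (\row_i f i x).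
Proof.
move=> Xf Cw; set a := \row_i f i x.
have [g [Cg ga wE]] := hadamard a Cw.
have -> : (fun y => w (\row_i f i y)) =
    (fun y => w a + \sum_i (f i y - f i x) * g i (\row_i f i y)).
  apply/funext => y; rewrite wE; congr (_ + _).
  by apply: eq_bigr => i _; rewrite !mxE.
have Xd i : fX (fun y => f i y - f i x) by apply: fctD => //; exact: fct_cst.
have Xg i : fX (fun y => g i (\row_i f i y)) by exact: fct_comp.
have Xp i : fX (fun y => (f i y - f i x) * g i (\row_i f i y)) by exact: fctM.
rewrite tderD; [|exact: fct_cst|exact: fct_sum].
rewrite tder_cst add0r tder_sum//; apply: eq_bigr => i _.
rewrite tderM// subrr mul0r add0r tderD//; last exact: fct_cst.
by rewrite tder_cst addr0 mulrC ga.
Qed.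

End vector.
End derivations.

(** * Tangent maps and charts *)

Section tangent_maps.
Context {R : realType}.
Implicit Types X Y Z : dspace R.

Lemma tbase_mktvec X (x : X) D : tbase (mktvec x D) = x.
Proof. by rewrite /mktvec; case: pselect. Qed.

Lemma tder_mktvec X (x : X) D : derivation_at x D -> tder (mktvec x D) = D.
Proof. by rewrite /mktvec; case: pselect. Qed.

Lemma derivation_tmap X Y (f : X -> Y) (v : tvec X) : dclosed Y -> smooth f ->
  derivation_at (f (tbase v))
    (fun h => if pselect (fct Y h) then tder v (h \o f) else 0).
Proof.
move=> cY sf; split=> [h|a g h Yg Yh|g h Yg Yh].
- by case: pselect.
- case: pselect => /= [_|[]]; last exact: fctZD.
  case: pselect => //= _; case: pselect => //= _.
  by rewrite -tderZD//; exact: sf.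
- case: pselect => /= [_|[]]; last exact: fctM.
  case: pselect => //= _; case: pselect => //= _.
  by rewrite -[f _]/((fun y => f y) _) -tderM//; exact: sf.
Qed.

Lemma tbase_tmap X Y (f : X -> Y) v : tbase (tmap f v) = f (tbase v).
Proof. exact: tbase_mktvec. Qed.

Lemma tder_tmap X Y (f : X -> Y) (v : tspace X) h :
  dclosed Y -> smooth f -> fct Y h -> tder (tmap f v) h = tder v (h \o f).
Proof.
move=> cY sf Yh; rewrite /tmap tder_mktvec; last exact: derivation_tmap.
by case: pselect.
Qed.

Lemma tvec_fct_ext X (v w : tvec X) : tbase v = tbase w ->
  (forall h, fct X h -> tder v h = tder w h) -> v = w.
Proof.
move=> vw dvw; apply: tvec_ext => // h.
by have [/dvw//|Xh] := pselect (fct X h); rewrite !tder0.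
Qed.

Lemma tmap_comp X Y Z (f : X -> Y) (g : Y -> Z) (v : tspace X) :
  dclosed Y -> dclosed Z -> smooth f -> smooth g ->
  tmap g (tmap f v) = tmap (g \o f) v.
Proof.
move=> cY cZ sf sg; have sgf := smooth_comp sf sg.
apply: tvec_fct_ext => [|h Zh]; first by rewrite !tbase_tmap.
by rewrite !tder_tmap//; exact: sg.
Qed.

Lemma tmap_id X (v : tspace X) : dclosed X -> tmap (fun x : X => x) v = v.
Proof.
move=> cX; apply: tvec_fct_ext => [|h Xh]; first by rewrite tbase_tmap.
by rewrite tder_tmap//; exact: smooth_id.
Qed.

Lemma smooth_tmap X Y (f : X -> Y) : dclosed Y -> smooth f ->
  smooth (tmap f : tspace X -> tspace Y).
Proof.
move=> cY sf; apply: smooth_atP; first exact: dclosed_tspace.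
move=> v; apply: smooth_at_tspace => [|h Yh].
  have -> : (fun w => tbase (tmap f w)) = f \o @tbase R X.
    by apply/funext => w; rewrite tbase_tmap.
  by apply: smooth_smooth_at; apply: smooth_comp sf; exact: smooth_tbase.
apply: (@lsm_ext _ _ _ _ (fun w => tder w (h \o f))).
  by move=> w; rewrite tder_tmap.
by apply: lsm_sub; apply: smooth_tder; exact: sf.
Qed.

Lemma tder_add X (v w : tspace X) h : dclosed X -> tbase v = tbase w ->
  tder (vadd (tbundle X) v w) h = tder v h + tder w h.
Proof.
move=> cX vw; rewrite /= tder_mktvec//; split=> [f Xf|a f g Xf Xg|f g Xf Xg].
- by rewrite !tder0// addr0.
- by rewrite !tderZD//; ring.
- by rewrite !tderM// vw; ring.
Qed.

Lemma tder_scale X a (v : tspace X) h : dclosed X ->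
  tder (vscale (tbundle X) a v) h = a * tder v h.
Proof.
move=> cX; rewrite /= tder_mktvec//; split=> [f Xf|b f g Xf Xg|f g Xf Xg].
- by rewrite tder0// mulr0.
- by rewrite tderZD//; ring.
- by rewrite tderM//; ring.
Qed.

Lemma tmap_add X Y (f : X -> Y) (v w : tspace X) :
  dclosed X -> dclosed Y -> smooth f -> tbase v = tbase w ->
  tmap f (vadd (tbundle X) v w) = vadd (tbundle Y) (tmap f v) (tmap f w).
Proof.
move=> cX cY sf vw; have fvw : tbase (tmap f v) = tbase (tmap f w).
  by rewrite !tbase_tmap vw.
apply: tvec_fct_ext => [|h Yh]; first by rewrite !(tbase_tmap, tbase_mktvec).
by rewrite tder_add// !tder_tmap// tder_add.
Qed.

Lemma tmap_scale X Y (f : X -> Y) a (v : tspace X) :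
  dclosed X -> dclosed Y -> smooth f ->
  tmap f (vscale (tbundle X) a v) = vscale (tbundle Y) a (tmap f v).
Proof.
move=> cX cY sf.
apply: tvec_fct_ext => [|h Yh]; first by rewrite !(tbase_tmap, tbase_mktvec).
by rewrite tder_scale// !tder_tmap// tder_scale.
Qed.

(** * Velocities of curves and charts *)

(** The velocity at [t = 0] of [g (z + t *: u)], set up for maps that are smooth only near [z], such
    as the inverse of a chart. *)
Definition tdir X n (g : 'rV[R]_n -> X) (z u : 'rV[R]_n) : tspace X :=
  mktvec (g z) (fun h => if pselect (fct X h) then 'D_u (h \o g) z else 0).

Lemma lsm_derivable n (k : 'rV[R]_n -> R) z u :
  lsm (@Cinf R n) z k -> derivable k z u.
Proof.
move=> /lsm_Cinf[w Cw hw]; apply: (@near_eq_derivable _ _ _ w).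
  by apply: filterS hw => y ->.
by apply: diff_derivable; exact: Cinf_diff.
Qed.

Lemma lsm_derive_lsm n (k : 'rV[R]_n -> R) z u : lsm (@Cinf R n) z k ->
  lsm (@Cinf R n) z (fun y => 'D_u k y).
Proof.
move=> /lsm_Cinf[w Cw hw]; apply/lsm_Cinf.
exists (fun y => 'D_u w y); first exact: Cinf_derive.
have := nbhs_interior hw.
by apply: filterS => y hy; exact: near_eq_derive.
Qed.

Lemma tbase_tdir X n (g : 'rV[R]_n -> X) z u : tbase (tdir g z u) = g z.
Proof. exact: tbase_mktvec. Qed.

Lemma tder_tdir X n (g : 'rV[R]_n -> X) z u h : dclosed X ->
  @smooth_at R (euclid R n) X g z -> fct X h -> tder (tdir g z u) h = 'D_u (h \o g) z.
Proof.
move=> cX sg Xh; have dg k : fct X k -> derivable (k \o g) z u.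
  by move=> /sg; exact: lsm_derivable.
rewrite /tdir tder_mktvec; first by case: pselect.
split=> [f|a f k Xf Xk|f k Xf Xk].
- by case: pselect.
- case: pselect => /= [_|[]]; last exact: fctZD.
  case: pselect => //= _; case: pselect => //= _.
  have -> : (fun y => a * f y + k y) \o g = a *: (f \o g) + (k \o g) by [].
  by rewrite deriveD ?deriveZ//; [exact: dg|apply: derivableZ; exact: dg|exact: dg].
- case: pselect => /= [_|[]]; last exact: fctM.
  case: pselect => //= _; case: pselect => //= _.
  have -> : (fun y => f y * k y) \o g = (f \o g) * (k \o g) by [].
  by rewrite deriveM//; exact: dg.
Qed.

(** The coordinates [zeta] are global functions, as tangent vectors are evaluated on these. *)
Record chart X (x : X) n (U : set X) (V : set 'rV[R]_n) (zeta : 'I_n -> X -> R)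
    (g : 'rV[R]_n -> X) : Prop := Chart {
  chart_dopen : dopen U;
  chart_pt : U x;
  chart_open : open V;
  chart_fct : forall i, fct X (zeta i);
  chart_in : forall q, U q -> V (\row_i zeta i q);
  chartK : forall q, U q -> g (\row_i zeta i q) = q;
  chart_out : forall z, V z -> U (g z);
  chart_invK : forall z, V z -> \row_i zeta i (g z) = z;
  chart_smooth : forall z, V z -> @smooth_at R (euclid R n) X g z }.

Lemma nbhs_fnbhs n (z : 'rV[R]_n) A : nbhs z A -> fnbhs (fct (euclid R n)) z A.
Proof. by move=> zA; apply/fnbhs_Cinf. Qed.

Lemma manifold_closed X n : manifold n X -> dclosed X.
Proof. by case. Qed.

(* The chart is shrunk until its coordinates extend to smooth functions on the
   whole manifold. *)
Lemma manifold_chart X n (x : X) : manifold n X ->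
  exists U V zeta g, @chart X x n U V zeta g.
Proof.
move=> [cX charts _ _].
have [U [V [phi [oU Ux oV [UV sphi [g [VU sg gphi phig]]]]]]] := charts x.
have sgz z : V z -> @smooth_at R (euclid R n) X g z.
  by move=> Vz; apply: smooth_on_at sg; apply: nbhs_fnbhs; exact: open_nbhs_nbhs.
have sphix := @smooth_on_at R X (euclid R n) U phi x (oU _ Ux) sphi.
have /choice[zeta zetaP] i : exists f, fct X f /\
    fnbhs (fct X) x [set y | (phi y : 'rV[R]_n) 0 i = f y].
  have [f Xf hf] := lsm_dclosed cX (sphix _ (@Cinf_coord R n i)).
  by exists f.
have zn : fnbhs (fct X) x [set y | forall i, (phi y : 'rV[R]_n) 0 i = zeta i y].
  by apply: fnbhs_forall => i; have [] := zetaP i.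
have [U' [U'x U'z oU']] := fnbhs_open (fnbhsI zn (oU _ Ux)).
have zetaE q : U' q -> \row_i zeta i q = phi q.
  by move=> /U'z[/= zq _]; apply/rowP => i; rewrite mxE zq.
have U'U q : U' q -> U q by move=> /U'z[].
exists U', [set z | V z /\ U' (g z)], zeta, g; split=> //=.
- rewrite openE => z [Vz U'z0].
  have := smooth_at_near (sgz _ Vz) (oU' _ U'z0).
  move=> /fnbhs_Cinf H; apply: filterS (filterI (open_nbhs_nbhs (conj oV Vz)) H).
  by move=> y [].
- by move=> i; have [] := zetaP i.
- by move=> q U'q; rewrite zetaE// gphi; [split=> //; exact: UV (U'U _ U'q)|exact: U'U].
- by move=> q U'q; rewrite zetaE// gphi//; exact: U'U.
- by move=> z [].
- by move=> z [Vz U'z0]; rewrite zetaE// phig.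
- by move=> z [Vz _]; exact: sgz.
Qed.

Section chart_vectors.
Context {X : dspace R} (cX : dclosed X) {x : X} {n} {U : set X}
  {V : set 'rV[R]_n} {zeta : 'I_n -> X -> R} {g : 'rV[R]_n -> X}
  (xi : chart x U V zeta g).

Lemma chart_rep q h : U q -> fct X h -> exists2 w, Cinf w &
  (\forall z \near \row_i zeta i q, h (g z) = w z) /\
  fnbhs (fct X) q [set y | h y = w (\row_i zeta i y)].
Proof.
move=> Uq Xh; have [w Cw hw] := iffLR (lsm_Cinf _ _) (chart_smooth xi (chart_in xi Uq) Xh).
exists w => //; split=> //.
have : fnbhs (fct X) q [set y | h (g (\row_i zeta i y)) = w (\row_i zeta i y)].
  apply: (@fnbhs_row _ _ _ _ _ _ [set z | h (g z) = w z]) => // i e e0.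
  by apply: fnbhs_coord => //; exact: chart_fct xi i.
move=> /(fnbhsI (chart_dopen xi Uq)); apply: fnbhsS => y [Uy /= <-].
by rewrite (chartK xi).
Qed.

(** Near the base point [h] is a smooth function of the coordinates, to which the chain rule for
    derivations applies. *)
Lemma chart_tder (v : tspace X) h : U (tbase v) -> fct X h ->
  tder v h = 'D_(\row_i tder v (zeta i)) (h \o g) (\row_i zeta i (tbase v)).
Proof.
move=> Uv Xh; have [w Cw [hgw hw]] := chart_rep Uv Xh.
rewrite (near_eq_derive _ hgw) (tder_eq cX Xh _ hw); last first.
  by apply: fct_comp => // i; exact: chart_fct xi i.
rewrite tder_comp//; last by move=> i; exact: chart_fct xi i.
rewrite derive_rV; last exact: Cinf_diff.
by apply: eq_bigr => i _; rewrite mxE.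
Qed.

Lemma chart_tdir_coord z u i : V z -> tder (tdir g z u) (zeta i) = u 0 i.
Proof.
move=> Vz; rewrite tder_tdir//; [|exact: chart_smooth xi _ Vz|exact: chart_fct xi i].
rewrite -[RHS](derive_coord i u z); apply: near_eq_derive.
apply: filterS (open_nbhs_nbhs (conj (chart_open xi) Vz)) => y Vy /=.
by rewrite -[in RHS](chart_invK xi Vy) mxE.
Qed.

Lemma chart_vec_ext (v w : tspace X) : U (tbase v) -> tbase v = tbase w ->
  (forall i, tder v (zeta i) = tder w (zeta i)) -> v = w.
Proof.
move=> Uv vw zvw; apply: tvec_fct_ext => // h Xh.
rewrite !chart_tder -?vw//; congr ('D_ _ _ _).
by apply/rowP => i; rewrite !mxE.
Qed.

End chart_vectors.

End tangent_maps.

(** * Vector bundles and maps of line bundles *)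

Section vector_bundles.
Context {R : realType}.
Implicit Types X E B : dspace R.

Record trivialization r E B (S : vbstr E B) (U : set B) (phi : E -> 'rV[R]_r)
    (psi : B -> 'rV[R]_r -> E) : Prop := Trivialization {
  tr_open : dopen U;
  tr_phi : @smooth_on R E (euclid R r) [set e | U (vproj S e)] phi;
  tr_psi : forall b y, U b ->
    @smooth_at R (dprod B (euclid R r)) E (fun p => psi p.1 p.2) (b, y);
  tr_proj : forall b y, U b -> vproj S (psi b y) = b;
  tr_psiK : forall b y, U b -> phi (psi b y) = y;
  tr_phiK : forall e, U (vproj S e) -> psi (vproj S e) (phi e) = e;
  tr_zero : forall b, U b -> phi (vzero S b) = 0;
  tr_add : forall e e', U (vproj S e) -> vproj S e = vproj S e' ->
    phi (vadd S e e') = phi e + phi e';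
  tr_scale : forall a e, U (vproj S e) -> phi (vscale S a e) = a *: phi e }.

Lemma vb_triv r E B (S : vbstr E B) (b : B) : vector_bundle r S ->
  exists U phi psi, @trivialization r E B S U phi psi /\ U b.
Proof.
move=> [_ _ /(_ b)[U [phi [[oU Ub] [UU sphi [g [gU sg gphi phig]]] phi0 phiD phiZ]]]].
have gP b' y : U b' -> vproj S (g (b', y)) = b' /\ phi (g (b', y)) = y.
  by move=> Ub'; have [->->] := phig (b', y) Ub'.
exists U, phi, (fun b y => g (b, y)); split=> //; split=> //=.
- move=> h Ch; apply: (sphi (h \o snd)).
  exact: (smooth_snd (X := B) (Y := euclid R r) Ch).
- move=> b' y Ub'; have -> : (fun p => g (p.1, p.2)) = g by apply/funext => -[].
  apply: (smooth_on_at _ sg).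
  apply: (@smooth_at_near R (dprod B (euclid R r)) B fst (b', y) U _ (oU _ Ub')).
  by apply: smooth_smooth_at; exact: smooth_fst.
- by move=> b' y /(gP b' y)[].
- by move=> b' y /(gP b' y)[].
Qed.

(** A linear isomorphism of one fibre with a coordinate space. Identities between the total
    operations of [E] are checked by transport along it. *)
Record fibre_coord r E B (S : vbstr E B) (b : B) (phi : E -> 'rV[R]_r) : Prop :=
  FibreCoord {
  fc_inj : forall e e', vproj S e = b -> vproj S e' = b -> phi e = phi e' -> e = e';
  fc_surj : forall y, exists2 e, vproj S e = b & phi e = y;
  fc_zero : phi (vzero S b) = 0;
  fc_add : forall e e', vproj S e = b -> vproj S e' = b ->
    phi (vadd S e e') = phi e + phi e';
  fc_scale : forall a e, vproj S e = b -> phi (vscale S a e) = a *: phi e }.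

Section algebra.
Context {r : nat} {E B : dspace R} {S : vbstr E B} (hS : vector_bundle r S).
Implicit Types (e : E) (b : B).

Lemma trivialization_coord U (phi : E -> 'rV[R]_r) psi b :
  trivialization S U phi psi -> U b -> fibre_coord S b phi.
Proof.
move=> T Ub; split.
- move=> e e' eb e'b ee'; have UU : U (vproj S e) by rewrite eb.
  rewrite -(tr_phiK T UU) ee' eb -e'b (tr_phiK T)//.
  by rewrite e'b.
- by move=> y; exists (psi b y); [exact: (tr_proj T)|exact: (tr_psiK T)].
- exact: (tr_zero T).
- by move=> e e' eb e'b; apply: (tr_add T); rewrite ?eb.
- by move=> a e eb; apply: (tr_scale T); rewrite ?eb.
Qed.

Lemma vb_fibre_coord b : exists phi : E -> 'rV[R]_r, fibre_coord S b phi.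
Proof.
have [U [phi [psi [T Ub]]]] := vb_triv b hS.
by exists phi; exact: trivialization_coord T Ub.
Qed.

Lemma proj_add e e' : vproj S e = vproj S e' -> vproj S (vadd S e e') = vproj S e.
Proof. by have [+ _ _] := hS; apply. Qed.

Lemma proj_scale a e : vproj S (vscale S a e) = vproj S e.
Proof. by have [_ + _] := hS; apply. Qed.

Lemma vscale0 e : vscale S 0 e = vzero S (vproj S e).
Proof.
have [phi P] := vb_fibre_coord (vproj S e).
by apply: (fc_inj P); rewrite ?proj_scale ?vprojK// (fc_scale P)// scale0r (fc_zero P).
Qed.

Lemma vaddK e e' : vproj S e = vproj S e' -> vsub S (vadd S e e') e' = e.
Proof.
move=> ee'; have [phi P] := vb_fibre_coord (vproj S e).
have p1 := proj_scale (-1) e'; have p2 := proj_add ee'.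
apply: (fc_inj P) => //; first by rewrite proj_add// p1 p2.
by rewrite (fc_add P)// ?p1// (fc_scale P)// (fc_add P)// scaleN1r addrK.
Qed.

Lemma vsubK e e' : vproj S e = vproj S e' -> vadd S (vsub S e e') e' = e.
Proof.
move=> ee'; have [phi P] := vb_fibre_coord (vproj S e).
have p1 := proj_scale (-1) e'.
have p2 : vproj S (vsub S e e') = vproj S e by rewrite proj_add// p1.
apply: (fc_inj P) => //; first by rewrite proj_add// p2.
by rewrite (fc_add P)// (fc_add P)// ?p1// (fc_scale P)// scaleN1r subrK.
Qed.

Lemma proj_sub e e' : vproj S e = vproj S e' -> vproj S (vsub S e e') = vproj S e.
Proof. by move=> ee'; rewrite proj_add// proj_scale. Qed.

Lemma vaddA e1 e2 e3 : vproj S e1 = vproj S e2 -> vproj S e2 = vproj S e3 ->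
  vadd S e1 (vadd S e2 e3) = vadd S (vadd S e1 e2) e3.
Proof.
move=> e12 e23; have [phi P] := vb_fibre_coord (vproj S e1).
have h2 : vproj S e2 = vproj S e1 by [].
have h3 : vproj S e3 = vproj S e1 by rewrite -e23.
have h12 : vproj S (vadd S e1 e2) = vproj S e1 by rewrite proj_add.
have h23 : vproj S (vadd S e2 e3) = vproj S e1 by rewrite proj_add.
apply: (fc_inj P); [by rewrite proj_add// h23|by rewrite proj_add// h12 h3|].
rewrite (fc_add P erefl h23) (fc_add P h2 h3) (fc_add P h12 h3).
by rewrite (fc_add P erefl h2) addrA.
Qed.

Lemma vaddACA e1 e2 e3 e4 : vproj S e1 = vproj S e2 -> vproj S e1 = vproj S e3 ->
  vproj S e1 = vproj S e4 ->
  vadd S (vadd S e1 e2) (vadd S e3 e4) = vadd S (vadd S e1 e3) (vadd S e2 e4).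
Proof.
move=> e12 e13 e14; have [phi P] := vb_fibre_coord (vproj S e1).
have h2 := esym e12; have h3 := esym e13; have h4 := esym e14.
have p12 := proj_add e12; have p13 := proj_add e13.
have p34 : vproj S (vadd S e3 e4) = vproj S e1 by rewrite proj_add ?h3.
have p24 : vproj S (vadd S e2 e4) = vproj S e1 by rewrite proj_add ?h2.
apply: (fc_inj P); [by rewrite proj_add ?p12|by rewrite proj_add ?p13|].
rewrite (fc_add P p12 p34) (fc_add P p13 p24) (fc_add P erefl h2) (fc_add P h3 h4).
by rewrite (fc_add P erefl h3) (fc_add P h2 h4) addrACA.
Qed.

Lemma vscaleDr a e e' : vproj S e = vproj S e' ->
  vscale S a (vadd S e e') = vadd S (vscale S a e) (vscale S a e').
Proof.
move=> ee'; have [phi P] := vb_fibre_coord (vproj S e).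
have p := proj_add ee'.
have [h1 h2] : vproj S (vscale S a e) = vproj S e /\ vproj S (vscale S a e') = vproj S e.
  by rewrite !proj_scale.
apply: (fc_inj P); [by rewrite proj_scale|by rewrite proj_add ?h1|].
rewrite (fc_scale P _ p) (fc_add P erefl (esym ee')) (fc_add P h1 h2).
by rewrite (fc_scale P _ erefl) (fc_scale P _ (esym ee')) scalerDr.
Qed.

(** Turns the cohomology relation, a statement about differences, into the equality of sums that the
    target maps need. *)
Lemma vsub_eq_add e1 e2 e3 e4 : vproj S e1 = vproj S e2 -> vproj S e1 = vproj S e3 ->
  vproj S e1 = vproj S e4 -> vsub S e1 e2 = vsub S e3 e4 ->
  vadd S e2 e3 = vadd S e1 e4.
Proof.
move=> e12 e13 e14 sub; have [phi P] := vb_fibre_coord (vproj S e1).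
have h2 := esym e12; have h3 := esym e13; have h4 := esym e14.
have [n2 n4] : vproj S (vscale S (-1) e2) = vproj S e1 /\
    vproj S (vscale S (-1) e4) = vproj S e1 by rewrite !proj_scale.
have : phi (vsub S e1 e2) = phi (vsub S e3 e4) by rewrite sub.
rewrite (fc_add P erefl n2) (fc_add P h3 n4) (fc_scale P _ h2) (fc_scale P _ h4).
rewrite !scaleN1r => /eqP; rewrite subr_eq addrAC eq_sym subr_eq => /eqP phiE.
apply: (fc_inj P); [by rewrite proj_add ?h2|by rewrite proj_add|].
by rewrite (fc_add P h2 h3) (fc_add P erefl h4) addrC.
Qed.

End algebra.

(* The definition of a vector bundle does not make its projection smooth, so the
   base points of a family of vectors are given by a separate smooth map [a]. *)
Section smoothness.
Context {r : nat} {X E B : dspace R} {S : vbstr E B} (hS : vector_bundle r S).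
Context (x : X) (a : X -> B) (sa : smooth_at a x).

Lemma smooth_at_psi U phi psi (c : X -> 'rV[R]_r) :
  @trivialization r E B S U phi psi -> U (a x) ->
  (forall i, lsm (fct X) x (fun y => c y 0 i)) ->
  smooth_at (fun y => psi (a y) (c y)) x.
Proof.
move=> T Ux sc.
have s1 : @smooth_at R X (dprod B (euclid R r)) (fun y => (a y, c y)) x.
  by apply: smooth_at_dprod => //; exact: smooth_at_euclid.
exact: (smooth_at_comp s1 (tr_psi T (c x) Ux)).
Qed.

Lemma smooth_at_phi U phi psi (l : X -> E) :
  @trivialization r E B S U phi psi -> U (a x) -> smooth_at l x ->
  fnbhs (fct X) x [set y | vproj S (l y) = a y] ->
  forall i, lsm (fct X) x (fun y => phi (l y) 0 i).
Proof.
move=> T Ux sl la i.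
have sphi : @smooth_at R X (euclid R r) (phi \o l) x.
  apply: (smooth_on_comp (tr_phi T) sl).
  by apply: fnbhsS (fnbhsI la (smooth_at_near sa (tr_open T Ux))) => y [/= ->].
exact: (sphi _ (@Cinf_coord R r i)).
Qed.

Lemma smooth_at_vadd (l l' : X -> E) : smooth_at l x -> smooth_at l' x ->
  fnbhs (fct X) x [set y | vproj S (l y) = a y] ->
  fnbhs (fct X) x [set y | vproj S (l' y) = a y] ->
  smooth_at (fun y => vadd S (l y) (l' y)) x.
Proof.
move=> sl sl' la l'a; have [U [phi [psi [T Ux]]]] := vb_triv (a x) hS.
apply: (@smooth_at_eq _ _ _ (fun y => psi (a y) (phi (l y) + phi (l' y)))).
  have := fnbhsI (smooth_at_near sa (tr_open T Ux)) (fnbhsI la l'a).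
  apply: fnbhsS => y [/= Uy [ly l'y]].
  have p : vproj S (vadd S (l y) (l' y)) = a y by rewrite (proj_add hS) ly.
  by rewrite -(tr_add T) ?ly// -{1}p (tr_phiK T) ?p.
apply: (smooth_at_psi T Ux) => i.
apply: lsm_ext (lsmD (smooth_at_phi T Ux sl la i) (smooth_at_phi T Ux sl' l'a i)).
by move=> y; rewrite mxE.
Qed.

Lemma smooth_at_vscale c (l : X -> E) : smooth_at l x ->
  fnbhs (fct X) x [set y | vproj S (l y) = a y] ->
  smooth_at (fun y => vscale S c (l y)) x.
Proof.
move=> sl la; have [U [phi [psi [T Ux]]]] := vb_triv (a x) hS.
apply: (@smooth_at_eq _ _ _ (fun y => psi (a y) (c *: phi (l y)))).
  have := fnbhsI (smooth_at_near sa (tr_open T Ux)) la.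
  apply: fnbhsS => y [/= Uy ly].
  have p : vproj S (vscale S c (l y)) = a y by rewrite (proj_scale hS).
  by rewrite -(tr_scale T) ?ly// -{1}p (tr_phiK T) ?p.
apply: (smooth_at_psi T Ux) => i.
apply: lsm_ext (lsmM (lsm_cst _ x c) (smooth_at_phi T Ux sl la i)).
by move=> y; rewrite mxE.
Qed.

End smoothness.

(** * Maps of line bundles that are injective on fibres *)

Section line_bundle_maps.
Context {E B E' B' : dspace R} {S : vbstr E B} {S' : vbstr E' B'}.
Context (hS : vector_bundle 1 S) (hS' : vector_bundle 1 S').
Context {F : E -> E'} {f : B -> B'} (hF : vb_morphism S S' F f).
Hypothesis F0 : forall e, F e = vzero S' (f (vproj S e)) -> e = vzero S (vproj S e).

Lemma line_map_proj e : vproj S' (F e) = f (vproj S e).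
Proof. by have [_ _ + _ _] := hF; apply. Qed.

Lemma line_map_add e e' : vproj S e = vproj S e' ->
  F (vadd S e e') = vadd S' (F e) (F e').
Proof. by have [_ _ _ + _] := hF; apply. Qed.

Lemma line_map_scale a e : F (vscale S a e) = vscale S' a (F e).
Proof. by have [_ _ _ _] := hF; apply. Qed.

Lemma line_map_inj e e' : vproj S e = vproj S e' -> F e = F e' -> e = e'.
Proof.
move=> ee' FF; rewrite -(vsubK hS ee').
have p := proj_sub hS ee'.
have -> : vsub S e e' = vzero S (vproj S e).
  rewrite -p; apply: F0; rewrite p /vsub line_map_add ?(proj_scale hS)//.
  rewrite line_map_scale FF; have [phi P] := vb_fibre_coord hS' (f (vproj S e)).
  have pe : vproj S' (F e') = f (vproj S e) by rewrite line_map_proj ee'.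
  apply: (fc_inj P); rewrite ?(proj_add hS') ?(proj_scale hS') ?vprojK ?pe//.
  rewrite (fc_zero P) (fc_add P) ?(proj_scale hS') ?pe// (fc_scale P)//.
  by rewrite scaleN1r subrr.
have [phi P] := vb_fibre_coord hS (vproj S e).
apply: (fc_inj P); rewrite ?(proj_add hS) ?vprojK//.
by rewrite (fc_add P) ?vprojK// (fc_zero P) add0r.
Qed.

(** On a one-dimensional fibre the map is multiplication by a number, the coordinate of the image of
    the basis vector [e1]; it is nonzero by injectivity. *)
Lemma line_map_coord b (phi : E -> 'rV[R]_1) (phi' : E' -> 'rV[R]_1) e1 :
  fibre_coord S b phi -> fibre_coord S' (f b) phi' ->
  vproj S e1 = b -> phi e1 = const_mx 1 ->
  phi' (F e1) 0 0 != 0 /\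
  forall e, vproj S e = b -> phi' (F e) 0 0 = phi e 0 0 * phi' (F e1) 0 0.
Proof.
move=> P P' e1b phie1; have Fe1b : vproj S' (F e1) = f b by rewrite line_map_proj e1b.
split=> [|e eb].
  apply/eqP => phi'0; have Fe1 : F e1 = vzero S' (f (vproj S e1)).
    rewrite e1b; apply: (fc_inj P'); rewrite ?vprojK// (fc_zero P').
    by apply/rowP => i; rewrite ord1 phi'0 mxE.
  have /rowP/(_ 0) : phi e1 = 0 by rewrite (F0 Fe1) e1b (fc_zero P).
  by rewrite phie1 !mxE => /eqP; rewrite oner_eq0.
have -> : F e = F (vscale S (phi e 0 0) e1).
  congr F; apply: (fc_inj P); rewrite ?(proj_scale hS)// (fc_scale P)// phie1.
  by apply/rowP => i; rewrite !mxE ord1 mulr1.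
by rewrite line_map_scale (fc_scale P')// mxE.
Qed.

Lemma line_map_surj b e' : vproj S' e' = f b ->
  exists e, vproj S e = b /\ F e = e'.
Proof.
move=> e'b; have [phi P] := vb_fibre_coord hS b.
have [phi' P'] := vb_fibre_coord hS' (f b).
have [e1 e1b phie1] := fc_surj P (const_mx 1).
have [c0 FE] := line_map_coord P P' e1b phie1.
have [e eb phie] := fc_surj P (const_mx (phi' e' 0 0 / phi' (F e1) 0 0)).
exists e; split=> //; apply: (fc_inj P') => //; first by rewrite line_map_proj eb.
by apply/rowP => i; rewrite ord1 FE// phie mxE divfK.
Qed.

Lemma fibinv_spec b e' : vproj S' e' = f b ->
  vproj S (fibinv S setT F b e') = b /\ F (fibinv S setT F b e') = e'.
Proof.
move=> /line_map_surj[e [eb Fe]]; rewrite /fibinv; case: pselect => [ex|[]].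
  by case: cid => /= ? [].
by exists e.
Qed.

(** In trivializations the inverse divides by the coefficient [c] of the map, which is smooth in the
    base point and nonzero. *)
Lemma smooth_at_fibinv (X : dspace R) (x : X) (a : X -> B) (a' : X -> E') :
  smooth_at a x -> smooth_at a' x ->
  (forall y, vproj S' (a' y) = f (a y)) ->
  smooth_at (fun y => fibinv S setT F (a y) (a' y)) x.
Proof.
move=> sa sa' aa'.
have [sF sf _ _ _] := hF.
have sfa : smooth_at (f \o a) x.
  by apply: smooth_at_comp sa _; exact: smooth_smooth_at.
have [U [phi [psi [T Ux]]]] := vb_triv (a x) hS.
have [U' [phi' [psi' [T' U'x]]]] := vb_triv (f (a x)) hS'.
pose e1 y := psi (a y) (const_mx 1).
have se1 : smooth_at e1 x.
  by apply: (smooth_at_psi sa T Ux) => i; apply: lsm_ext (lsm_cst _ x 1) => y; rewrite mxE.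
pose c y := phi' (F (e1 y)) 0 0.
have nU := smooth_at_near sa (tr_open T Ux).
have nU' := smooth_at_near sfa (tr_open T' U'x).
have sc : lsm (fct X) x c.
  apply: (smooth_at_phi sfa T' U'x).
    by apply: smooth_at_comp se1 _; exact: smooth_smooth_at.
  by apply: fnbhsS nU => y Uy /=; rewrite line_map_proj (tr_proj T).
have sp : lsm (fct X) x (fun y => phi' (a' y) 0 0).
  apply: (smooth_at_phi sfa T' U'x sa').
  by apply: fnbhsS (fnbhsT _ x) => y _ /=; exact: aa'.
have cP y : U (a y) -> U' (f (a y)) -> c y != 0 /\
    forall e, vproj S e = a y -> phi' (F e) 0 0 = phi e 0 0 * c y.
  move=> Uy U'y; apply: line_map_coord; [exact: trivialization_coord T Uy| | |].
  - exact: trivialization_coord T' U'y.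
  - exact: tr_proj T _ _ Uy.
  - exact: tr_psiK T _ _ Uy.
apply: (@smooth_at_eq _ _ _ (fun y => psi (a y) (const_mx (phi' (a' y) 0 0 / c y)))).
  apply: fnbhsS (fnbhsI nU nU') => y [/= Uy U'y].
  have [c0 FE] := cP y Uy U'y; have [p q] := fibinv_spec (aa' y).
  have P := trivialization_coord T Uy.
  apply: (fc_inj P) => //; first exact: tr_proj T _ _ Uy.
  rewrite (tr_psiK T)//; apply/rowP => i; rewrite ord1 mxE.
  by rewrite -{1}q FE// mulfK.
apply: (smooth_at_psi sa T Ux) => i.
apply: lsm_ext (lsmM sp (lsmV sc _)); first by move=> y; rewrite mxE.
by have [] := cP x Ux U'x.
Qed.

End line_bundle_maps.
End vector_bundles.

(** * Line bundle groupoids *)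

Section line_bundle_groupoids.
Context {R : realType} {L : vbgroupoid R} (hL : line_bundle_groupoid L).
Local Notation G := (vbase L).
Local Notation LL := (vtop L).
Local Notation SA := (varr L).
Local Notation SO := (vobj L).

Let hA : vector_bundle 1 SA := vg_arr hL.
Let hO : vector_bundle 1 SO := vg_obj hL.
Let gL : lie_groupoid LL := vg_top hL.
Let gG : lie_groupoid G := vg_base hL.

Lemma arr_closed : dclosed (arr G).
Proof. by have [n] := lg_arr gG; exact: manifold_closed. Qed.

Lemma obj_closed : dclosed (obj G).
Proof. by have [n] := lg_obj gG; exact: manifold_closed. Qed.

Lemma vb_zero r r' (E B E' B' : dspace R) (S : vbstr E B) (S' : vbstr E' B') F f b :
  vector_bundle r S -> vector_bundle r' S' -> vb_morphism S S' F f ->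
  F (vzero S b) = vzero S' (f b).
Proof.
move=> hS hS' [_ _ Fp _ FZ].
have := FZ 0 (vzero S b); rewrite (vscale0 hS) (vscale0 hS') Fp.
by rewrite !vprojK.
Qed.

Lemma src_zero g : src (vzero SA g) = vzero SO (src g).
Proof. exact: vb_zero hA hO (vg_src hL). Qed.

Lemma tgt_zero g : tgt (vzero SA g) = vzero SO (tgt g).
Proof. exact: vb_zero hA hO (vg_tgt hL). Qed.

Lemma mul_zero g h : src g = tgt h ->
  mul (vzero SA g) (vzero SA h) = vzero SA (mul g h).
Proof.
move=> gh; have st : src (vzero SA g) = tgt (vzero SA h).
  by rewrite src_zero tgt_zero gh.
have := vg_mulZ hL 0 st; rewrite !(vscale0 hA) !vprojK => ->.
by rewrite (vg_mul hL)// !vprojK.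
Qed.

Lemma src_proj l : vproj SO (src l) = src (vproj SA l).
Proof. exact: line_map_proj (vg_src hL) l. Qed.

(* Over a unit, [unt] is a linear section of the map [src] between lines. *)
Lemma src_eq0_unt x l : vproj SA l = unt x -> src l = vzero SO x ->
  l = vzero SA (unt x).
Proof.
move=> lx l0.
have [phi P] := vb_fibre_coord hA (unt x).
have [phi' P'] := vb_fibre_coord hO x.
have [e1 e1x phie1] := fc_surj P' (const_mx 1).
have [_ _ up _ _] := vg_unt hL.
have ue1 : vproj SA (unt e1) = unt x by rewrite up e1x.
have c0 : phi (unt e1) 0 0 != 0.
  apply/eqP => phi0; have ue : unt e1 = vzero SA (unt x).
    apply: (fc_inj P); rewrite ?vprojK// (fc_zero P).
    by apply/rowP => i; rewrite ord1 phi0 mxE.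
  have e10 : e1 = vzero SO x.
    by rewrite -(lg_src_unt gL e1) ue src_zero (lg_src_unt gG).
  have /rowP/(_ 0) : phi' e1 = 0 by rewrite e10 (fc_zero P').
  by rewrite phie1 !mxE => /eqP; rewrite oner_eq0.
have lE : l = vscale SA (phi l 0 0 / phi (unt e1) 0 0) (unt e1).
  apply: (fc_inj P); rewrite ?(proj_scale hA)// (fc_scale P)//.
  by apply/rowP => i; rewrite ord1 mxE divfK.
suff phil : phi l 0 0 = 0 by rewrite lE phil mul0r (vscale0 hA) ue1.
have : phi' (src l) 0 0 = 0 by rewrite l0 (fc_zero P') mxE.
have [_ _ _ _ sZ] := vg_src hL.
rewrite {1}lE sZ (lg_src_unt gL) (fc_scale P')// phie1 !mxE mulr1 => /eqP.
by rewrite mulf_eq0 invr_eq0 (negPf c0) orbF => /eqP.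
Qed.

(* Translate to a unit by multiplication with a zero vector. *)
Lemma src_eq0 l : src l = vzero SO (src (vproj SA l)) -> l = vzero SA (vproj SA l).
Proof.
set g := vproj SA l => l0.
have st : src l = tgt (vzero SA (ginv g)) by rewrite l0 tgt_zero (lg_tgt_inv gG).
have m0 : mul l (vzero SA (ginv g)) = vzero SA (unt (tgt g)).
  apply: src_eq0_unt; first by rewrite (vg_mul hL)// vprojK (lg_mulgV gG).
  by rewrite (lg_src_mul gL)// src_zero (lg_src_inv gG).
have st' : src (vzero SA (ginv g)) = tgt (vzero SA g).
  by rewrite src_zero tgt_zero (lg_src_inv gG).
have z1 : mul (vzero SA (ginv g)) (vzero SA g) = unt (src l).
  rewrite mul_zero ?(lg_src_inv gG)// (lg_mulVg gG) l0.
  by rewrite (vb_zero _ hO hA (vg_unt hL)).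
rewrite -[LHS](lg_mulg1 gL) -z1 (lg_mulA gL)// m0 mul_zero ?(lg_src_unt gG)//.
by rewrite (lg_mul1g gG).
Qed.

(** Inversion exchanges target and source, so the inverse of [l] is a zero vector by [src_eq0]. *)
Lemma tgt_eq0 l : tgt l = vzero SO (tgt (vproj SA l)) -> l = vzero SA (vproj SA l).
Proof.
move=> l0; apply: src_eq0; set g := vproj SA l in l0 *.
have [_ _ ip _ _] := vg_inv hL.
have il : ginv l = vzero SA (ginv g).
  rewrite -[ginv g]ip; apply: src_eq0.
  by rewrite ip (lg_src_inv gL) l0 (lg_src_inv gG).
by rewrite -(lg_tgt_inv gL) il tgt_zero (lg_tgt_inv gG).
Qed.

Lemma src_inj l l' : vproj SA l = vproj SA l' -> src l = src l' -> l = l'.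
Proof. exact: (line_map_inj hA hO (vg_src hL) src_eq0). Qed.

Lemma srcinv_spec (g : arr G) (x : obj LL) : vproj SO x = src g ->
  vproj SA (srcinv g x) = g /\ src (srcinv g x) = x.
Proof. exact: (fibinv_spec hA hO (vg_src hL) src_eq0). Qed.

(** * Pull-backs of a form along source and target *)

Section forms.
Context {alpha : tspace (obj G) -> obj LL} (halpha : form1 SO alpha).

Let sourceG : smooth (@src R G). Proof. by have [] := lg_src gG. Qed.
Let targetG : smooth (@tgt R G). Proof. by have [] := lg_tgt gG. Qed.

Lemma form_proj (w : tspace (obj G)) : vproj SO (alpha w) = tbase w.
Proof. by have [_ _ + _ _] := halpha; apply. Qed.

(** By [src_inj] these two properties determine the pull-back, so the choice made in [fibinv] can be
    forgotten. *)
Lemma src_pullback_spec v :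
  vproj SA (src_pullback alpha v) = tbase v /\
  src (src_pullback alpha v) = alpha (tmap (@src R G) v).
Proof.
apply: (fibinv_spec hA hO (vg_src hL) src_eq0).
by rewrite form_proj tbase_tmap.
Qed.

Lemma tgt_pullback_spec v :
  vproj SA (tgt_pullback alpha v) = tbase v /\
  tgt (tgt_pullback alpha v) = alpha (tmap (@tgt R G) v).
Proof.
apply: (fibinv_spec hA hO (vg_tgt hL) tgt_eq0).
by rewrite form_proj tbase_tmap.
Qed.

Lemma smooth_src_pullback : smooth (src_pullback alpha).
Proof.
apply: smooth_atP; first exact: dclosed_tspace.
move=> v; apply: (smooth_at_fibinv hA hO (vg_src hL) src_eq0).
- by apply: smooth_smooth_at; exact: smooth_tbase.
- apply: smooth_smooth_at; apply: smooth_comp (smooth_tmap obj_closed sourceG) _.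
  by have [] := halpha.
- by move=> w; rewrite form_proj tbase_tmap.
Qed.

Lemma src_pullback_add v w : tbase v = tbase w ->
  src_pullback alpha (vadd (tbundle (arr G)) v w) =
  vadd SA (src_pullback alpha v) (src_pullback alpha w).
Proof.
move=> vw; have [p1 q1] := src_pullback_spec (vadd (tbundle (arr G)) v w).
have [p2 q2] := src_pullback_spec v; have [p3 q3] := src_pullback_spec w.
have [_ _ _ sD _] := vg_src hL; have [_ _ _ aD _] := halpha.
apply: src_inj.
  by rewrite p1 (proj_add hA) ?p2 ?p3//= tbase_mktvec.
rewrite q1 sD ?p2 ?p3// q2 q3 (tmap_add arr_closed obj_closed sourceG vw).
by rewrite aD//= !tbase_tmap vw.
Qed.

Lemma src_pullback_scale a v :
  src_pullback alpha (vscale (tbundle (arr G)) a v) =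
  vscale SA a (src_pullback alpha v).
Proof.
have [p1 q1] := src_pullback_spec (vscale (tbundle (arr G)) a v).
have [p2 q2] := src_pullback_spec v.
have [_ _ _ _ sZ] := vg_src hL; have [_ _ _ _ aZ] := halpha.
apply: src_inj.
  by rewrite p1 (proj_scale hA) p2/= tbase_mktvec.
rewrite q1 sZ q2 (tmap_scale _ _ arr_closed obj_closed sourceG).
exact: aZ.
Qed.

End forms.

End line_bundle_groupoids.

(** * Tangent vectors of fibre products *)

Section fibre_products.
Context {R : realType}.
Implicit Types X Y M : dspace R.

Lemma fnbhs_dsub X (A : set X) (p : dsub A) P : fnbhs (fct (dsub A)) p P ->
  fnbhs (fct X) (sval p) [set y | forall Ay : A y, P (exist _ y Ay)].
Proof.
move=> nP; have [l [u [e [Xu e0 uP]]]] := fnbhs_fgen nP.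
have /choice[u' u'P] i : exists u', fct X u' /\ u i = u' \o sval.
  by have [u' Xu' ->] := Xu i; exists u'.
exists l, u', e; split=> // [i|y uy Ay]; first by have [] := u'P i.
by apply: uP => i; have [_ ->] := u'P i; exact: uy.
Qed.

Lemma dsub_rep X (A : set X) (p : dsub A) k : dclosed X -> fct (dsub A) k ->
  exists f, fct X f /\ fnbhs (fct (dsub A)) p [set y | k y = f (sval y)].
Proof.
move=> cX /(_ p)[n [f [w [Xf Cw hw]]]].
have /choice[f' f'P] i : exists f', fct X f' /\ f i = f' \o sval.
  by have [f' Xf' ->] := Xf i; exists f'.
exists (fun y => w (\row_i f' i y)); split.
  by apply: fct_comp => // i; have [] := f'P i.
have {}hw : fnbhs (fct (dsub A)) p [set y | k y = w (\row_i f i y)].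
  move: hw => [l [u [e [Xu e0 uP]]]]; exists l, u, e; split=> // i.
  by move=> q; exact/lsm_sub/Xu.
apply: fnbhsS hw => y /= ->; congr w; apply/rowP => i.
by rewrite !mxE; have [_ ->] := f'P i.
Qed.

(* A vector at a point of [A] which kills the functions vanishing on [A] is
   tangent to [A]. *)
Lemma tvec_dsub X (A : set X) (p : dsub A) (v : tspace X) : dclosed X ->
  tbase v = sval p ->
  (forall f, fct X f -> fnbhs (fct (dsub A)) p [set y | f (sval y) = 0] ->
    tder v f = 0) ->
  exists2 w : tspace (dsub A), tbase w = p &
    forall f, fct X f -> tder w (f \o sval) = tder v f.
Proof.
move=> cX vp v0.
have veq f f' : fct X f -> fct X f' ->
    fnbhs (fct (dsub A)) p [set y | f (sval y) = f' (sval y)] ->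
    tder v f = tder v f'.
  move=> Xf Xf' ff'; apply/eqP; rewrite -subr_eq0; apply/eqP.
  rewrite -mulN1r addrC -tderZD//; apply: v0; first exact: fctZD.
  by apply: fnbhsS ff' => y /= ->; rewrite mulN1r addNr.
have /choice[rep repP] k : exists f, fct (dsub A) k ->
    fct X f /\ fnbhs (fct (dsub A)) p [set y | k y = f (sval y)].
  have [Ak|] := pselect (fct (dsub A) k); last by exists (fun=> 0).
  by have [f fP] := dsub_rep p cX Ak; exists f.
have cA : dclosed (dsub A) by exact: dclosed_dsub.
(* The derivation is computed on an extension [rep k] of the germ of [k] to [X]; [DE] states that
   any other extension gives the same value. *)
pose D k := if pselect (fct (dsub A) k) then tder v (rep k) else 0.
have DE k f : fct (dsub A) k -> fct X f ->
    fnbhs (fct (dsub A)) p [set y | k y = f (sval y)] -> D k = tder v f.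
  move=> Ak Xf kf; rewrite /D; case: pselect => //= _.
  have [Xr rk] := repP k Ak; apply: veq => //.
  by apply: fnbhsS (fnbhsI rk kf) => y [/= <-].
have Dp : derivation_at p D.
  split=> [k Ak|a k l Ak Al|k l Ak Al].
  - by rewrite /D; case: pselect.
  - have [Xk rk] := repP k Ak; have [Xl rl] := repP l Al.
    rewrite (DE _ _ Ak Xk rk) (DE _ _ Al Xl rl) -tderZD//.
    apply: DE; [exact: fctZD|exact: fctZD|].
    by apply: fnbhsS (fnbhsI rk rl) => y [/= -> ->].
  - have [Xk rk] := repP k Ak; have [Xl rl] := repP l Al.
    rewrite (DE _ _ Ak Xk rk) (DE _ _ Al Xl rl).
    have -> : k p = rep k (tbase v) by rewrite vp; exact: (fnbhs_point rk).
    have -> : l p = rep l (tbase v) by rewrite vp; exact: (fnbhs_point rl).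
    rewrite -tderM//; apply: DE; [exact: fctM|exact: fctM|].
    by apply: fnbhsS (fnbhsI rk rl) => y [/= -> ->].
exists (TVec Dp) => //= f Xf; apply: DE => //.
  exact: (smooth_sval (A := A)).
by apply: fnbhsS (fnbhsT _ p).
Qed.

Lemma derive_lsubmx n n' (k : 'rV[R]_n -> R) (z u : 'rV[R]_(n + n')) :
  'D_u (fun z => k (lsubmx z)) z = 'D_(lsubmx u) k (lsubmx z).
Proof.
rewrite /derive (_ : (fun h => _) = (fun h : R => h^-1 *:
  (k (h *: lsubmx u + lsubmx z) - k (lsubmx z))))//.
apply/funext => h; rewrite /= (_ : lsubmx (h *: u + z) = h *: lsubmx u + lsubmx z)//.
by apply/matrixP => i j; rewrite !mxE.
Qed.

Lemma derive_rsubmx n n' (k : 'rV[R]_n' -> R) (z u : 'rV[R]_(n + n')) :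
  'D_u (fun z => k (rsubmx z)) z = 'D_(rsubmx u) k (rsubmx z).
Proof.
rewrite /derive (_ : (fun h => _) = (fun h : R => h^-1 *:
  (k (h *: rsubmx u + rsubmx z) - k (rsubmx z))))//.
apply/funext => h; rewrite /= (_ : rsubmx (h *: u + z) = h *: rsubmx u + rsubmx z)//.
by apply/matrixP => i j; rewrite !mxE.
Qed.

Lemma smooth_lsubmx n n' :
  @smooth R (euclid R (n + n')) (euclid R n) (fun z : 'rV[R]_(n + n') => lsubmx z).
Proof.
move=> h Ch; have -> : h \o (fun z : 'rV[R]_(n + n') => lsubmx z) =
    fun z => h (\row_i z 0 (lshift n' i)).
  by apply/funext => z /=; congr h; apply/rowP => i; rewrite !mxE.
by apply: (Cinf_comp (g := fun i z => z 0 _)) => // i; exact: Cinf_coord.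
Qed.

Lemma smooth_rsubmx n n' :
  @smooth R (euclid R (n + n')) (euclid R n') (fun z : 'rV[R]_(n + n') => rsubmx z).
Proof.
move=> h Ch; have -> : h \o (fun z : 'rV[R]_(n + n') => rsubmx z) =
    fun z => h (\row_i z 0 (rshift n i)).
  by apply/funext => z /=; congr h; apply/rowP => i; rewrite !mxE.
by apply: (Cinf_comp (g := fun i z => z 0 _)) => // i; exact: Cinf_coord.
Qed.

(** Near the given point [A] is the common zero set of the functions [k j], the differences of the
    coordinates of [a] and [b]. Equality of the images of [v] and [v'] says that the pair kills
    every [k j], so by [derive_level_set] it kills the functions vanishing on [A]. *)
Lemma tangent_fibre_product X Y M nX nY nM (a : X -> M) (b : Y -> M)
    (v : tspace X) (v' : tspace Y) :
  manifold nX X -> manifold nY Y -> manifold nM M -> smooth a -> submersion b ->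
  tmap a v = tmap b v' ->
  let A : set (dprod X Y) := [set p | a p.1 = b p.2] in
  exists w : tspace (dsub A),
    tmap (fun p : dsub A => (sval p).1) w = v /\
    tmap (fun p : dsub A => (sval p).2) w = v'.
Proof.
move=> mX mY mM sa [sb subb] vv' A.
have cX := manifold_closed mX; have cY := manifold_closed mY.
have cM := manifold_closed mM; have cP := @dclosed_dprod R X Y.
set x := tbase v; set y := tbase v'.
have axby : a x = b y.
  by rewrite /x /y -(tbase_tmap a) vv' tbase_tmap.
have [U [V [zeta [g xi]]]] := manifold_chart x mX.
have [U' [V' [zeta' [g' xi']]]] := manifold_chart y mY.
have [UM [VM [zetaM [gM xiM]]]] := manifold_chart (a x) mM.
pose cv (u : tspace X) : 'rV[R]_nX := \row_i tder u (zeta i).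
pose cv' (u : tspace Y) : 'rV[R]_nY := \row_i tder u (zeta' i).
pose z0 : 'rV[R]_(nX + nY) := row_mx (\row_i zeta i x) (\row_i zeta' i y).
pose g2 (z : 'rV[R]_(nX + nY)) : dprod X Y := (g (lsubmx z), g' (rsubmx z)).
have Vx : V (\row_i zeta i x) by apply: (chart_in xi); exact: chart_pt xi.
have V'y : V' (\row_i zeta' i y) by apply: (chart_in xi'); exact: chart_pt xi'.
have g2z0 : g2 z0 = (x, y).
  rewrite /g2 row_mxKl row_mxKr (chartK xi) ?(chartK xi')//.
    exact: chart_pt xi'.
  exact: chart_pt xi.
have sg2 : @smooth_at R (euclid R (nX + nY)) (dprod X Y) g2 z0.
  apply: smooth_at_dprod.
    apply: (@smooth_at_comp R (euclid R (nX + nY)) (euclid R nX) X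
      (fun z : 'rV[R]_(nX + nY) => lsubmx z) g).
      by apply: smooth_smooth_at; exact: smooth_lsubmx.
    by rewrite row_mxKl; exact: (chart_smooth xi Vx).
  apply: (@smooth_at_comp R (euclid R (nX + nY)) (euclid R nY) Y
    (fun z : 'rV[R]_(nX + nY) => rsubmx z) g').
    by apply: smooth_smooth_at; exact: smooth_rsubmx.
  by rewrite row_mxKr; exact: (chart_smooth xi' V'y).
(* The vector of the product with components [u] and [u'], as the velocity of a straight line in
   product coordinates. *)
pose dir (u : tspace X) (u' : tspace Y) : tspace (dprod X Y) :=
  tdir g2 z0 (row_mx (cv u) (cv' u')).
have dir_fst u u' f : tbase u = x -> fct X f -> tder (dir u u') (f \o fst) = tder u f.
  move=> ux Xf; rewrite tder_tdir//; last exact: (smooth_fst Xf).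
  rewrite (derive_lsubmx (f \o g)) !row_mxKl.
  by rewrite (chart_tder cX xi)// ux//; exact: chart_pt xi.
have dir_snd u u' f : tbase u' = y -> fct Y f -> tder (dir u u') (f \o snd) = tder u' f.
  move=> uy Yf; rewrite tder_tdir//; last exact: (smooth_snd Yf).
  rewrite (derive_rsubmx (f \o g')) !row_mxKr.
  by rewrite (chart_tder cY xi')// uy//; exact: chart_pt xi'.
pose k j (p : dprod X Y) := zetaM j (a p.1) - zetaM j (b p.2).
have zMX j : fct X (zetaM j \o a) by apply: sa; exact: chart_fct xiM j.
have zMY j : fct Y (zetaM j \o b) by apply: sb; exact: chart_fct xiM j.
have kE j : k j = fun p => -1 * (zetaM j \o b \o snd) p + (zetaM j \o a \o fst) p.
  by apply/funext => p; rewrite /k mulN1r addrC.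
have Pk j : fct (dprod X Y) (k j).
  rewrite kE; apply: fctZD => //; [exact: (smooth_snd (zMY j))|].
  exact: (smooth_fst (zMX j)).
have dir_k u u' j : tbase u = x -> tbase u' = y ->
    tder (dir u u') (k j) = tder u (zetaM j \o a) - tder u' (zetaM j \o b).
  move=> ux uy; rewrite kE tderZD; [|exact: (smooth_snd (zMY j))|exact: (smooth_fst (zMX j))].
  by rewrite dir_fst// dir_snd// mulN1r addrC.
have UMx : UM (a x) by exact: chart_pt xiM.
(* Because [b] enters [k] with a minus sign, vectors lifted from the negative coordinate directions
   form, with zero first component, the dual family required by [derive_level_set]. *)
have lift j : exists u' : tspace Y, tbase u' = y /\
    forall i, tder u' (zetaM i \o b) = - (j == i)%:R.
  pose w := tdir gM (\row_i zetaM i (a x)) (- delta_mx 0 j).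
  have [|u' u'y u'w] := subb y w.
    by rewrite tbase_tdir (chartK xiM).
  exists u'; split=> // i.
  rewrite -(tder_tmap _ cM sb (chart_fct xiM i)) u'w /w.
  rewrite (chart_tdir_coord cM xiM); last by apply: (chart_in xiM).
  by rewrite !mxE eqxx eq_sym.
have /choice[u' u'P] := lift.
have Axy : A (x, y) by [].
have [|f Pf f0|w wp wE] := @tvec_dsub _ A (exist _ (x, y) Axy) (dir v v') cP.
- by rewrite tbase_tdir.
- have := fnbhs_dsub f0; rewrite /= => {}f0.
  (* The functions [k j] read in the chart are smooth only near [z0], and are replaced by smooth
     functions on the whole space. *)
  have /choice[F FP] j : exists F, Cinf F /\ \forall z \near z0, k j (g2 z) = F z.
    by have [F CF kF] := iffLR (lsm_Cinf _ _) (sg2 _ (Pk j)); exists F.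
  have [H CH fH] := iffLR (lsm_Cinf _ _) (sg2 _ Pf).
  have FD u j : 'D_u (F j) z0 = 'D_u (k j \o g2) z0.
    by apply/esym/near_eq_derive; have [] := FP j.
  rewrite tder_tdir// (near_eq_derive _ fH).
  apply: (@derive_level_set _ _ _ F z0 _
    (fun j => row_mx (cv (tzero x)) (cv' (u' j)))) => //.
  + by move=> j; have [] := FP j.
  + move=> i j; rewrite FD -(tder_tdir _ cP sg2 (Pk j)).
    have [u'y u'D] := u'P i.
    by rewrite (dir_k (tzero x))// u'D/= sub0r opprK.
  + move=> j; rewrite FD -(tder_tdir _ cP sg2 (Pk j)) (dir_k v v')//.
    rewrite -(tder_tmap v cM sa (chart_fct xiM j)).
    by rewrite -(tder_tmap v' cM sb (chart_fct xiM j)) vv' subrr.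
  + have n1 : \forall z \near z0, forall j, k j (g2 z) = F j z.
      apply: (@filter_forall _ _ (fun j z => k j (g2 z) = F j z) (nbhs z0)) => j.
      by have [] := FP j.
    have n2 : \forall z \near z0, A (g2 z) -> f (g2 z) = 0.
      have f0' : fnbhs (fct (dprod X Y)) (g2 z0) [set q | A q -> f q = 0].
        by rewrite g2z0; apply: fnbhsS f0 => q fq Aq; exact: fq.
      by have /fnbhs_Cinf := smooth_at_near sg2 f0'.
    (* Both images are kept in the chart [UM], where equality of the coordinates forces equality of
       the points. *)
    have n3 : \forall z \near z0, UM (a (g2 z).1).
      have sa1 : smooth (fun q : dprod X Y => a q.1).
        by apply: smooth_comp sa; exact: smooth_fst.
      have UMg : fnbhs (fct M) (a (g2 z0).1) UM.
        by rewrite g2z0; exact: (chart_dopen xiM).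
      have /fnbhs_Cinf := smooth_at_near (smooth_at_comp sg2 (smooth_smooth_at _ sa1)) UMg.
      exact.
    have n4 : \forall z \near z0, UM (b (g2 z).2).
      have sb2 : smooth (fun q : dprod X Y => b q.2).
        by apply: smooth_comp sb; exact: smooth_snd.
      have UMg : fnbhs (fct M) (b (g2 z0).2) UM.
        by rewrite g2z0 /= -axby; exact: (chart_dopen xiM).
      have /fnbhs_Cinf := smooth_at_near (smooth_at_comp sg2 (smooth_smooth_at _ sb2)) UMg.
      exact.
    near=> z => Fz.
    have E1 : forall j, k j (g2 z) = F j z by near: z; exact: n1.
    have E2 : A (g2 z) -> f (g2 z) = 0 by near: z; exact: n2.
    have E3 : UM (a (g2 z).1) by near: z; exact: n3.
    have E4 : UM (b (g2 z).2) by near: z; exact: n4.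
    have E5 : f (g2 z) = H z by near: z; exact: fH.
    have Hz0 : H z0 = 0.
      by rewrite -(nbhs_singleton fH) /= (nbhs_singleton n2)// g2z0.
    rewrite Hz0 -E5; apply: E2; rewrite /A/=.
    rewrite -(chartK xiM E3) -(chartK xiM E4); congr gM; apply/rowP => j.
    rewrite !mxE; apply/eqP; rewrite -subr_eq0; apply/eqP.
    have := Fz j; rewrite -E1 -(nbhs_singleton n1) /k => ->.
    by rewrite g2z0/= axby subrr.
- have s1 : smooth (fun q : dsub A => (sval q).1).
    exact: (smooth_comp (@smooth_sval R (dprod X Y) A) (@smooth_fst R X Y)).
  have s2 : smooth (fun q : dsub A => (sval q).2).
    exact: (smooth_comp (@smooth_sval R (dprod X Y) A) (@smooth_snd R X Y)).
  exists w; split; apply: tvec_fct_ext => [|f Zf].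
  + by rewrite tbase_tmap wp.
  + rewrite (tder_tmap w cX s1 Zf) -(dir_fst v v')//.
    by rewrite -(wE (f \o fst))//; exact: (smooth_fst Zf).
  + by rewrite tbase_tmap wp.
  + rewrite (tder_tmap w cY s2 Zf) -(dir_snd v v')//.
    by rewrite -(wE (f \o snd))//; exact: (smooth_snd Zf).
Unshelve. all: by end_near. Qed.

End fibre_products.

(** * Submersions between Whitney sums with the tangent bundle *)

Section agreement.
Context {R : realType} {Y : dspace R} (cY : dclosed Y) (v w : tspace Y).
Hypothesis vw : tbase v = tbase w.

(* Vectors are only evaluated on global functions, hence the extension [k'] of
   the germ of [k]. *)
Definition agree (k : Y -> R) := exists k', [/\ fct Y k',
  fnbhs (fct Y) (tbase v) [set y | k y = k' y] & tder v k' = tder w k'].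

Lemma agree_lsm k : agree k -> lsm (fct Y) (tbase v) k.
Proof.
move=> [k' [Yk' kk' _]]; apply: lsm_eq (lsm_sub _ Yk').
by apply: fnbhsS kk' => y /= ->.
Qed.

Lemma agree_eq k l : fnbhs (fct Y) (tbase v) [set y | k y = l y] ->
  agree k -> agree l.
Proof.
move=> kl [k' [Yk' kk' vwk']]; exists k'; split=> //.
by apply: fnbhsS (fnbhsI kl kk') => y [/= <-].
Qed.

Lemma agree_comp n (h : 'I_n -> Y -> R) f : (forall i, agree (h i)) -> Cinf f ->
  agree (fun y => f (\row_i h i y)).
Proof.
move=> /choice[h' h'P] Cf; exists (fun y => f (\row_i h' i y)); split.
- by apply: fct_comp => // i; have [] := h'P i.
- have : fnbhs (fct Y) (tbase v) [set y | forall i, h i y = h' i y].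
    by apply: fnbhs_forall => i; have [] := h'P i.
  by apply: fnbhsS => y /= hy; congr f; apply/rowP => i; rewrite !mxE.
- rewrite !tder_comp -?vw//; try by move=> i; have [] := h'P i.
  by apply: eq_bigr => i _; have [_ _ ->] := h'P i.
Qed.

Lemma agree_comp2 n n' (h : 'I_n -> Y -> R) (h' : 'I_n' -> Y -> R) f :
  (forall i, agree (h i)) -> (forall i, agree (h' i)) -> Cinf f ->
  agree (fun y => f (row_mx (\row_i h i y) (\row_i h' i y))).
Proof.
move=> ah ah' Cf; pose g (i : 'I_(n + n')) :=
  match fintype.split i with inl j => h j | inr j => h' j end.
have ag i : agree (g i) by rewrite /g; case: fintype.split.
apply: agree_eq (agree_comp ag Cf); apply: fnbhsS (fnbhsT _ _) => y _ /=.
congr f; apply/rowP => i; rewrite !mxE /g.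
by case: fintype.split => j; rewrite mxE.
Qed.

(** Agreement on generators pulled back along [g] passes to all functions locally expressed through
    them; this peels off one layer of a generated structure. *)
Lemma agree_pull (T : Type) (F : set (T -> R)) (g : Y -> T) h :
  (forall e, F e -> agree (e \o g)) -> lsm F (g (tbase v)) h -> agree (h \o g).
Proof.
move=> aF [k [f [u [Ff Cu [l [e [d [Fe d0 ed]]]]]]]].
have af i : agree (f i \o g) by exact: aF.
apply: agree_eq (agree_comp af Cu).
have : fnbhs (fct Y) (tbase v)
    [set y | forall i, `|e i (g y) - e i (g (tbase v))| < d].
  by apply: fnbhs_forall => i; exact: (lsm_cont (agree_lsm (aF _ (Fe i))) d0).
by apply: fnbhsS => y /= ey; rewrite (ed (g y)).
Qed.

Lemma agree_ext : (forall h, fct Y h -> agree h) -> v = w.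
Proof.
move=> a; apply: tvec_fct_ext => // h Yh; have [k [Yk hk vwk]] := a h Yh.
by rewrite (tder_eq cY Yh Yk hk) vwk; apply/esym/(tder_eq cY Yh Yk); rewrite -vw.
Qed.

End agreement.

Section whitney_sums.
Context {R : realType}.

Section pairs.
Context {E E' B : dspace R} (S : vbstr E B) (S' : vbstr E' B).

Lemma wpairE e e' : vproj S' e' = vproj S e -> sval (wpair S S' e e') = (e, e').
Proof. by move=> p; rewrite /wpair; case: pselect. Qed.

Lemma wsum_ext (p q : wsum S S') : sval p = sval q -> p = q.
Proof.
case: p q => [p pP] [q qP] /= pq; subst; congr exist; exact: Prop_irrelevance.
Qed.

Lemma wpairK (p : wsum S S') : wpair S S' (sval p).1 (sval p).2 = p.
Proof.
apply: wsum_ext; rewrite wpairE; first by case: (sval p).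
by case: p.
Qed.

Lemma wsumP (p : wsum S S') : vproj S' (sval p).2 = vproj S (sval p).1.
Proof. by case: p. Qed.

Lemma smooth_wfst : smooth (fun p : wsum S S' => (sval p).1).
Proof. exact: (smooth_comp (@smooth_sval R _ (wsum_set S S')) (@smooth_fst R E E')). Qed.

Lemma smooth_wsnd : smooth (fun p : wsum S S' => (sval p).2).
Proof. exact: (smooth_comp (@smooth_sval R _ (wsum_set S S')) (@smooth_snd R E E')). Qed.

Lemma smooth_at_wpair (X : dspace R) (x : X) (a : X -> E) (a' : X -> E') :
  smooth_at a x -> smooth_at a' x ->
  fnbhs (fct X) x [set y | vproj S' (a' y) = vproj S (a y)] ->
  smooth_at (fun y => wpair S S' (a y) (a' y)) x.
Proof.
move=> sa sa' aa'; apply: smooth_at_dsub.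
apply: (@smooth_at_eq _ _ _ (fun y => (a y, a' y) : dprod E E')).
  by apply: fnbhsS aa' => y /= yy; rewrite wpairE.
exact: smooth_at_dprod.
Qed.

End pairs.

(** * Horizontal and vertical vectors on a Whitney sum *)

Section tangent_sum.
Context {E B : dspace R} {S : vbstr E B} (hS : vector_bundle 1 S).
Context {n : nat} (mB : manifold n B).
Local Notation TB := (tbundle B).
Local Notation W := (wsum TB S).
Implicit Types p : W.

Let cB : dclosed B := manifold_closed mB.
Let cW : dclosed W := @dclosed_dsub R _ _.

Definition wbase (p : W) : B := tbase (sval p).1.

Lemma smooth_wbase : smooth wbase.
Proof. exact: (smooth_comp (@smooth_wfst _ _ _ TB S) (@smooth_tbase R B)). Qed.

(* Transport the point [p] along a curve in [B], with constant coordinates. *)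
Lemma horizontal_lift p (u : tspace B) : tbase u = wbase p ->
  exists2 V : tspace W, tbase V = p &
    forall k, fct B k -> tder V (k \o wbase) = tder u k.
Proof.
move=> up; set x := wbase p in up *.
have [U [V [zeta [g xi]]]] := manifold_chart x mB.
have [UE [phi [psi [T UEx]]]] := vb_triv x hS.
pose z0 := \row_i zeta i x; pose a := \row_i tder u (zeta i).
pose c := \row_i tder (sval p).1 (zeta i).
(* The straight line in the chart with velocity [u], parametrized by one-entry rows so that [tdir]
   applies. *)
pose z (s : 'rV[R]_1) := z0 + s 0 0 *: a.
have z00 : z 0 = z0 by rewrite /z mxE scale0r addr0.
have Ux := chart_pt xi; have Vz0 : V z0 := chart_in xi Ux.
have gz0 : g z0 = x := chartK xi Ux.
have sz s : @smooth_at R (euclid R 1) (euclid R n) z s.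
  apply: smooth_at_euclid => i.
  apply: (@lsm_ext _ _ _ _ (fun y : 'rV[R]_1 => z0 0 i + y 0 0 * a 0 i)).
    by move=> y; rewrite !mxE.
  apply: lsmD; first exact: lsm_cst.
  by apply: lsmM; [apply: lsm_sub; exact: Cinf_coord|exact: lsm_cst].
have nV : fnbhs (fct (euclid R 1)) (0 : 'rV[R]_1) [set s | V (z s)].
  apply: (smooth_at_near (sz 0)); apply: nbhs_fnbhs; rewrite z00.
  exact: open_nbhs_nbhs (conj (chart_open xi) Vz0).
have sgz : @smooth_at R (euclid R 1) B (fun s => g (z s)) 0.
  apply: (smooth_at_comp (sz 0)); rewrite z00; exact: (chart_smooth xi Vz0).
(* The tangent component keeps its coordinates [c] and the line component its coordinate [phi],
   while the base point moves along the curve. *)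
pose G (s : 'rV[R]_1) : W := wpair TB S (tdir g (z s) c) (psi (g (z s)) (phi (sval p).2)).
have nUE : fnbhs (fct (euclid R 1)) (0 : 'rV[R]_1) [set s | UE (g (z s))].
  by apply: (smooth_at_near sgz); rewrite z00 gz0; exact: (tr_open T).
have sG : @smooth_at R (euclid R 1) W G 0.
  apply: smooth_at_wpair.
  - apply: smooth_at_tspace => [|h Bh].
      apply: smooth_at_eq sgz; apply: fnbhsS (fnbhsT _ _) => s _ /=.
      by rewrite tbase_tdir.
    apply: (@lsm_eq _ _ _ _ (fun s => 'D_c (h \o g) (z s))).
      by apply: fnbhsS nV => s Vs /=; rewrite tder_tdir//; exact: (chart_smooth xi Vs).
    apply: (@smooth_at_lsm R (euclid R 1) (euclid R n) z 0 (fun y => 'D_c (h \o g) y) (sz 0)).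
    by rewrite z00; apply: lsm_derive_lsm; exact: (chart_smooth xi Vz0).
  - apply: (smooth_at_psi sgz T); first by rewrite z00 gz0.
    by move=> i; exact: lsm_cst.
  - by apply: fnbhsS nUE => s Us /=; rewrite tbase_tdir (tr_proj T).
have G0 : G 0 = p.
  rewrite -[RHS]wpairK /G z00; congr wpair; last first.
    rewrite gz0 -[RHS](tr_phiK T); last by rewrite wsumP.
    by rewrite wsumP.
  apply: (chart_vec_ext cB xi) => [||i]; [by rewrite tbase_tdir gz0..|].
  by rewrite (chart_tdir_coord cB xi)// mxE.
exists (tdir G 0 (const_mx 1)); first by rewrite tbase_tdir.
move=> k Bk; rewrite tder_tdir//; last exact: smooth_wbase.
rewrite (chart_tder cB xi) ?up// -/z0 -/a.
have zE (h : R) : z (h *: const_mx 1 + 0) = h *: a + z0.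
  by rewrite /z addr0 !mxE mulr1 addrC.
have kG s : k (wbase (G s)) = k (g (z s)) by rewrite /wbase wpair_fst tbase_tdir.
rewrite /derive; set F := (X in lim (X @ _)).
suff -> : F = (fun h : R => h^-1 *: ((k \o g) (h *: a + z0) - (k \o g) z0)) by [].
apply/funext => h; rewrite /F; congr (_ *: (_ - _)).
  by rewrite -[LHS]/(k (wbase (G _))) kG zE.
by rewrite -[LHS]/(k (wbase (G _))) kG z00.
Qed.

(* The velocity of a curve which is affine in a fibre. *)
Lemma vertical_lift p (u : tspace B) (l : E) :
  tbase u = wbase p -> vproj S l = wbase p ->
  exists2 V : tspace W, tbase V = p &
    forall k c0 c1 A, fct W k -> fnbhs (fct W) p A ->
      (forall s, let q := wpair TB S (vadd TB (sval p).1 (vscale TB s u))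
        (vadd S (sval p).2 (vscale S s l)) in A q -> k q = c0 + s * c1) ->
      tder V k = c1.
Proof.
move=> up lp; set x := wbase p in up lp *.
pose G (s : 'rV[R]_1) : W := wpair TB S (vadd TB (sval p).1 (vscale TB (s 0 0) u))
        (vadd S (sval p).2 (vscale S (s 0 0) l)).
have tG s h : tder (vadd TB (sval p).1 (vscale TB s u)) h =
    tder (sval p).1 h + s * tder u h.
  by rewrite tder_add ?tder_scale// [RHS]tbase_mktvec up.
have pG s : tbase (vadd TB (sval p).1 (vscale TB s u)) = x by rewrite tbase_mktvec.
have p2 : vproj S (sval p).2 = x by exact: wsumP.
have pl s : vproj S (vscale S s l) = x by rewrite (proj_scale hS).
have pE s : vproj S (vadd S (sval p).2 (vscale S s l)) = x.
  by rewrite (proj_add hS)// p2 pl.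
have [UE [phi [psi [T UEx]]]] := vb_triv x hS.
have sx : @smooth_at R (euclid R 1) B (fun=> x) 0 by move=> h _; exact: lsm_cst.
have sG : @smooth_at R (euclid R 1) W G 0.
  apply: smooth_at_wpair.
  - apply: smooth_at_tspace => [|h Bh].
      by apply: smooth_at_eq sx; apply: fnbhsS (fnbhsT _ _) => s _ /=; rewrite pG.
    apply: (@lsm_ext _ _ _ _ (fun s : 'rV[R]_1 => tder (sval p).1 h + s 0 0 * tder u h)).
      by move=> s; rewrite tG.
    apply: lsmD; first exact: lsm_cst.
    by apply: lsmM; [apply: lsm_sub; exact: Cinf_coord|exact: lsm_cst].
  - apply: (@smooth_at_eq R (euclid R 1) E (fun s : 'rV[R]_1 =>
        psi x (phi (sval p).2 + s 0 0 *: phi l))).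
      apply: fnbhsS (fnbhsT _ _) => s _ /=.
      rewrite -(tr_scale T) ?lp// -(tr_add T) ?p2 ?pl//.
      by rewrite -{1}(pE (s 0 0)) (tr_phiK T)// pE.
    apply: (smooth_at_psi sx T) => // i.
    apply: (@lsm_ext _ _ _ _ (fun s : 'rV[R]_1 =>
      phi (sval p).2 0 i + s 0 0 * phi l 0 i)); first by move=> s; rewrite !mxE.
    apply: lsmD; first exact: lsm_cst.
    by apply: lsmM; [apply: lsm_sub; exact: Cinf_coord|exact: lsm_cst].
  - by apply: fnbhsS (fnbhsT _ _) => s _ /=; rewrite pE pG.
have G0 : G 0 = p.
  apply: wsum_ext; rewrite wpairE ?mxE; last by rewrite pE /= tbase_mktvec.
  rewrite (vscale0 hS) lp [RHS]surjective_pairing; congr pair.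
    by apply: tvec_ext => [|h]; rewrite ?pG// tG mul0r addr0.
  have [phi' P] := vb_fibre_coord hS x; apply: (fc_inj P) => //.
    by rewrite (proj_add hS) ?vprojK.
  by rewrite (fc_add P) ?vprojK// (fc_zero P) addr0.
exists (tdir G 0 (const_mx 1)); first by rewrite tbase_tdir.
move=> k c0 c1 A Wk nA kG; rewrite (tder_tdir _ cW sG Wk).
(* Being affine is only required while the curve stays in [A]; this admits global extensions of
   local coordinates. *)
have kGE : \forall s \near (0 : 'rV[R]_1), (k \o G) s = c0 + c1 * s 0 0.
  have nA' : fnbhs (fct W) (G 0) A by rewrite G0.
  have /fnbhs_Cinf := smooth_at_near sG nA'.
  by apply: filterS => s /kG; rewrite mulrC.
rewrite (near_eq_derive _ kGE).
have -> : (fun s : 'rV[R]_1 => c0 + c1 * s 0 0) =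
  cst c0 + c1 *: (fun s : 'rV[R]_1 => s 0 0) by [].
have dc : derivable (fun s : 'rV[R]_1 => s 0 0) 0 (const_mx 1).
  by apply: diff_derivable; exact: differentiable_coord.
rewrite (deriveD (derivable_cst c0 _ _) (derivableZ (k := c1) dc)) (deriveZ c1 dc).
by rewrite derive_cst derive_coord mxE add0r; exact: mulr1.
Qed.

End tangent_sum.

(** * Coordinates on a Whitney sum *)

Section local_generators.
Context {E B : dspace R} {S : vbstr E B} (hS : vector_bundle 1 S).
Context {n : nat} (mB : manifold n B).
Local Notation TB := (tbundle B).
Local Notation W := (wsum TB S).

Let cB : dclosed B := manifold_closed mB.
Let cW : dclosed W := @dclosed_dsub R _ _.

(** The base coordinates, their differentials on the tangent component and the line coordinate form
    a local coordinate system. The last of these is only local, so it enters through [agree]. *)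
Lemma wsum_vec_ext (v w : tspace W) U V zeta g UE phi psi :
  tbase v = tbase w ->
  @chart R B (wbase (tbase v)) n U V zeta g ->
  @trivialization R 1 E B S UE phi psi -> UE (wbase (tbase v)) ->
  (forall i, tder v (zeta i \o @wbase _ _ S) = tder w (zeta i \o @wbase _ _ S)) ->
  (forall i, tder v (fun q => tder (sval q).1 (zeta i)) =
             tder w (fun q => tder (sval q).1 (zeta i))) ->
  (forall i, agree v w (fun q => phi (sval q).2 0 i)) ->
  v = w.
Proof.
move=> vw xi T UEx vw0 vw1 vw2; set p := tbase v; set x := wbase p.
have Ux := chart_pt xi; have sb := @smooth_wbase _ _ S.
have a0 i : agree v w (zeta i \o @wbase _ _ S).
  exists (zeta i \o @wbase _ _ S); split=> //; first exact/sb/(chart_fct xi).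
  by apply: fnbhsS (fnbhsT _ _).
have a1 i : agree v w (fun q => tder (sval q).1 (zeta i)).
  exists (fun q => tder (sval q).1 (zeta i)); split=> //.
    exact: (smooth_wfst (smooth_tder (chart_fct xi i))).
  by apply: fnbhsS (fnbhsT _ _).
have sbp A : fnbhs (fct B) x A -> fnbhs (fct W) p [set q | A (wbase q)].
  by apply: smooth_at_near; exact: smooth_smooth_at.
apply: agree_ext => //.
have ab k : fct B k -> agree v w (k \o @wbase _ _ S).
  move=> Bk; have [f Cf [_ kf]] := chart_rep xi Ux Bk.
  apply: agree_eq (agree_comp cW vw a0 Cf).
  by apply: fnbhsS (sbp _ kf) => q /= ->.
have ad k : fct B k -> agree v w (fun q => tder (sval q).1 k).
  move=> Bk; have [f Cf [_ kf]] := chart_rep xi Ux Bk.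
  have [N [Nx Nk oN]] := fnbhs_open kf.
  (* The differential of [k] as a function of the base coordinates and of the components of the
     tangent vector. *)
  pose h (z : 'rV[R]_(n + n)) :=
    \sum_i (rsubmx z) 0 i * 'D_(delta_mx 0 i) f (lsubmx z).
  have Ch : Cinf h.
    apply: Cinf_sum => i; apply: CinfM.
      exact: (@smooth_rsubmx R n n _ (@Cinf_coord R n i)).
    exact: (@smooth_lsubmx R n n _ (Cinf_derive (delta_mx 0 i) Cf)).
  apply: agree_eq (agree_comp2 cW vw a0 a1 Ch).
  apply: fnbhsS (sbp _ (oN _ Nx)) => q /= Nq.
  have Xz i := chart_fct xi i.
  rewrite (tder_eq cB Bk (fct_comp cB Xz Cf)); last first.
    exact: fnbhsS Nk (oN _ Nq).
  rewrite tder_comp// /h row_mxKl row_mxKr.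
  by apply: eq_bigr => i _; rewrite mxE.
have ae k : fct E k -> agree v w (fun q => k (sval q).2).
  move=> Ek.
  (* A function on [E] read through the chart of the base and the trivialization of the bundle. *)
  pose f (z : 'rV[R]_(n + 1)) := k (psi (g (lsubmx z)) (rsubmx z)).
  pose z0 : 'rV[R]_(n + 1) := row_mx (\row_i zeta i x) (phi (sval p).2).
  have sg : @smooth_at R (euclid R (n + 1)) B (fun z => g (lsubmx z)) z0.
    apply: (@smooth_at_comp R (euclid R (n + 1)) (euclid R n) B
      (fun z : 'rV[R]_(n + 1) => lsubmx z) g).
      by apply: smooth_smooth_at; exact: smooth_lsubmx.
    by rewrite row_mxKl; exact: (chart_smooth xi (chart_in xi Ux)).
  have gz0 : g (lsubmx z0) = x by rewrite row_mxKl; exact: (chartK xi Ux).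
  have /lsm_Cinf[h Ch fh] : lsm (@Cinf R (n + 1)) z0 f.
    apply: (@smooth_at_psi _ _ (euclid R (n + 1)) _ _ _ _ _ sg _ _ _ _ T _ _ k Ek).
      by rewrite gz0.
    by move=> i; apply: lsm_sub; exact: (@smooth_rsubmx R n 1 _ (@Cinf_coord R 1 i)).
  apply: agree_eq (agree_comp2 cW vw a0 vw2 Ch).
  pose Z (q : W) := row_mx (\row_i zeta i (wbase q)) (\row_i phi (sval q).2 0 i).
  have nZ : fnbhs (fct W) p [set q | f (Z q) = h (Z q)].
    have Zp : Z p = z0.
      by rewrite /Z /z0; congr row_mx; apply/rowP => i; rewrite mxE.
    have sZ : @smooth_at R W (euclid R (n + 1)) Z p.
      apply: smooth_at_euclid => i; rewrite -(splitK i).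
      case: (fintype.split i) => j /=.
        apply: (@lsm_ext _ _ _ _ (fun q => zeta j (wbase q))).
          by move=> q; rewrite /Z row_mxEl mxE.
        by apply: lsm_sub; exact: sb _ (chart_fct xi j).
      apply: (@lsm_ext _ _ _ _ (fun q => phi (sval q).2 0 j)).
        by move=> q; rewrite /Z row_mxEr mxE.
      exact: (agree_lsm (vw2 j)).
    have fh' : fnbhs (fct (euclid R (n + 1))) (Z p) [set z | f z = h z].
      by rewrite Zp; apply/fnbhs_Cinf.
    exact: (smooth_at_near sZ fh').
  have nU := sbp _ (chart_dopen xi Ux).
  have nUE := sbp _ (tr_open T UEx).
  apply: fnbhsS (fnbhsI nZ (fnbhsI nU nUE)) => q [/= <- [Uq UEq]].
  rewrite /f /Z row_mxKl row_mxKr (chartK xi Uq).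
  have -> : \row_i phi (sval q).2 0 i = phi (sval q).2 by apply/rowP => i; rewrite mxE.
  have qE : wbase q = vproj S (sval q).2 by rewrite wsumP.
  by rewrite qE (tr_phiK T)// -qE.
move=> h Wh; rewrite -[h]/(h \o id).
(* The structure of the sum is unwound layer by layer: subspace, product, tangent space. *)
apply: (agree_pull cW vw _ (Wh p)) => _ [k Pk ->].
apply: (agree_pull (g := sval) cW vw _ (Pk (sval p))) => _ [] [l El ->].
  apply: (agree_pull (g := fst \o sval) cW vw _ (El (sval p).1)).
  by move=> _ [] [m Bm ->]; [exact: ab|exact: ad].
exact: ae.
Qed.

End local_generators.

Section sum_submersion.
Context {E B E' B' : dspace R} {S : vbstr E B} {S' : vbstr E' B'}.
Context (hS : vector_bundle 1 S) (hS' : vector_bundle 1 S').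
Context {F : E -> E'} {f : B -> B'} (hF : vb_morphism S S' F f).
Hypothesis F0 : forall e, F e = vzero S' (f (vproj S e)) -> e = vzero S (vproj S e).
Context {n n' : nat} (mB : manifold n B) (mB' : manifold n' B').
Context (sf : submersion f).
Local Notation W := (wsum (tbundle B) S).
Local Notation W' := (wsum (tbundle B') S').

Let cB : dclosed B := manifold_closed mB.
Let cB' : dclosed B' := manifold_closed mB'.
Let cW : dclosed W := @dclosed_dsub R _ _.
Let cW' : dclosed W' := @dclosed_dsub R _ _.

Definition wmap (p : W) : W' := wpair (tbundle B') S' (tmap f (sval p).1) (F (sval p).2).

Lemma sval_wmap p : sval (wmap p) = (tmap f (sval p).1, F (sval p).2).
Proof.
by rewrite /wmap wpairE// (line_map_proj hF) wsumP /= tbase_tmap.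
Qed.

Lemma smooth_wmap : smooth wmap.
Proof.
have [sF smf _ _ _] := hF.
apply: smooth_atP => // p; apply: smooth_at_wpair.
- apply: smooth_smooth_at.
  exact: (smooth_comp (@smooth_wfst _ _ _ (tbundle B) S) (smooth_tmap cB' smf)).
- apply: smooth_smooth_at.
  exact: (smooth_comp (@smooth_wsnd _ _ _ (tbundle B) S) sF).
- apply: fnbhsS (fnbhsT _ _) => q _ /=.
  by rewrite (line_map_proj hF) tbase_tmap; congr f; exact: (wsumP q).
Qed.

Lemma wbase_wmap p : wbase (wmap p) = f (wbase p).
Proof. by rewrite /wbase sval_wmap/= tbase_tmap. Qed.

(** The horizontal lift [V0] has the right image in the base. Its defects, [b] in the tangent
    coordinates and [r] in the line coordinate, are made up by a vertical vector, available because
    [f] is a submersion and [F] is surjective on fibres. *)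
Lemma submersion_wmap : submersion wmap.
Proof.
split; first exact: smooth_wmap.
have [sF smf _ _ _] := hF; have [_ subf] := sf.
move=> p w wp; set x := wbase p; have x'E : wbase (tbase w) = f x by rewrite wp wbase_wmap.
have [U' [V' [zeta' [g' xi']]]] := manifold_chart (wbase (tbase w)) mB'.
have [UE' [phi' [psi' [T' UEx']]]] := vb_triv (wbase (tbase w)) hS'.
have sb := @smooth_wbase _ _ S; have sb' := @smooth_wbase _ _ S'.
have sT := smooth_wmap.
have [u1 u1x u1w] : exists2 u1, tbase u1 = x & tmap f u1 = tmap (@wbase _ _ S') w.
  by apply: subf; rewrite tbase_tmap.
have [V0 V0p V0k] := horizontal_lift hS mB u1x.
(* The line coordinate is local; [eta] is a global function with the same germ, on which vectors can
   be evaluated. *)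
have Weta : exists eta, fct W' eta /\
    fnbhs (fct W') (tbase w) [set q | phi' (sval q).2 0 0 = eta q].
  have sl : lsm (fct W') (tbase w) (fun q => phi' (sval q).2 0 0).
    apply: (smooth_at_phi (smooth_smooth_at _ sb') T' UEx').
      by apply: smooth_smooth_at; exact: smooth_wsnd.
    by apply: fnbhsS (fnbhsT _ _) => q _; exact: (wsumP q).
  by have [eta Weta peta] := lsm_dclosed cW' sl; exists eta.
have [eta [We etaE]] := Weta.
pose dz i (q : W') := tder (sval q).1 (zeta' i).
have Wdz i : fct W' (dz i) := smooth_wfst (smooth_tder (chart_fct xi' i)).
pose b i := tder w (dz i) - tder V0 (dz i \o wmap).
pose r := tder w eta - tder V0 (eta \o wmap).
have [u2 u2x u2w] : exists2 u2, tbase u2 = x &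
    tmap f u2 = tdir g' (\row_i zeta' i (wbase (tbase w))) (\row_i b i).
  by apply: subf; rewrite tbase_tdir (chartK xi' (chart_pt xi')).
have P' := trivialization_coord T' UEx'.
have [e2' e2'x phie2'] := fc_surj P' (const_mx r).
have [l2 [l2x Fl2]] : exists l2, vproj S l2 = x /\ F l2 = e2'.
  by apply: (line_map_surj hS hS' hF F0); rewrite -x'E.
have [V1 V1p V1k] := vertical_lift hS mB u2x l2x.
exists (vadd (tbundle W) V0 V1); first by rewrite tbase_mktvec.
have bVw : tbase (tmap wmap (vadd (tbundle W) V0 V1)) = tbase w.
  by rewrite tbase_tmap tbase_mktvec V0p wp.
have tmE k : fct W' k -> tder (tmap wmap (vadd (tbundle W) V0 V1)) k =
    tder V0 (k \o wmap) + tder V1 (k \o wmap).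
  by move=> Wk; rewrite (tder_tmap _ cW' sT Wk) tder_add// V0p V1p.
have px : vproj S (sval p).2 = x by exact: (wsumP p).
have lx s : vproj S (vscale S s l2) = x by rewrite (proj_scale hS).
have curve s : wmap (wpair (tbundle B) S (vadd (tbundle B) (sval p).1 (vscale (tbundle B) s u2))
      (vadd S (sval p).2 (vscale S s l2))) =
    wpair (tbundle B') S' (tmap f (vadd (tbundle B) (sval p).1 (vscale (tbundle B) s u2)))
      (F (vadd S (sval p).2 (vscale S s l2))).
  by rewrite /wmap wpairE// (proj_add hS) ?px ?lx//= tbase_mktvec.
(* The vertical vector has derivative [c1] on [k] if [k] is affine of slope [c1] along the image of
   the vertical curve. *)
have V1E k c0 c1 A : fct W' k -> fnbhs (fct W') (tbase w) A ->
    (forall s, let q := wpair (tbundle B') S'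
      (tmap f (vadd (tbundle B) (sval p).1 (vscale (tbundle B) s u2)))
      (F (vadd S (sval p).2 (vscale S s l2))) in A q -> k q = c0 + s * c1) ->
    tder V1 (k \o wmap) = c1.
  move=> Wk nA kc; apply: (V1k _ c0 _ (wmap @^-1` A)); first exact: sT.
    by apply: (smooth_at_near (smooth_smooth_at _ sT)); rewrite -wp.
  by move=> s q; rewrite /q /= curve; exact: kc.
have zB i := chart_fct xi' i.
apply/esym; apply: (wsum_vec_ext mB' (esym bVw) xi' T' UEx') => [i|i|i].
- rewrite tmE; last exact: (sb' _ (zB i)).
  rewrite (V1E _ (zeta' i (f x)) 0 _ (sb' _ (zB i)) (fnbhsT _ _)); last first.
    by move=> s q _; rewrite /q /= /wbase wpair_fst tbase_tmap tbase_mktvec mulr0 addr0.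
  have -> : (zeta' i \o @wbase _ _ S') \o wmap = (zeta' i \o f) \o @wbase _ _ S.
    by apply/funext => q /=; rewrite wbase_wmap.
  rewrite V0k; last exact: (smf _ (zB i)).
  by rewrite -(tder_tmap _ cB' smf (zB i)) u1w (tder_tmap _ cB' sb' (zB i)) addr0.
- rewrite tmE; last exact: Wdz.
  rewrite (V1E _ (tder (tmap f (sval p).1) (zeta' i)) (b i) _ (Wdz i) (fnbhsT _ _)).
    by rewrite /b addrC subrK.
  move=> s q _; rewrite /q /dz wpair_fst !(tder_tmap _ cB' smf (zB i)).
  rewrite tder_add ?tder_scale//; last by rewrite [RHS]tbase_mktvec u2x.
  rewrite -(tder_tmap u2 cB' smf (zB i)) u2w (chart_tdir_coord cB' xi') ?mxE//.
  by apply: (chart_in xi'); exact: (chart_pt xi').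
(* The linearity of [phi'] carries over to [eta] only where the two agree, which is the set passed
   to [V1E]. *)
- have r0 : tder (tmap wmap (vadd (tbundle W) V0 V1)) eta = tder w eta.
    rewrite tmE// (V1E _ (phi' (F (sval p).2) 0 0) r _ We etaE).
      by rewrite /r addrC subrK.
    have Fp : vproj S' (F (sval p).2) = wbase (tbase w).
      by rewrite (line_map_proj hF) px x'E.
    have e2s s : vproj S' (vscale S' s e2') = wbase (tbase w) by rewrite (proj_scale hS').
    have FE s : F (vadd S (sval p).2 (vscale S s l2)) =
        vadd S' (F (sval p).2) (vscale S' s e2').
      by rewrite (line_map_add hF) ?px ?lx// (line_map_scale hF) Fl2.
    move=> s q etaq; rewrite -etaq /= /q.
    have -> : (sval q).2 = F (vadd S (sval p).2 (vscale S s l2)).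
      rewrite /q wpairE// FE (proj_add hS') ?Fp ?e2s//.
      by rewrite -[RHS]/(tbase _) tbase_tmap tbase_mktvec x'E.
    by rewrite FE (fc_add P' Fp (e2s s)) (fc_scale P')// phie2' !mxE.
  by exists eta; split=> //; rewrite ord1.
Qed.

End sum_submersion.
End whitney_sums.

(** * Morita kernels of cohomologous forms *)

Section shears.
Context {R : realType} {E B : dspace R} {S : vbstr E B} (hS : vector_bundle 1 S).
Context {beta : tspace B -> E} (hbeta : smooth beta)
  (pbeta : forall w, vproj S (beta w) = tbase w).
Local Notation TB := (tbundle B).
Local Notation W := (wsum TB S).

(** For [beta] the form itself this is the translation inside the target map of its kernel; for
    [src_pullback alpha] it is A on arrows, and for [alpha] it is A on objects. *)
Definition shear (p : W) : W := wpair TB S (sval p).1 (vadd S (sval p).2 (beta (sval p).1)).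

Definition unshear (p : W) : W := wpair TB S (sval p).1 (vsub S (sval p).2 (beta (sval p).1)).

Let pb (p : W) : vproj S (sval p).2 = vproj S (beta (sval p).1).
Proof. by rewrite pbeta wsumP. Qed.

Lemma sval_shear p : sval (shear p) = ((sval p).1, vadd S (sval p).2 (beta (sval p).1)).
Proof. by rewrite /shear wpairE// (proj_add hS)// wsumP. Qed.

Lemma sval_unshear p :
  sval (unshear p) = ((sval p).1, vsub S (sval p).2 (beta (sval p).1)).
Proof. by rewrite /unshear wpairE// (proj_sub hS)// wsumP. Qed.

Lemma shearK p : unshear (shear p) = p.
Proof.
by apply: wsum_ext; rewrite sval_unshear sval_shear/= (vaddK hS)//; case: (sval p).
Qed.

Lemma unshearK p : shear (unshear p) = p.
Proof.
by apply: wsum_ext; rewrite sval_shear sval_unshear/= (vsubK hS)//; case: (sval p).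
Qed.

Let smooth_beta1 (p : W) : smooth_at (fun q : W => beta (sval q).1) p.
Proof.
by apply: smooth_smooth_at; exact: (smooth_comp (@smooth_wfst R _ _ _ TB S) hbeta).
Qed.

Let base_snd (p : W) : fnbhs (fct W) p [set q | vproj S (sval q).2 = wbase q].
Proof. by apply: fnbhsS (fnbhsT _ _) => q _; exact: (wsumP q). Qed.

Let base_beta (p : W) : fnbhs (fct W) p [set q | vproj S (beta (sval q).1) = wbase q].
Proof. by apply: fnbhsS (fnbhsT _ _) => q _; exact: pbeta. Qed.

Lemma smooth_shear : smooth shear.
Proof.
apply: smooth_atP => [|p]; first exact: dclosed_dsub.
have s1 := smooth_smooth_at p (@smooth_wfst R _ _ _ TB S).
have s2 := smooth_smooth_at p (@smooth_wsnd R _ _ _ TB S).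
have sb := smooth_smooth_at p (@smooth_wbase R _ _ S).
apply: smooth_at_wpair => //.
  exact: (smooth_at_vadd hS sb s2 (smooth_beta1 p) (base_snd p) (base_beta p)).
apply: fnbhsS (fnbhsT _ _) => q _.
by apply: eq_trans (proj_add hS (pb q)) _; exact: wsumP.
Qed.

Lemma smooth_unshear : smooth unshear.
Proof.
apply: smooth_atP => [|p]; first exact: dclosed_dsub.
have s1 := smooth_smooth_at p (@smooth_wfst R _ _ _ TB S).
have s2 := smooth_smooth_at p (@smooth_wsnd R _ _ _ TB S).
have sb := smooth_smooth_at p (@smooth_wbase R _ _ S).
apply: smooth_at_wpair => //.
  have sN := smooth_at_vscale hS sb (-1) (smooth_beta1 p) (base_beta p).
  apply: (smooth_at_vadd hS sb s2 sN (base_snd p)).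
  by apply: fnbhsS (base_beta p) => q /= <-; rewrite (proj_scale hS).
apply: fnbhsS (fnbhsT _ _) => q _.
by apply: eq_trans (proj_sub hS (pb q)) _; exact: wsumP.
Qed.

End shears.

Section morita.
Context {R : realType} {L : vbgroupoid R} (hL : line_bundle_groupoid L).
Local Notation G := (vbase L).
Local Notation LL := (vtop L).
Local Notation SA := (varr L).
Local Notation SO := (vobj L).
Local Notation TA := (tbundle (arr G)).
Local Notation TO := (tbundle (obj G)).

Let hA : vector_bundle 1 SA := vg_arr hL.
Let hO : vector_bundle 1 SO := vg_obj hL.
Let gL : lie_groupoid LL := vg_top hL.
Let gG : lie_groupoid G := vg_base hL.
Let cA : dclosed (arr G) := arr_closed hL.
Let cO : dclosed (obj G) := obj_closed hL.
Let sourceG : smooth (@src R G). Proof. by have [] := lg_src gG. Qed.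
Let targetG : smooth (@tgt R G). Proof. by have [] := lg_tgt gG. Qed.

(** [tangent_fibre_product] excludes the default value of [tmul]. The source is found by
    differentiating the identity between the source of a product and the source of its second
    factor. *)
Lemma tmul_spec (v v' : tspace (arr G)) :
  tmap (@src R G) v = tmap (@tgt R G) v' ->
  tbase (tmul v v') = mul (tbase v) (tbase v') /\
  tmap (@src R G) (tmul v v') = tmap (@src R G) v'.
Proof.
move=> vv'; have [nA mA] := lg_arr gG; have [nO mO] := lg_obj gG.
have := tangent_fibre_product mA mA mO sourceG (lg_tgt gG) vv'.
rewrite /tmul => ex; case: pselect => // {}ex; case: cid => w /= [wv wv'].
pose G2 := dsub (@composable R G).
have s2 : smooth (fun p : G2 => (sval p).2).
  exact: (smooth_comp (@smooth_sval R _ (@composable R G)) (@smooth_snd R _ _)).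
split; first by rewrite tbase_tmap -wv -wv' !tbase_tmap.
have sm : smooth (fun p : G2 => gmul (sval p)) := lg_mul gG.
rewrite (tmap_comp w cA cO sm sourceG) -wv' (tmap_comp w cA cO s2 sourceG).
congr tmap; apply/funext => -[[g h] gh] /=.
exact: (lg_src_mul gG gh).
Qed.

(** * Source and target of a Morita kernel *)

Section kernels.
Context {theta : tspace (arr G) -> arr LL} (htheta : form1 SA theta).

Lemma MKsrcE : @src R (MKgroupoid theta) = @wmap R _ _ _ _ SA SO (@src R LL) (@src R G).
Proof. by apply/funext => -[[v l] p]. Qed.

Lemma MKtgtE : @tgt R (MKgroupoid theta) =
  @wmap R _ _ _ _ SA SO (@tgt R LL) (@tgt R G) \o @shear R _ _ SA theta.
Proof.
apply/funext => p /=; have [_ _ tp _ _] := htheta.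
rewrite /wmap (sval_shear hA tp).
by case: (sval p).
Qed.

Lemma smooth_MKsrc : smooth (@src R (MKgroupoid theta)).
Proof.
by rewrite MKsrcE; have [nO mO] := lg_obj gG; exact: (smooth_wmap (vg_src hL) mO).
Qed.

Lemma smooth_MKtgt : smooth (@tgt R (MKgroupoid theta)).
Proof.
rewrite MKtgtE; have [nO mO] := lg_obj gG; have [st _ tp _ _] := htheta.
exact: (smooth_comp (smooth_shear hA st tp) (smooth_wmap (vg_tgt hL) mO)).
Qed.

(** The translation by [theta] is a diffeomorphism: vectors are lifted through the Whitney sum of
    maps and then moved back by [unshear]. *)
Lemma submersion_MKtgt : submersion (@tgt R (MKgroupoid theta)).
Proof.
split; first exact: smooth_MKtgt.
have [nO mO] := lg_obj gG; have [nA mA] := lg_arr gG; have [st _ tp _ _] := htheta.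
have [_ sub] := submersion_wmap hA hO (vg_tgt hL) (tgt_eq0 hL) mA mO (lg_tgt gG).
rewrite MKtgtE => p w wp; have [v vp vw] := sub _ _ wp.
have ss := smooth_shear hA st tp; have su := smooth_unshear hA st tp.
have cW : dclosed (wsum TA SA) by exact: dclosed_dsub.
exists (tmap (@unshear R _ _ SA theta) v).
  by rewrite tbase_tmap vp (shearK hA tp).
rewrite (tmap_comp v cW _ su); last 2 first.
- exact: dclosed_dsub.
- exact: (smooth_comp ss (smooth_wmap (vg_tgt hL) mO)).
rewrite -[RHS]vw; congr tmap; apply/funext => q /=.
by rewrite (unshearK hA tp).
Qed.

End kernels.

(** * The translation as a map between two Morita kernels *)

Section cohomologous.
Context {theta theta' : tspace (arr G) -> arr LL}.
Context (htheta : form1 SA theta) (htheta' : form1 SA theta').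
Context {alpha : tspace (obj G) -> obj LL} (halpha : form1 SO alpha).
Hypothesis hcoh : forall v, vsub SA (theta v) (theta' v) = d0 alpha v.

Local Notation K := (MKgroupoid theta).
Local Notation K' := (MKgroupoid theta').
Local Notation salpha := (src_pullback alpha).

Let ps v : vproj SA (salpha v) = tbase v := (src_pullback_spec hL halpha v).1.
Let qs v : src (salpha v) = alpha (tmap (@src R G) v) := (src_pullback_spec hL halpha v).2.
Let ss : smooth salpha := smooth_src_pullback hL halpha.
Let pa w : vproj SO (alpha w) = tbase w := form_proj halpha w.
Let sa : smooth alpha. Proof. by have [] := halpha. Qed.

Local Notation F := (@MKmap R L alpha).
Local Notation F0 := (@shear R _ _ SO alpha).
Local Notation F' := (@unshear R _ _ SA salpha).

Lemma MKmapE : F = @shear R _ _ SA salpha.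
Proof. by apply/funext => -[[v l] p]. Qed.

Lemma coh_add v : vadd SA (theta' v) (salpha v) =
  vadd SA (theta v) (tgt_pullback alpha v).
Proof.
have [_ _ tp _ _] := htheta; have [_ _ tp' _ _] := htheta'.
have [pt _] := tgt_pullback_spec hL halpha v.
by apply: (vsub_eq_add hA); rewrite ?tp ?tp' ?ps ?pt//; exact: hcoh.
Qed.

Let vb_src : vb_morphism SA SO (@src R LL) (@src R G) := vg_src hL.
Let vb_tgt : vb_morphism SA SO (@tgt R LL) (@tgt R G) := vg_tgt hL.

Lemma MKmap_src (p : arr K) : src (F p : arr K') = F0 (src p).
Proof.
rewrite MKmapE !MKsrcE; apply: wsum_ext.
rewrite (sval_wmap vb_src) (sval_shear hO pa) (sval_wmap vb_src).
rewrite (sval_shear hA ps)/=; congr pair.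
by rewrite (line_map_add vb_src) ?qs// ps; exact: (wsumP p).
Qed.

Lemma MKmap_tgt (p : arr K) : tgt (F p : arr K') = F0 (tgt p).
Proof.
have [_ _ tp _ _] := htheta; have [_ _ tp' _ _] := htheta'.
have p2 := wsumP p; set v := (sval p).1 in p2; set l := (sval p).2 in p2.
have [pt qt] := tgt_pullback_spec hL halpha v.
rewrite MKmapE !MKtgtE//; apply: wsum_ext.
rewrite [LHS](sval_wmap vb_tgt) (sval_shear hO pa) [in RHS](sval_wmap vb_tgt).
rewrite (sval_shear hA tp) (sval_shear hA tp') (sval_shear hA ps)/= -/v -/l.
congr pair; rewrite -qt -(line_map_add vb_tgt); last first.
  by rewrite (proj_add hA) ?tp ?pt ?p2.
congr tgt.
have [pl1 pl2 pl3] : [/\ vproj SA (salpha v) = vproj SA l,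
  vproj SA (theta' v) = vproj SA l & vproj SA (theta v) = vproj SA l].
  by rewrite ps tp tp' p2.
(* Once the common summand [l] is split off, [coh_add] remains, up to the order of summands. *)
rewrite -(vaddA hA) ?pl1 ?pl2// -(vaddA hA) ?pl3 ?pt ?p2//; congr vadd.
rewrite -coh_add; have [phi P] := vb_fibre_coord hA (vproj SA l).
apply: (fc_inj P); rewrite ?(proj_add hA) ?pl1 ?pl2//.
by rewrite !(fc_add P)// addrC.
Qed.

(** The tangent components are the same term. The line components lie over the same arrow, and both
    have as source the sum of the source of the second line component and [alpha] on the source of
    the second tangent vector. *)
Lemma MKmap_mul (p q : arr K) : src p = tgt q ->
  F (mul p q) = mul (F p : arr K') (F q).
Proof.
have [_ _ tp _ _] := htheta.
rewrite MKsrcE (MKtgtE htheta) => /(congr1 sval).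
rewrite (sval_wmap vb_src) [RHS](sval_wmap vb_tgt) (sval_shear hA tp) => -[vv' _].
have [bv sv] := tmul_spec vv'.
have gh : src (tbase (sval p).1) = tgt (tbase (sval q).1).
  by rewrite -!(tbase_tmap (Y := obj G)) vv'.
have sl : vproj SO (src (sval q).2) = src (mul (tbase (sval p).1) (tbase (sval q).1)).
  by rewrite (src_proj hL) wsumP (lg_src_mul gG).
have [pl ql] := srcinv_spec hL sl.
have sl' : vproj SO (src (vadd SA (sval q).2 (salpha (sval q).1))) =
    src (mul (tbase (sval p).1) (tbase (sval q).1)).
  by rewrite (src_proj hL) (proj_add hA) ?ps ?wsumP// (lg_src_mul gG).
have [pl' ql'] := srcinv_spec hL sl'.
rewrite MKmapE; apply: wsum_ext; rewrite (sval_shear hA ps).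
have mE (K0 : tspace (arr G) -> arr LL) (p' q' : arr (MKgroupoid K0)) : mul p' q' =
  wpair TA SA (tmul (sval p').1 (sval q').1)
    (srcinv (mul (tbase (sval p').1) (tbase (sval q').1)) (src (sval q').2)).
  by rewrite /=; case: (sval p'); case: (sval q').
rewrite !mE (wpairE (S := TA)) ?pl ?bv// !(sval_shear hA ps)/=.
rewrite (wpairE (S := TA)) ?pl' ?bv//; congr pair.
apply: (src_inj hL); first by rewrite (proj_add hA) ?pl ?pl' ?ps ?bv.
rewrite (line_map_add vb_src) ?pl ?ps ?bv// ql ql' qs sv.
by rewrite (line_map_add vb_src) ?qs// ps wsumP.
Qed.

(** As the source map retracts the unit map, [src_pullback alpha] on a unit vector has source
    [alpha] of that vector. *)
Lemma MKmap_unt (x : obj K) : F (unt x) = unt (F0 x : obj K').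
Proof.
have [_ su up uD _] := vg_unt hL.
have xp : vproj SO (sval x).2 = tbase (sval x).1 := wsumP x.
have uE (K0 : tspace (arr G) -> arr LL) (y : obj (MKgroupoid K0)) : unt y =
    wpair TA SA (tmap (@unt R G) (sval y).1) (unt (sval y).2).
  by rewrite /=; case: (sval y).
have pu (w : tspace (obj G)) (e : obj LL) : vproj SO e = tbase w ->
    vproj SA (unt e) = vproj TA (tmap (@unt R G) w).
  by move=> ew; rewrite up ew /= tbase_tmap.
rewrite MKmapE; apply: wsum_ext; rewrite (sval_shear hA ps) !uE.
rewrite (wpairE (S := TA)); last by exact: pu.
rewrite !(sval_shear hO pa)/= (wpairE (S := TA)); last first.
  by apply: pu; rewrite (proj_add hO) ?pa.
congr pair; have [p1 p2] : vproj SA (unt (sval x).2) = unt (tbase (sval x).1) /\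
    vproj SA (salpha (tmap (@unt R G) (sval x).1)) = unt (tbase (sval x).1).
  by rewrite up ps tbase_tmap xp.
apply: (src_inj hL).
  by rewrite (proj_add hA) ?p1 ?p2// up (proj_add hO) ?pa ?xp.
rewrite (line_map_add vb_src) ?p1 ?p2// qs (tmap_comp _ cA cO su sourceG).
have -> : @src R G \o @unt R G = (fun y => y).
  by apply/funext => y; exact: lg_src_unt gG y.
by rewrite tmap_id// !(lg_src_unt gL).
Qed.

Lemma smooth_MKmap : smooth F.
Proof. by rewrite MKmapE; exact: smooth_shear. Qed.

Lemma MKmap_vb : vb_morphism (whitney TA SA) (whitney TA SA) F (fun g : arr G => g).
Proof.
have wP (q : MKarr L) : vproj SA (sval q).2 = tbase (sval q).1 := wsumP q.
have bA (p q : MKarr L) : tbase (sval p).1 = tbase (sval q).1 ->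
    vproj SA (vadd SA (sval p).2 (sval q).2) =
    vproj TA (vadd TA (sval p).1 (sval q).1).
  by move=> pq; rewrite (proj_add hA) ?wP//= tbase_mktvec.
have bZ a (p : MKarr L) : vproj SA (vscale SA a (sval p).2) =
    vproj TA (vscale TA a (sval p).1).
  by rewrite (proj_scale hA) wP/= tbase_mktvec.
rewrite MKmapE; split=> [|||p q pq|a p].
- by rewrite -MKmapE; exact: smooth_MKmap.
- exact: smooth_id.
- by move=> p; rewrite /= (sval_shear hA ps).
- apply: wsum_ext; rewrite (sval_shear hA ps) /= !(sval_shear hA ps)/=.
  rewrite (wpairE (S := TA)) ?bA// (wpairE (S := TA))/=; last first.
    by rewrite !(proj_add hA) ?ps ?wP//= tbase_mktvec.
  congr pair; rewrite (src_pullback_add hL halpha)//.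
  by rewrite (vaddACA hA) ?ps ?wP.
- apply: wsum_ext; rewrite (sval_shear hA ps) /= !(sval_shear hA ps)/=.
  rewrite (wpairE (S := TA)) ?bZ// (wpairE (S := TA))/=; last first.
    by rewrite (proj_scale hA) (proj_add hA) ?ps ?wP//= tbase_mktvec.
  congr pair; rewrite (src_pullback_scale hL halpha) (vscaleDr hA)//.
  by rewrite ps wP.
Qed.

Lemma MKmap_morphism : @groupoid_morphism R K K' F F0.
Proof.
split; [exact: smooth_MKmap|exact: smooth_shear|exact: MKmap_src|exact: MKmap_tgt| |].
- exact: MKmap_mul.
- exact: MKmap_unt.
Qed.

(** The inverse forgets the two objects and applies [unshear] to the arrow; the objects are
    recovered because the map on objects is injective. *)
Lemma MKmap_fully_faithful : @fully_faithful R K K' F F0.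
Proof.
have cW : dclosed (arr K) by exact: dclosed_dsub.
have sF := smooth_MKmap.
have sf : @smooth R (arr K) (dprod (dprod (obj K) (obj K)) (arr K'))
    (fun h => ((src h, tgt h), F h)).
  apply: smooth_dprod => //; apply: smooth_dprod => //.
    exact: smooth_MKsrc.
  exact: smooth_MKtgt.
split=> [p _||]; first by split; [exact: MKmap_src|exact: MKmap_tgt].
  exact: (smooth_comp (@smooth_sval R (arr K) setT) sf).
exists (fun y => F' y.2); split=> //.
- apply: smooth_comp (smooth_unshear hA ss ps).
  exact: (smooth_comp (@smooth_sval R _ _) (@smooth_snd R _ _)).
- by move=> p _; rewrite /= MKmapE (shearK hA ps).
- move=> [[x y] p] [px py].
  have FF : F (F' p) = p by rewrite MKmapE (unshearK hA ps).
  have Ex : F0 (src (F' p : arr K)) = F0 x by rewrite -MKmap_src FF.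
  have Ey : F0 (tgt (F' p : arr K)) = F0 y by rewrite -MKmap_tgt FF.
  rewrite -[LHS]/((src (F' p : arr K), tgt (F' p : arr K)), F (F' p)) FF.
  congr (_, _, _).
    by rewrite -[LHS](shearK hO pa) Ex (shearK hO pa).
  by rewrite -[LHS](shearK hO pa) Ey (shearK hO pa).
Qed.

(** The map on objects is bijective, so a point of [P] is an arrow [k] together with the preimage of
    its source. Under this identification [j] the map to be studied is the target map of the second
    kernel. *)
Lemma MKmap_essentially_surjective : @essentially_surjective R K K' F0.
Proof.
have cW' : dclosed (arr K') by exact: dclosed_dsub.
have [st' _ tp' _ _] := htheta'.
pose F0' := @unshear R _ _ SO alpha.
have F0K x : F0 (F0' x) = x by exact: (unshearK hO pa).
pose P : set (dprod (arr K') (obj K)) := [set p | @src R K' p.1 = F0 p.2].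
have jP (k : arr K') : P (k, F0' (src k)) by rewrite /P /= F0K.
pose j (k : arr K') : dsub P := exist _ (k, F0' (src k)) (jP k).
have sj : smooth j.
  apply: smooth_atP => // k; apply: smooth_at_dsub; apply: smooth_smooth_at.
  apply: (@smooth_dprod R (arr K') (arr K') (obj K) (fun k => k)
    (fun k => F0' (src k))) => //.
  exact: (smooth_comp (smooth_MKsrc (theta := theta')) (smooth_unshear hO sa pa)).
have [stgt subt] := submersion_MKtgt htheta'.
have sq : smooth (fun p : dsub P => tgt (sval p).1).
  apply: smooth_comp stgt.
  exact: (smooth_comp (@smooth_sval R _ P) (@smooth_fst R _ _)).
split.
- move=> x.
  (* The unit at [x] is corrected by [theta'], so that its target is [x] even if
     [theta'] does not vanish on units. *)
  pose u := wpair TA SA (tmap (@unt R G) (sval x).1) (unt (sval x).2).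
  exists (j (@unshear R _ _ SA theta' u)).
  have [_ su up _ _] := vg_unt hL.
  rewrite /= -[LHS]/(@tgt R K' _) MKtgtE//= (unshearK hA tp').
  apply: (@wsum_ext R _ _ _ TO SO); rewrite (sval_wmap vb_tgt) /u (wpairE (S := TA)); last first.
    by rewrite up wsumP /= tbase_tmap.
  rewrite /= (tmap_comp _ cA cO su targetG).
  have -> : @tgt R G \o @unt R G = (fun y => y).
    by apply/funext => y; exact: lg_tgt_unt gG y.
  by rewrite tmap_id// (lg_tgt_unt gL); case: (sval x).
- split=> // p w wp.
  have [v vp vw] := subt _ _ wp.
  have jp : j (sval p).1 = p.
    case: p {wp vp} => -[k y] py; apply: eq_exist.
    have py' : @src R K' k = F0 y := py.
    by rewrite -[LHS]/(k, F0' (@src R K' k)) py' /F0' (shearK hO pa).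
  have cP : dclosed (dsub P) by exact: dclosed_dsub.
  exists (tmap j v); first by rewrite tbase_tmap vp jp.
  by rewrite (tmap_comp v cP _ sj sq)//; exact: dclosed_dsub.
Qed.

Lemma MKmap_morita :
  @vb_morita_map R (morita_kernel theta) (morita_kernel theta') F idfun.
Proof.
exists F0, idfun; split; first exact: MKmap_vb.
- exact: MKmap_morphism.
- by split.
- split; [exact: MKmap_morphism|exact: MKmap_fully_faithful|exact: MKmap_essentially_surjective].
Qed.

End cohomologous.

End morita.

Theorem proposition5p9 (R : realType) (L : vbgroupoid R)
    (hL : line_bundle_groupoid L)
    (theta theta' : tspace (arr (vbase L)) -> arr (vtop L))
    (htheta : form1 (varr L) theta) (htheta' : form1 (varr L) theta')
    (mtheta : multiplicative theta) (mtheta' : multiplicative theta')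
    (alpha : tspace (obj (vbase L)) -> obj (vtop L))
    (halpha : form1 (vobj L) alpha)
    (hcoh : forall v, vsub (varr L) (theta v) (theta' v) = d0 alpha v) :
  @vb_morita_map R (morita_kernel theta) (morita_kernel theta')
    (@MKmap R L alpha) idfun.
Proof. exact: MKmap_morita. Qed.
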